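(* Consider the Cauchy problem $$\partial_t^2\phi-\Delta\phi=F(t,x)\ \text{ in } \mathbb{R}_+\times\mathbb{R}^3,\qquad \phi(0,x)=\partial_t\phi(0,x)=0,\quad x\in\mathbb{R}^3,$$ and suppose that $\operatorname{supp} F\subset\{|x|\le t+1\}$. Then, with $r=|x|$, $$\sup_{t}\Big(\big\|(t+2-r)^{s/2}\nabla_{t,x}\phi\big\|_{L^2(\mathbb{R}^3)}+\Big\|(t+2-r)^{s/2}\frac{\phi}{r}\Big\|_{L^2(\mathbb{R}^3)}+\Big\|(t+2-r)^{s/2}\frac{\nabla_{S^2}\phi}{r}\Big\|_{L^2(\mathbb{R}^3)}\Big)\le C_\delta\,\big\|(t+2+r)^{s/2}(t+2-r)^{1/2+\delta}F\big\|_{L^2(\mathbb{R}_+\times\mathbb{R}^3)}$$ for any constant $\delta>0$ and $1<s<2$, where $C_\delta$ denotes a positive constant depending on $\delta$.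
   Context: Here $\phi$ is the solution of the stated Cauchy problem, $\nabla_{t,x}=(\partial_t,\nabla_x)$, the supremum is over times $t\ge 0$, and $\nabla_{S^2}$ is the gradient on the unit sphere $S^2$ in the angular variables: in polar coordinates $x=(r\sin\theta\cos\varphi,\,r\sin\theta\sin\varphi,\,r\cos\theta)$ one has $(\nabla_{S^2}\phi)^2=(\partial_\theta\phi)^2+\frac{1}{\sin^2\theta}(\partial_\varphi\phi)^2$.
   Formalization: The constant is allowed to depend on s as well as on δ; a constant depending on δ alone for all 1<s<2 is impossible, since the best constant blows up like (s-1)^{-1/2} as s→1 (take F=f(t+r)χ(t-r)/r with f(v)=v^{-s} truncated). *)

(* Defs.v *)
From HB Require Import structures.
From mathcomp Require Import all_boot all_order all_algebra.
From mathcomp Require Import all_classical all_reals all_analysis.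

Set Implicit Arguments.
Unset Strict Implicit.
Unset Printing Implicit Defensive.
Import Order.TTheory GRing.Theory Num.Theory.
Import numFieldNormedType.Exports.
Local Open Scope classical_set_scope.
Local Open Scope ring_scope.

Notation R3 R := (R * R * R)%type.
Notation spacetime R := (R * (R * R * R))%type.

(* The library norm `|x| on a product is the max norm, hence this one. *)
Definition enorm {R : realType} (x : R3 R) : R :=
  Num.sqrt (x.1.1 ^+ 2 + x.1.2 ^+ 2 + x.2 ^+ 2).

Definition dir_t {R : realType} : spacetime R := (1, (0, 0, 0)).
Definition dir_x1 {R : realType} : spacetime R := (0, (1, 0, 0)).
Definition dir_x2 {R : realType} : spacetime R := (0, (0, 1, 0)).
Definition dir_x3 {R : realType} : spacetime R := (0, (0, 0, 1)).

(* f is k times continuously differentiable on the whole of V *)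
Fixpoint is_Ck {R : realType} {V : normedModType R} (k : nat) (f : V -> R)
    : Prop :=
  continuous f /\
  if k is k'.+1 then
    forall v : V, (forall z, derivable f z v) /\ is_Ck k' ('D_v f)
  else True.

Definition laplacian {R : realType} (phi : spacetime R -> R)
    (z : spacetime R) : R :=
  'D_dir_x1 ('D_dir_x1 phi) z + 'D_dir_x2 ('D_dir_x2 phi) z
  + 'D_dir_x3 ('D_dir_x3 phi) z.

(* Classical solutions of class C^2 up to t = 0.  A function is C^2 on the
   closed half-space [0, +oo[ x R^3 iff it is the restriction of a C^2 function
   on R x R^3; phi is such an extension, and its values for t < 0 are
   otherwise unconstrained. *)
Definition solves_wave {R : realType} (F phi : spacetime R -> R) : Prop :=
  [/\ is_Ck 2 phi,
      forall (t : R) (x : R3 R), 0 < t ->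
        'D_dir_t ('D_dir_t phi) (t, x) - laplacian phi (t, x) = F (t, x),
      forall x : R3 R, phi (0, x) = 0
    & forall x : R3 R, 'D_dir_t phi (0, x) = 0].

(* the support of the restriction of F to positive times *)
Definition supp {R : realType} (F : spacetime R -> R) : set (spacetime R) :=
  closure [set z | 0 < z.1 /\ F z != 0].

Definition grad_tx {R : realType} (phi : spacetime R -> R)
    (z : spacetime R) : R :=
  Num.sqrt (('D_dir_t phi z) ^+ 2 + ('D_dir_x1 phi z) ^+ 2
            + ('D_dir_x2 phi z) ^+ 2 + ('D_dir_x3 phi z) ^+ 2).

Definition spherical {R : realType} (r theta vphi : R) : R3 R :=
  (r * sin theta * cos vphi, r * sin theta * sin vphi, r * cos theta).

Definition colatitude {R : realType} (x : R3 R) : R := acos (x.2 / enorm x).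

Definition longitude {R : realType} (x : R3 R) : R :=
  let a := acos (x.1.1 / Num.sqrt (x.1.1 ^+ 2 + x.1.2 ^+ 2)) in
  if 0 <= x.1.2 then a else - a.

Lemma div_sqrtDsqr_itv {R : realType} (a b : R) :
  0 <= b -> -1 <= a / Num.sqrt (a ^+ 2 + b) <= 1.
Proof.
move=> b0; have [->|c0] := eqVneq (Num.sqrt (a ^+ 2 + b)) 0.
  by rewrite invr0 mulr0 lerN10 ler01.
have cp : 0 < Num.sqrt (a ^+ 2 + b) by rewrite lt_neqAle eq_sym c0 sqrtr_ge0.
rewrite -ler_norml normrM normfV (gtr0_norm cp) ler_pdivrMr// mul1r.
by rewrite -sqrtr_sqr ler_wsqrtr// lerDl.
Qed.

Lemma sin_acos_div_sqrt {R : realType} (a b : R) : 0 <= b ->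
  Num.sqrt (a ^+ 2 + b) * sin (acos (a / Num.sqrt (a ^+ 2 + b))) = Num.sqrt b.
Proof.
move=> b0; have ab0 : 0 <= a ^+ 2 + b by rewrite addr_ge0// sqr_ge0.
rewrite sin_acos ?div_sqrtDsqr_itv// -sqrtrM// exprMn exprVn sqr_sqrtr//.
have [ab|ab] := eqVneq (a ^+ 2 + b) 0.
  rewrite ab mul0r; congr Num.sqrt; apply/esym/eqP.
  by move/eqP: ab; rewrite paddr_eq0 ?sqr_ge0// => /andP[].
by rewrite mulrBr mulr1 mulrCA mulfV// mulr1 addrC addKr.
Qed.

Lemma cos_acos_div_sqrt {R : realType} (a b : R) : 0 <= b ->
  Num.sqrt (a ^+ 2 + b) * cos (acos (a / Num.sqrt (a ^+ 2 + b))) = a.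
Proof.
move=> b0; have ab0 : 0 <= a ^+ 2 + b by rewrite addr_ge0// sqr_ge0.
rewrite acosK ?in_itv/= ?div_sqrtDsqr_itv//.
have [ab|ab] := eqVneq (Num.sqrt (a ^+ 2 + b)) 0; last by rewrite mulrCA mulfV ?mulr1.
rewrite ab mul0r; apply/esym/eqP; rewrite -sqrf_eq0.
move/eqP: ab; rewrite sqrtr_eq0 => ab.
have /eqP : a ^+ 2 + b = 0 by apply/eqP; rewrite eq_le ab ab0.
by rewrite paddr_eq0 ?sqr_ge0// => /andP[].
Qed.

Lemma spherical_anglesK {R : realType} (x : R3 R) :
  spherical (enorm x) (colatitude x) (longitude x) = x.
Proof.
case: x => [[x y] z]; rewrite /spherical /colatitude /longitude /enorm /=.
have xy0 : 0 <= x ^+ 2 + y ^+ 2 by rewrite addr_ge0// sqr_ge0.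
rewrite (addrC _ (z ^+ 2)) sin_acos_div_sqrt// cos_acos_div_sqrt//.
have [y0|y0] := leP 0 y.
  by rewrite cos_acos_div_sqrt ?sin_acos_div_sqrt ?sqr_ge0// sqrtr_sqr ger0_norm.
rewrite cosN sinN mulrN cos_acos_div_sqrt ?sin_acos_div_sqrt ?sqr_ge0//.
by rewrite sqrtr_sqr ltr0_norm// opprK.
Qed.

(* |nabla_{S^2} f|; only meaningful off the x_3-axis, which is a null set. *)
Definition grad_S2 {R : realType} (f : R3 R -> R) (x : R3 R) : R :=
  let r := enorm x in
  let theta := colatitude x in
  let vphi := longitude x in
  Num.sqrt ((derive1 (fun a => f (spherical r a vphi)) theta) ^+ 2
            + (sin theta ^+ 2)^-1
              * (derive1 (fun b => f (spherical r theta b)) vphi) ^+ 2).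

Section lebesgue_measures.
Local Open Scope ereal_scope.

Lemma product_sigma_finite {d1 d2 : measure_display}
    {T1 : measurableType d1} {T2 : measurableType d2} {R : realType}
    (m1 : {sigma_finite_measure set T1 -> \bar R})
    (m2 : {sigma_finite_measure set T2 -> \bar R}) :
  sigma_finite [set: T1 * T2] (m1 \x m2).
Proof.
have /sigma_finiteP[F [TF ndF Foo]] := sigma_finiteT m1.
have /sigma_finiteP[G [TG ndG Goo]] := sigma_finiteT m2.
exists (fun n => F n `*` G n).
  rewrite -setXTT TF TG predeqE => -[x y]; split.
    move=> [/= [n _ Fnx] [k _ Gky]]; exists (maxn n k) => //; split.
    - by move: x Fnx; exact/subsetPset/ndF/leq_maxl.
    - by move: y Gky; exact/subsetPset/ndG/leq_maxr.
  by move=> [n _ []/= ? ?]; split; exists n.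
move=> k; have [? ?] := Foo k; have [? ?] := Goo k.
split; first exact: measurableX.
by rewrite product_measure1E// lte_mul_pinfty// ge0_fin_numE.
Qed.

Context {R : realType}.

(* Lebesgue measure on R^2, R^3 and R x R^3, on the Borel sigma-algebras.  The
   names carry the sigma-finiteness instances, which inference does not find
   on iterated products. *)
Definition leb2 : set (measurableTypeR R * measurableTypeR R) -> \bar R :=
  @lebesgue_measure R \x @lebesgue_measure R.
HB.instance Definition _ := Measure.on leb2.
HB.instance Definition _ := Measure_isSigmaFinite.Build _ _ _ leb2
  (product_sigma_finite (@lebesgue_measure R) (@lebesgue_measure R)).

Definition leb3 :
    set (measurableTypeR R * measurableTypeR R * measurableTypeR R) -> \bar R :=
  leb2 \x @lebesgue_measure R.
HB.instance Definition _ := Measure.on leb3.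
HB.instance Definition _ := Measure_isSigmaFinite.Build _ _ _ leb3
  (product_sigma_finite leb2 (@lebesgue_measure R)).

Definition leb4 :
    set (measurableTypeR R *
         (measurableTypeR R * measurableTypeR R * measurableTypeR R)) ->
    \bar R :=
  @lebesgue_measure R \x leb3.
HB.instance Definition _ := Measure.on leb4.
HB.instance Definition _ := Measure_isSigmaFinite.Build _ _ _ leb4
  (product_sigma_finite (@lebesgue_measure R) leb3).

End lebesgue_measures.

Definition L2_R3 {R : realType} (f : R3 R -> R) : \bar R :=
  'N[leb3]_2%:E[EFin \o f]%E.

(* norm of L^2(]0, +oo[ x R^3) *)
Definition L2_Rplus_R3 {R : realType} (f : spacetime R -> R) : \bar R :=
  let f0 := f \_ [set z | 0 < z.1] in 'N[leb4]_2%:E[EFin \o f0]%E.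

(* Pitfall: a `^ p = 1 when a < 0.  The weights are only relevant for
   r <= t + 1, outside of which F and phi vanish. *)
Definition wminus {R : realType} (t : R) (x : R3 R) (p : R) : R :=
  (t + 2 - enorm x) `^ p.
Definition wplus {R : realType} (t : R) (x : R3 R) (p : R) : R :=
  (t + 2 + enorm x) `^ p.

Definition energy_norm {R : realType} (s : R) (phi : spacetime R -> R) (t : R)
    : \bar R :=
  let grad_term x := wminus t x (s / 2) * grad_tx phi (t, x) in
  let zero_term x := wminus t x (s / 2) * (phi (t, x) / enorm x) in
  let ang_term x :=
    wminus t x (s / 2) * (grad_S2 (fun y => phi (t, y)) x / enorm x) in
  (L2_R3 grad_term + L2_R3 zero_term + L2_R3 ang_term)%E.

Definition source_norm {R : realType} (s delta : R) (F : spacetime R -> R)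
    : \bar R :=
  L2_Rplus_R3 (fun z => wplus z.1 z.2 (s / 2)
                        * wminus z.1 z.2 (1 / 2 + delta) * F z).

(* Main.v *)
Require Import Defs.
From HB Require Import structures.
From mathcomp Require Import all_boot all_order all_algebra.
From mathcomp Require Import all_classical all_reals all_analysis.
From mathcomp Require Import measurable_realfun ring lra.
Import Order.TTheory GRing.Theory Num.Theory.
Import numFieldNormedType.Exports.
Local Open Scope classical_set_scope.
Local Open Scope ring_scope.

(* Put r = |x|, u = t + 2 - r, v = t + 2 + r, d = min(delta, (s - 1) / 2) and
   gam(w) = 1 + w^(-2d).  The wave equation is multiplied by
     gam(u) v^s (d_t + d_r)(r phi) / r + gam(v) u^s (d_t - d_r)(r phi) / r,
   whose divergence identity has the energy density
     gam(u) v^s ((phi_t + S)^2 + Z) / 2 + gam(v) u^s ((phi_t - S)^2 + Z) / 2,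
   where G = grad (r phi) / r, S = G . x / r and Z = |G|^2 - S^2 is the square
   of the angular gradient over r.  As gam decreases, its derivative yields
   two bulk terms of favourable sign, 2d v^s u^(-1-2d) (phi_t + S)^2 and its
   counterpart 2d u^s v^(-1-2d) (phi_t - S)^2; by AM-GM they absorb the source
   up to v^s u^(1+2d) F^2 / d, since 1 + 2d <= s.  The last bulk term is a
   multiple of Z, of favourable sign because w^s has a concave derivative (the
   trapezoidal rule underestimates its integral) and gam decreases.
   Everything is singular at r = 0 only, so one cuts off at r^2 ~ k; the
   difference of the two weights vanishes at r = 0, so the error is O(1/k) on
   a region of volume O(k^(3/2)), and k -> 0.  Finite speed of propagation
   removes the boundary terms and makes u >= 1.  Finally the divergence of
   u^s x phi^2 / r^2 bounds the integral of u^s phi_r^2 by that of u^s S^2,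
   because u decreases in r; this separates phi_r and phi / r. *)

Set Implicit Arguments.
Unset Strict Implicit.
Unset Printing Implicit Defensive.

(** * Integration over boxes and the divergence theorem *)

(** Without [gam] the multiplier is, for s = 2, the conformal multiplier of Morawetz and, for s = 1,
    the scaling field, both centred at t = -2 and applied to r phi. In these two cases the angular
    bulk term vanishes; strictly between them it has a sign. The bulk terms in (phi_t + S)^2 and
    (phi_t - S)^2 would be zero, since each quantity is transported along the null direction that
    leaves its own power weight constant, and the source would have to be measured in L^1 in time.
    The factor [gam] stays between 1 and 2, because w^(-1-2d) is integrable at infinity, and its
    derivative buys the L^2 norm over space-time at the price 1 / d. Each final time is treated
    separately and the right side covers all times, so the supremum costs nothing. The details are
    shaped by the use of cubes and Cartesian coordinates: every current has to be C^1 on the whole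
    of space-time. Hence r and r^-2 are replaced by functions of r^2 that are C^1 at the origin and
    agree with them where r^2 >= k, and 1 / r is always written as the product of these two. *)

Lemma rational_ball {R : realType} (x : R) (e : R) : 0 < e ->
  exists q : rat, ball (ratr q : R) e x.
Proof.
move=> e0; have /rat_in_itvoo[q] : x - e < x + e by lra.
rewrite in_itv/= => /andP[q1 q2]; exists q.
by rewrite /ball/= ltr_distlC; lra.
Qed.

(** The sigma-algebra is the product one, so an open set is exhibited as the countable union of the
    balls with rational centre and radius [1 / (n + 1)] that it contains; in the product metric such
    a ball is a box of four intervals. *)
Lemma open_measurable_spacetime {R : realType} (O : set (spacetime R)) :
  open O ->
  measurable (O : set (measurableTypeR R * (measurableTypeR R *
    measurableTypeR R * measurableTypeR R))).
Proof.
move=> oO.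
pose pt (q : rat * (rat * rat * rat)) : spacetime R :=
  (ratr q.1, (ratr q.2.1.1, ratr q.2.1.2, ratr q.2.2)).
pose P (i : nat * (rat * (rat * rat * rat))) :=
  ball (pt i.2) (i.1.+1%:R^-1) `<=` O.
pose B (i : nat * (rat * (rat * rat * rat))) : set (spacetime R) :=
  if pselect (P i) then ball (pt i.2) (i.1.+1%:R^-1) else set0.
have -> : O = \bigcup_i B i.
  apply/seteqP; split => [z Oz|z [i _]]; last first.
    by rewrite /B; case: pselect => // Pi; exact: Pi.
  have : nbhs z O by move: oO; rewrite openE => /(_ z Oz).
  move=> /nbhs_ballP[e /= e0 eO].
  have [n ne] : exists n, n.+1%:R^-1 < e / 2 :> R.
    have [n] : exists n, 0 + n.+1%:R^-1 < e / 2 :> R by apply: ltr_add_invr; lra.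
    by rewrite add0r => h; exists n.
  have n0 : 0 < n.+1%:R^-1 :> R by rewrite invr_gt0.
  have [q0 h0] := rational_ball z.1 n0.
  have [q1 h1] := rational_ball z.2.1.1 n0.
  have [q2 h2] := rational_ball z.2.1.2 n0.
  have [q3 h3] := rational_ball z.2.2 n0.
  have zq : ball (pt (q0, (q1, q2, q3))) n.+1%:R^-1 z by [].
  exists (n, (q0, (q1, q2, q3))) => //; rewrite /B; case: pselect => //= nP.
  exfalso; apply: nP => y /= qy; apply: eO.
  rewrite (splitr e); apply: (@ball_triangle _ _ (pt (q0, (q1, q2, q3)))).
    by apply: ball_sym; apply: (le_ball (ltW ne)); exact: zq.
  by apply: (le_ball (ltW ne)); exact: qy.
apply: countable_bigcupT_measurable; [exact: countableP|move=> i]; rewrite /B; case: pselect => [Pi|_] /=; last exact: measurable0.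
have -> : ball (pt i.2) i.1.+1%:R^-1 =
  ball (ratr i.2.1 : R) i.1.+1%:R^-1 `*` ((ball (ratr i.2.2.1.1 : R) i.1.+1%:R^-1
  `*` ball (ratr i.2.2.1.2 : R) i.1.+1%:R^-1) `*` ball (ratr i.2.2.2 : R) i.1.+1%:R^-1) by [].
by apply: measurableX; [|apply: measurableX; [apply: measurableX|]]; exact: measurable_ball.
Qed.

Lemma continuous_measurable_spacetime {R : realType} (f : spacetime R -> R) :
  continuous f ->
  measurable_fun [set: measurableTypeR R * (measurableTypeR R *
    measurableTypeR R * measurableTypeR R)] f.
Proof.
move=> /continuousP cf; apply: (measurability _ (RGenOpens.measurableE R)).
move=> _ [_ [a [b ->] <-]]; rewrite setTI; apply: open_measurable_spacetime.
exact/cf/interval_open.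
Qed.

Section fubini_on.
Context d1 d2 (T1 : measurableType d1) (T2 : measurableType d2) (R : realType).
Variables (m1 : {sigma_finite_measure set T1 -> \bar R})
          (m2 : {sigma_finite_measure set T2 -> \bar R}).
Variables (A : set T1) (B : set T2) (f : T1 * T2 -> \bar R).
Hypotheses (mA : measurable A) (mB : measurable B).
Hypothesis intf : (m1 \x m2)%E.-integrable (A `*` B) f.

Let intf_mkcond : (m1 \x m2)%E.-integrable setT (f \_ (A `*` B)).
Proof. by rewrite -integrable_mkcond//; exact: measurableX. Qed.

(** Extension of [f] by zero off the rectangle reduces this, and the other order below, to Fubini on
    the whole spaces. *)
Lemma integral12_setX :
  (\int[m1 \x m2]_(z in A `*` B) f z = \int[m1]_(x in A) \int[m2]_(y in B) f (x, y))%E.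
Proof.
rewrite integral_mkcond -integral12_prod_meas1// [in RHS]integral_mkcond.
apply: eq_integral => x _; rewrite /fubini_F patchE; case: ifPn => xA.
  rewrite [in RHS]integral_mkcond; apply: eq_integral => y _; rewrite !patchE.
  by rewrite in_setX xA.
by apply: integral0_eq => y _; rewrite patchE in_setX (negbTE xA).
Qed.

Lemma integral21_setX :
  (\int[m1 \x m2]_(z in A `*` B) f z = \int[m2]_(y in B) \int[m1]_(x in A) f (x, y))%E.
Proof.
rewrite integral_mkcond -integral21_prod_meas1// [in RHS]integral_mkcond.
apply: eq_integral => y _; rewrite /fubini_G patchE; case: ifPn => yB.
  rewrite [in RHS]integral_mkcond; apply: eq_integral => x _; rewrite !patchE.
  by rewrite in_setX yB andbT.
by apply: integral0_eq => x _; rewrite patchE in_setX (negbTE yB) andbF.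
Qed.
End fubini_on.

Definition seg {R : realType} (N : R) : set (measurableTypeR R) := `[- N, N]%classic.
Definition box2 {R : realType} (N : R) := seg N `*` seg N.
Definition box3 {R : realType} (N : R) := box2 N `*` seg N.
(** Open at t = 0, since the wave equation is assumed only for positive times. *)
Definition slab {R : realType} (T N : R) :
  set (measurableTypeR R * (measurableTypeR R * measurableTypeR R * measurableTypeR R)) :=
  `]0, T]%classic `*` box3 N.

Section box_integrals.
Context {R : realType}.
Implicit Types (N T t : R) (f : spacetime R -> R).

Lemma measurable_seg N : measurable (seg N).
Proof. exact: measurable_itv. Qed.
Lemma measurable_box2 N : measurable (box2 N).
Proof. by apply: measurableX; exact: measurable_seg. Qed.
Lemma measurable_box3 N : measurable (box3 N).
Proof. by apply: measurableX; [exact: measurable_box2|exact: measurable_seg]. Qed.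
Lemma measurable_slab T N : measurable (slab T N).
Proof. by apply: measurableX; [exact: measurable_itv|exact: measurable_box3]. Qed.

Lemma box3P N (x : R3 R) :
  box3 N x <-> [/\ `|x.1.1| <= N, `|x.1.2| <= N & `|x.2| <= N].
Proof.
rewrite /box3/= /box2/= /seg/= !in_itv/= -!ler_norml.
by split=> [[[]]|[]].
Qed.

Lemma leb1_seg N : 0 <= N -> lebesgue_measure (seg N) = (2 * N)%:E.
Proof.
move=> N0; rewrite /seg lebesgue_measure_itv/= lte_fin.
have [->|nN] := eqVneq N 0; first by rewrite oppr0 ltxx mulr0.
have N1 : 0 < N by rewrite lt_neqAle eq_sym nN.
have -> : - N < N by lra.
by rewrite -EFinD; congr EFin; ring.
Qed.

Lemma leb2_box2 N : 0 <= N -> leb2 (box2 N) = (4 * N ^+ 2)%:E.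
Proof.
move=> N0; rewrite /leb2 product_measure1E; [|exact: measurable_seg..].
rewrite (_ : 4 * N ^+ 2 = (2 * N) * (2 * N)); last by ring.
by rewrite EFinM; congr (_ * _)%E; exact: leb1_seg.
Qed.

Lemma leb3_box3 N : 0 <= N -> leb3 (box3 N) = (8 * N ^+ 3)%:E.
Proof.
move=> N0; rewrite /leb3 product_measure1E; [|exact: measurable_box2|exact: measurable_seg].
rewrite (_ : 8 * N ^+ 3 = (4 * N ^+ 2) * (2 * N)); last by ring.
by rewrite EFinM; congr (_ * _)%E; [exact: leb2_box2|exact: leb1_seg].
Qed.

Lemma leb4_slab T N : 0 <= T -> 0 <= N -> leb4 (slab T N) = (T * (8 * N ^+ 3))%:E.
Proof.
move=> T0 N0; rewrite /leb4 product_measure1E; [|exact: measurable_itv|exact: measurable_box3].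
rewrite EFinM; congr (_ * _)%E; last exact: leb3_box3.
rewrite [LHS]lebesgue_measure_itv/= lte_fin.
have [->|nT] := eqVneq T 0; first by rewrite ltxx.
by rewrite lt_neqAle eq_sym nT T0/= -EFinD subr0.
Qed.

Lemma continuous_bounded_box f (a b N : R) : continuous f ->
  exists2 M, 0 < M & forall t x, a <= t <= b -> box3 N x -> `|f (t, x)| <= M.
Proof.
move=> cf.
pose K : set (spacetime R) := `[a, b]%classic `*` ((`[- N, N]%classic `*` `[- N, N]%classic) `*` `[- N, N]%classic).
have cK : compact K.
  by apply: compact_setX; [|apply: compact_setX; [apply: compact_setX|]]; exact: segment_compact.
have /compact_bounded[M [_ MfK]] : compact (f @` K).
  by apply: continuous_compact => //; exact: continuous_subspaceT.
exists (`|M| + 1); first by rewrite ltr_wpDl.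
move=> t x tab xN; apply: MfK; first by rewrite ltr_pwDr// ler_norm.
by exists (t, x) => //; split => //=; rewrite in_itv.
Qed.

Lemma measurable_slice f t : continuous f ->
  measurable_fun [set: measurableTypeR R * measurableTypeR R * measurableTypeR R]
    (fun x => f (t, x)).
Proof.
move=> /continuous_measurable_spacetime mf.
by apply: (measurableT_comp mf); exact: pair1_measurable.
Qed.

Lemma integrable_bounded d (T : measurableType d) (mu : {measure set T -> \bar R})
    (A : set T) (g : T -> R) (M : R) :
  measurable A -> (mu A < +oo)%E -> measurable_fun setT g ->
  (forall x, A x -> `|g x| <= M) -> mu.-integrable A (EFin \o g).
Proof.
move=> mA muA mg gM; apply: measurable_bounded_integrable => //.
  exact: measurable_funS mg.
exists M; split; first exact: num_real.
by move=> M' MM' x Ax; apply: le_trans (ltW MM'); exact: gM.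
Qed.

Lemma integrable_slab f T N : 0 <= T -> 0 <= N -> continuous f ->
  leb4.-integrable (slab T N) (EFin \o f).
Proof.
move=> T0 N0 cf; have [M M0 Mf] := @continuous_bounded_box f 0 T N cf.
apply: (integrable_bounded (M := M)).
- exact: measurable_slab.
- by have := ltry (T * (8 * N ^+ 3)); rewrite -(leb4_slab T0 N0).
- exact: continuous_measurable_spacetime.
- move=> [t x] [/= tT xN]; apply: Mf => //.
  by move: tT; rewrite in_itv/= => /andP[/ltW -> ->].
Qed.

Lemma integrable_box3 f t N : 0 <= N -> continuous f ->
  leb3.-integrable (box3 N) (fun x => (f (t, x))%:E).
Proof.
move=> N0 cf; have [M M0 Mf] := @continuous_bounded_box f t t N cf.
apply: (integrable_bounded (M := M)).
- exact: measurable_box3.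
- by have := ltry (8 * N ^+ 3); rewrite -(leb3_box3 N0).
- exact: measurable_slice.
- by move=> x xN; apply: Mf => //; rewrite lexx.
Qed.

Lemma integrable_box2 f t x3 N : 0 <= N -> continuous f -> seg N x3 ->
  leb2.-integrable (box2 N) (fun x => (f (t, (x, x3)))%:E).
Proof.
move=> N0 cf x3N; have [M M0 Mf] := @continuous_bounded_box f t t N cf.
apply: (integrable_bounded (M := M)).
- exact: measurable_box2.
- by have := ltry (4 * N ^+ 2); rewrite -(leb2_box2 N0).
- by apply: (measurableT_comp (measurable_slice t cf)); exact: pair2_measurable.
- by move=> x xN; apply: Mf => //; rewrite lexx.
Qed.

(** Along an affine line the one-variable difference quotient is literally the directional one.
    Directional derivatives can therefore be fed to the fundamental theorem of calculus and to the
    mean value theorem, with no appeal to differentials. *)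
Lemma is_derive_line (V : normedModType R) (f : V -> R) (c : R -> V) v (s : R) :
  (forall h k, c (h + k) = h *: v + c k) -> derivable f (c s) v ->
  is_derive s 1 (f \o c) ('D_v f (c s)).
Proof.
move=> cv df.
have E : (fun h : R => h^-1 *: (((f \o c) \o shift s) (h *: 1) - (f \o c) s)) =
         (fun h : R => h^-1 *: ((f \o shift (c s)) (h *: v) - f (c s))).
  by apply/funext => h /=; rewrite [h *: 1]mulr1 cv.
by split; rewrite /derivable /derive E.
Qed.

Lemma integral_derive_line (V : normedModType R) (f : V -> R) (c : R -> V) v (a b : R) :
  (forall h k, c (h + k) = h *: v + c k) -> continuous c ->
  (forall z, derivable f z v) -> continuous f -> continuous ('D_v f) -> a < b ->
  (\int[lebesgue_measure]_(x in `[a, b]) ('D_v f (c x))%:E = (f (c b))%:E - (f (c a))%:E)%E.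
Proof.
move=> cv cc df cf cdf ab.
have H s := @is_derive_line V f c v s cv (df _).
have cfc : continuous (f \o c) by move=> x; apply: continuous_comp; [exact: cc|exact: cf].
rewrite (@continuous_FTC2 _ ('D_v f \o c) (f \o c) a b)//.
- by apply: continuous_subspaceT => x; apply: continuous_comp; [exact: cc|exact: cdf].
- split.
  + by move=> x _; have [] := H x.
  + by apply: cvg_at_right_filter; exact: cfc.
  + by apply: cvg_at_left_filter; exact: cfc.
- by move=> x _; rewrite derive1E; have [_ ->] := H x.
Qed.

End box_integrals.

(** * The divergence theorem on cubes and time slabs *)

Section divergence.
Context {R : realType}.
Implicit Types (N T t : R) (f : spacetime R -> R).

Lemma is_C1P (V : normedModType R) (f : V -> R) : is_Ck 1 f <->
  [/\ continuous f, forall v z, derivable f z v & forall v, continuous ('D_v f)].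
Proof.
split=> [[cf df]|[cf df cdf]].
  by split => //= v; have [? []] := df v.
by exact: (conj cf (fun v => conj (df v) (conj (cdf v) Logic.I))).
Qed.

Lemma C1_continuous (V : normedModType R) (f : V -> R) : is_Ck 1 f -> continuous f.
Proof. by move=> /is_C1P[]. Qed.

Lemma C1_derivable (V : normedModType R) (f : V -> R) v z : is_Ck 1 f -> derivable f z v.
Proof. by move=> /is_C1P[_ df _]; exact: df. Qed.

Lemma C1_continuous_derive (V : normedModType R) (f : V -> R) v :
  is_Ck 1 f -> continuous ('D_v f).
Proof. by move=> /is_C1P[_ _ cf]; exact: cf. Qed.

Lemma continuous_pair (U V W : topologicalType) (f : U -> V) (g : U -> W) :
  continuous f -> continuous g -> continuous (fun x => (f x, g x)).
Proof. by move=> cf cg x; apply: (cvg_pair (cf x) (cg x)). Qed.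

(** In this lemma and the next three the order of integration is chosen so that the differentiated
    variable is innermost. *)
Lemma integral_dx1_box3 f t N : 0 < N -> is_Ck 1 f ->
  (forall x, `|x.1.1| = N -> f (t, x) = 0) ->
  (\int[leb3]_(x in box3 N) ('D_dir_x1 f (t, x))%:E = 0)%E.
Proof.
move=> N0 f1 fN.
rewrite /leb3 /box3 integral21_setX; [|exact: measurable_box2|exact: measurable_seg|].
- apply: integral0_eq => x3 x3N.
  rewrite /leb2 /box2 integral21_setX; [|exact: measurable_seg..|].
    apply: integral0_eq => x2 x2N; rewrite /seg.
    rewrite (@integral_derive_line _ _ f (fun x1 => (t, ((x1, x2), x3))) dir_x1).
    + by rewrite !fN ?subee//= ?normrN gtr0_norm.
    + move=> h k; congr pair; [|congr pair; [congr pair|]]; rewrite /= ?[_ *: _]mulr1 ?[_ *: _]mulr0 ?add0r//.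
    + do 3 ?apply: continuous_pair; by move=> ?; (exact: cvg_cst || exact: cvg_id).
    + by move=> z; apply: C1_derivable f1.
    + exact: C1_continuous f1.
    + exact: C1_continuous_derive.
    + by lra.
  by apply: (@integrable_box2 _ ('D_dir_x1 f) t x3 N) => //; [exact: ltW|exact: C1_continuous_derive].
- by apply: (@integrable_box3 _ ('D_dir_x1 f) t N) => //; [exact: ltW|exact: C1_continuous_derive].
Qed.

Lemma integral_dx2_box3 f t N : 0 < N -> is_Ck 1 f ->
  (forall x, `|x.1.2| = N -> f (t, x) = 0) ->
  (\int[leb3]_(x in box3 N) ('D_dir_x2 f (t, x))%:E = 0)%E.
Proof.
move=> N0 f1 fN.
rewrite /leb3 /box3 integral21_setX; [|exact: measurable_box2|exact: measurable_seg|].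
- apply: integral0_eq => x3 x3N.
  rewrite /leb2 /box2 integral12_setX; [|exact: measurable_seg..|].
    apply: integral0_eq => x1 x1N; rewrite /seg.
    rewrite (@integral_derive_line _ _ f (fun x2 => (t, ((x1, x2), x3))) dir_x2).
    + by rewrite !fN ?subee//= ?normrN gtr0_norm.
    + move=> h k; congr pair; [|congr pair; [congr pair|]]; rewrite /= ?[_ *: _]mulr1 ?[_ *: _]mulr0 ?add0r//.
    + do 3 ?apply: continuous_pair; by move=> ?; (exact: cvg_cst || exact: cvg_id).
    + by move=> z; apply: C1_derivable f1.
    + exact: C1_continuous f1.
    + exact: C1_continuous_derive.
    + by lra.
  by apply: (@integrable_box2 _ ('D_dir_x2 f) t x3 N) => //; [exact: ltW|exact: C1_continuous_derive].
- by apply: (@integrable_box3 _ ('D_dir_x2 f) t N) => //; [exact: ltW|exact: C1_continuous_derive].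
Qed.

Lemma integral_dx3_box3 f t N : 0 < N -> is_Ck 1 f ->
  (forall x, `|x.2| = N -> f (t, x) = 0) ->
  (\int[leb3]_(x in box3 N) ('D_dir_x3 f (t, x))%:E = 0)%E.
Proof.
move=> N0 f1 fN.
rewrite /leb3 /box3 integral12_setX; [|exact: measurable_box2|exact: measurable_seg|].
- apply: integral0_eq => x12 x12N; rewrite /seg.
  rewrite (@integral_derive_line _ _ f (fun x3 => (t, (x12, x3))) dir_x3).
  + by rewrite !fN ?subee//= ?normrN gtr0_norm.
  + move=> h k; congr pair; [|congr pair; [|]]; rewrite /= ?[_ *: _]mulr1 ?[_ *: _]mulr0 ?add0r//.
    by case: x12 {x12N} => ? ?; congr pair; rewrite /= [_ *: _]mulr0 add0r.
  + do 2 ?apply: continuous_pair; by move=> ?; (exact: cvg_cst || exact: cvg_id).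
  + by move=> z; apply: C1_derivable f1.
  + exact: C1_continuous f1.
  + exact: C1_continuous_derive.
  + by lra.
- by apply: (@integrable_box3 _ ('D_dir_x3 f) t N) => //; [exact: ltW|exact: C1_continuous_derive].
Qed.

Lemma integral_dt_slab f T N : 0 < T -> 0 < N -> is_Ck 1 f ->
  (forall x, box3 N x -> f (0, x) = 0) ->
  (\int[leb4]_(z in slab T N) ('D_dir_t f z)%:E =
   \int[leb3]_(x in box3 N) (f (T, x))%:E)%E.
Proof.
move=> T0 N0 f1 f0.
rewrite /leb4 /slab integral21_setX; [|exact: measurable_itv|exact: measurable_box3|].
- apply: eq_integral => x /set_mem xN.
  (* The fundamental theorem of calculus is stated on the closed interval; the added end point is a
     null set. *)
  rewrite integral_itv_obnd_cbnd//.
  rewrite (@integral_derive_line _ _ f (fun t => (t, x)) dir_t).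
  + by rewrite f0// sube0.
  + move=> h k; congr pair; rewrite /=; first by rewrite [_ *: _]mulr1.
    case: x xN => [[x1 x2] x3] _; congr pair; last by rewrite /= [_ *: _]mulr0 add0r.
    by congr pair; rewrite /= [_ *: _]mulr0 add0r.
  + by apply: continuous_pair => ?; (exact: cvg_cst || exact: cvg_id).
  + by move=> z; apply: C1_derivable f1.
  + exact: C1_continuous f1.
  + exact: C1_continuous_derive.
  + by [].
  + apply: measurable_funTS; apply/measurable_EFinP.
    apply: (@measurableT_comp _ _ _ _ _ _ ('D_dir_t f) _ (fun t => (t, x))).
      exact: continuous_measurable_spacetime (C1_continuous_derive f1).
    exact: pair2_measurable.
- by apply: (@integrable_slab _ ('D_dir_t f)) => //; [exact: ltW..|exact: C1_continuous_derive].
Qed.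

Lemma integral_space_slab f T N : 0 < T -> 0 < N -> continuous f ->
  (forall t, (0 < t <= T)%R -> \int[leb3]_(x in box3 N) (f (t, x))%:E = 0)%E ->
  (\int[leb4]_(z in slab T N) (f z)%:E = 0)%E.
Proof.
move=> T0 N0 cf f0.
rewrite /leb4 /slab integral12_setX; [|exact: measurable_itv|exact: measurable_box3|].
- by apply: integral0_eq => t /=; rewrite in_itv/=; exact: f0.
- by apply: integrable_slab => //; exact: ltW.
Qed.

(** The six faces are where some |x_i| equals [N]. The condition is met because the cube reaches
    beyond the support of the fields: [T + 1 < N] for the energy and Hardy currents, a backward cone
    inside the cube for finite speed. *)
Let vanishes_on_faces T N (J1 J2 J3 : spacetime R -> R) :=
  forall t x, 0 <= t <= T -> N \in [:: `|x.1.1|; `|x.1.2|; `|x.2|] ->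
  [/\ J1 (t, x) = 0, J2 (t, x) = 0 & J3 (t, x) = 0].

Lemma box_divergence_eq0 t N J1 J2 J3 : 0 < N ->
  is_Ck 1 J1 -> is_Ck 1 J2 -> is_Ck 1 J3 -> vanishes_on_faces t N J1 J2 J3 ->
  0 <= t ->
  (\int[leb3]_(x in box3 N)
    ('D_dir_x1 J1 (t, x) + 'D_dir_x2 J2 (t, x) + 'D_dir_x3 J3 (t, x))%:E = 0)%E.
Proof.
move=> N0 C1 C2 C3 van t0.
have tt : 0 <= t <= t by rewrite t0 lexx.
have I f v : is_Ck 1 f -> leb3.-integrable (box3 N) (fun x => ('D_v f (t, x))%:E).
  by move=> f1; apply: (@integrable_box3 _ ('D_v f)); [exact: ltW|exact: C1_continuous_derive].
under eq_integral do rewrite !EFinD.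
rewrite integralD; [|exact: measurable_box3| |exact: I].
  rewrite integralD; [|exact: measurable_box3|exact: I..].
  rewrite integral_dx1_box3// => [|x xN]; last first.
    by have [] := van t x tt; rewrite // -xN !inE eqxx.
  rewrite integral_dx2_box3// => [|x xN]; last first.
    by have [] := van t x tt; rewrite // -xN !inE eqxx orbT.
  rewrite integral_dx3_box3// => [|x xN]; last first.
    by have [] := van t x tt; rewrite // -xN !inE eqxx !orbT.
  by rewrite !adde0.
by apply: integrableD; [exact: measurable_box3|exact: I|exact: I].
Qed.

(** Integration over the slab: the space divergence contributes nothing, and the time derivative
    leaves only the final slice. The hypothesis is an inequality because the favourable bulk terms
    are discarded pointwise. *)
Lemma box_divergence_le T N P J1 J2 J3 (h : spacetime R -> R) : 0 < T -> 0 < N ->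
  is_Ck 1 P -> is_Ck 1 J1 -> is_Ck 1 J2 -> is_Ck 1 J3 -> continuous h ->
  vanishes_on_faces T N J1 J2 J3 -> (forall x, P (0, x) = 0) ->
  (forall t x, 0 < t <= T -> box3 N x ->
    'D_dir_t P (t, x) + ('D_dir_x1 J1 (t, x) + 'D_dir_x2 J2 (t, x) + 'D_dir_x3 J3 (t, x))
    <= h (t, x)) ->
  (\int[leb3]_(x in box3 N) (P (T, x))%:E <= \int[leb4]_(z in slab T N) (h z)%:E)%E.
Proof.
move=> T0 N0 CP C1 C2 C3 ch van P0 hle.
pose div z := 'D_dir_x1 J1 z + 'D_dir_x2 J2 z + 'D_dir_x3 J3 z.
have cdiv : continuous div.
  move=> z; apply: cvgD; last exact: C1_continuous_derive.
  by apply: cvgD; exact: C1_continuous_derive.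
have div0 : (\int[leb4]_(z in slab T N) (div z)%:E = 0)%E.
  apply: (integral_space_slab T0 N0 cdiv) => t /andP[t0 tT].
  apply: box_divergence_eq0 => //; last exact: ltW.
  move=> t' x /andP[t'0 t't]; apply: van; rewrite t'0/=; exact: le_trans tT.
rewrite -integral_dt_slab// -[leLHS]adde0 -div0 -integralD.
- apply: le_integral => //.
  + exact: measurable_slab.
  + apply: integrableD; first exact: measurable_slab.
    * by apply: (@integrable_slab _ ('D_dir_t P)); [exact: ltW..|exact: C1_continuous_derive].
    * by apply: (integrable_slab _ _ cdiv) => //; exact: ltW.
  + by apply: (integrable_slab _ _ ch) => //; exact: ltW.
  + move=> [t x] /set_mem[/=]; rewrite in_itv/= => tT xN.
    by rewrite -EFinD lee_fin; exact: hle.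
- exact: measurable_slab.
- by apply: (@integrable_slab _ ('D_dir_t P)); [exact: ltW..|exact: C1_continuous_derive].
- by apply: (integrable_slab _ _ cdiv) => //; exact: ltW.
Qed.

Lemma box_divergence_le3 t N J1 J2 J3 (f g : spacetime R -> R) : 0 <= t -> 0 < N ->
  is_Ck 1 J1 -> is_Ck 1 J2 -> is_Ck 1 J3 -> continuous f -> continuous g ->
  vanishes_on_faces t N J1 J2 J3 ->
  (forall x, box3 N x ->
    f (t, x) + ('D_dir_x1 J1 (t, x) + 'D_dir_x2 J2 (t, x) + 'D_dir_x3 J3 (t, x))
    <= g (t, x)) ->
  (\int[leb3]_(x in box3 N) (f (t, x))%:E <= \int[leb3]_(x in box3 N) (g (t, x))%:E)%E.
Proof.
move=> t0 N0 C1 C2 C3 cf cg van hle.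
rewrite -[leLHS]adde0 -(box_divergence_eq0 N0 C1 C2 C3 van t0) -integralD.
- apply: le_integral.
  + exact: measurable_box3.
  + apply: integrableD; first exact: measurable_box3.
    * by apply: (integrable_box3 t _ cf); exact: ltW.
    * apply: (@integrable_box3 _ (fun z => 'D_dir_x1 J1 z + 'D_dir_x2 J2 z + 'D_dir_x3 J3 z)); first exact: ltW.
      move=> z; apply: cvgD; last exact: C1_continuous_derive.
      by apply: cvgD; exact: C1_continuous_derive.
  + by apply: (integrable_box3 t _ cg); exact: ltW.
  + by move=> x /[!inE] xN; rewrite -EFinD lee_fin; exact: hle.
- exact: measurable_box3.
- by apply: (integrable_box3 t _ cf); exact: ltW.
- apply: (@integrable_box3 _ (fun z => 'D_dir_x1 J1 z + 'D_dir_x2 J2 z + 'D_dir_x3 J3 z)); first exact: ltW.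
  move=> z; apply: cvgD; last exact: C1_continuous_derive.
  by apply: cvgD; exact: C1_continuous_derive.
Qed.

End divergence.

(** * Calculus of C^1 functions *)

Section C1_calculus.
Context {R : realType} {V : normedModType R}.
Implicit Types (f g : V -> R) (v z : V).

(** The rules of differentiation are restated for explicit abstractions, the shape on which the
    tactic [der] matches. *)
Lemma derD f g v z df dg : is_derive z v f df -> is_derive z v g dg ->
  is_derive z v (fun z => f z + g z) (df + dg).
Proof. by move=> hf hg; exact: (is_deriveD hf hg). Qed.

Lemma derB f g v z df dg : is_derive z v f df -> is_derive z v g dg ->
  is_derive z v (fun z => f z - g z) (df - dg).
Proof. by move=> hf hg; exact: (is_deriveB hf hg). Qed.

Lemma derN f v z df : is_derive z v f df -> is_derive z v (fun z => - f z) (- df).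
Proof. by move=> hf; exact: (is_deriveN hf). Qed.

Lemma derM f g v z df dg : is_derive z v f df -> is_derive z v g dg ->
  is_derive z v (fun z => f z * g z) (f z * dg + g z * df).
Proof. by move=> hf hg; exact: (is_deriveM hf hg). Qed.

Lemma derC (c : R) v z : is_derive z v (fun=> c) 0.
Proof. exact: is_derive_cst. Qed.

Lemma derX f v z df : is_derive z v f df ->
  is_derive z v (fun z => f z ^+ 2) (2 * f z * df).
Proof.
move=> hf; apply: (is_derive_eq (derM hf hf) _) => //=; ring.
Qed.

(** The difference quotient of [f] along [v] is that of the real function [h |-> f (h *: v + z)] at
    0, to which the one-variable chain rule applies. *)
Lemma der_comp (g dg : R -> R) f v z df :
  is_derive (f z) 1 g (dg (f z)) -> is_derive z v f df ->
  is_derive z v (fun z => g (f z)) (dg (f z) * df).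
Proof.
move=> hg hf.
have E (k : V -> R) : (fun h : R => h^-1 *: ((k \o shift z) (h *: v) - k z)) =
    (fun h : R => h^-1 *: (((fun h : R => k (h *: v + z)) \o shift 0) (h *: 1)
      - (fun h : R => k (h *: v + z)) 0)).
  by apply/funext => h /=; rewrite [h *: 1]mulr1 addr0 scale0r add0r.
have H : is_derive (0 : R) (1 : R) (g \o (fun h : R => f (h *: v + z)) : R -> R) (dg (f z) * df).
  apply: is_derive1_comp; first by rewrite /= scale0r add0r.
  by case: hf => d1 d2; split; rewrite /derivable /derive -E.
by case: H => d1 d2; split; rewrite /derivable /derive E.
Qed.

Lemma der_linear f v z : (forall (h : R) z, f (h *: v + z) = h * f v + f z) ->
  is_derive z v f (f v).
Proof.
move=> lf.
have cv : (fun h : R => h^-1 *: ((f \o shift z) (h *: v) - f z)) @ 0^' --> f v.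
  apply: cvg_near_cst; near=> h.
  rewrite /= lf addrK [_ *: _]mulrA mulVf ?mul1r//.
  by near: h; exact: nbhs_dnbhs_neq.
by split; [apply/cvg_ex; exists (f v)|exact: cvg_lim cv].
Unshelve. all: by end_near. Qed.

Lemma C1_intro f (df : V -> V -> R) : continuous f ->
  (forall v z, is_derive z v f (df v z)) -> (forall v, continuous (df v)) -> is_Ck 1 f.
Proof.
move=> cf hf cdf; apply/is_C1P; split; [exact: cf|by move=> v z; have [] := hf v z|move=> v].
have -> : 'D_v f = df v by apply/funext => z; have [_] := hf v z.
exact: cdf.
Qed.

Lemma C1_is_derive f v z : is_Ck 1 f -> is_derive z v f ('D_v f z).
Proof. by move=> f1; apply/derivableP; exact: C1_derivable. Qed.

Lemma C1_cst (c : R) : is_Ck 1 (fun _ : V => c).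
Proof.
apply: (@C1_intro _ (fun _ _ => 0)) => [|v].
- exact: cst_continuous.
- exact: cst_continuous.
Qed.

Lemma C1D f g : is_Ck 1 f -> is_Ck 1 g -> is_Ck 1 (fun z => f z + g z).
Proof.
move=> f1 g1; apply: (@C1_intro _ (fun v z => 'D_v f z + 'D_v g z)).
- by move=> z; apply: cvgD; exact: C1_continuous.
- by move=> v z; apply: derD; exact: C1_is_derive.
- by move=> v z; apply: cvgD; exact: C1_continuous_derive.
Qed.

Lemma C1N f : is_Ck 1 f -> is_Ck 1 (fun z => - f z).
Proof.
move=> f1; apply: (@C1_intro _ (fun v z => - 'D_v f z)).
- by move=> z; apply: cvgN; exact: C1_continuous.
- by move=> v z; apply: derN; exact: C1_is_derive.
- by move=> v z; apply: cvgN; exact: C1_continuous_derive.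
Qed.

Lemma C1B f g : is_Ck 1 f -> is_Ck 1 g -> is_Ck 1 (fun z => f z - g z).
Proof. by move=> f1 g1; apply: C1D => //; exact: C1N. Qed.

Lemma C1M f g : is_Ck 1 f -> is_Ck 1 g -> is_Ck 1 (fun z => f z * g z).
Proof.
move=> f1 g1; apply: (@C1_intro _ (fun v z => f z * 'D_v g z + g z * 'D_v f z)).
- by move=> z; apply: cvgM; exact: C1_continuous.
- by move=> v z; apply: derM; exact: C1_is_derive.
- by move=> v z; apply: cvgD; apply: cvgM;
    (exact: C1_continuous || exact: C1_continuous_derive).
Qed.

Lemma C1X f : is_Ck 1 f -> is_Ck 1 (fun z => f z ^+ 2).
Proof. by move=> f1; apply: C1M. Qed.

Lemma C1_comp (g dg : R -> R) f : (forall x : R, is_derive x 1 g (dg x)) ->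
  continuous dg -> is_Ck 1 f -> is_Ck 1 (fun z => g (f z)).
Proof.
move=> hg cdg f1.
have cg : continuous g.
  by move=> x; apply/differentiable_continuous/derivable1_diffP; have [] := hg x.
apply: (@C1_intro _ (fun v z => dg (f z) * 'D_v f z)).
- by move=> z; apply: continuous_comp; [exact: C1_continuous|exact: cg].
- by move=> v z; apply: der_comp => //; exact: C1_is_derive.
- move=> v z; apply: cvgM; last exact: C1_continuous_derive.
  by apply: continuous_comp; [exact: C1_continuous|exact: cdg].
Qed.

Lemma C1_linear f : continuous f ->
  (forall v (h : R) z, f (h *: v + z) = h * f v + f z) -> is_Ck 1 f.
Proof.
move=> cf lf; apply: (@C1_intro _ (fun v _ => f v)) => // [v z|v].
  exact: der_linear.
exact: cst_continuous.
Qed.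

Lemma mvt0 (F dF : R -> R) (h : R) : (forall x : R, is_derive x 1 F (dF x)) ->
  exists e : R, `|e| <= `|h| /\ F h - F 0 = h * dF e.
Proof.
move=> hF.
have cF a b : {within `[a, b], continuous F}.
  by apply: derivable_within_continuous => x _; have [] := hF x.
have [h0|h0] := leP 0 h.
  have [e] := MVT_segment h0 (fun s _ => hF s) (cF _ _).
  rewrite in_itv/= => /andP[e0 eh] E; exists e; rewrite !ger0_norm//; split => //.
  by rewrite E subr0 mulrC.
have [e] := MVT_segment (ltW h0) (fun s _ => hF s) (cF _ _).
rewrite in_itv/= => /andP[e0 eh] E; exists e.
rewrite ler0_norm// ltr0_norm// lerN2; split => //.
by rewrite -opprB E; ring.
Qed.

Lemma C1_mvt f v z (h : R) : is_Ck 1 f ->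
  exists e : R, `|e| <= `|h| /\ f (h *: v + z) - f z = h * 'D_v f (e *: v + z).
Proof.
move=> f1; have [|e [eh E]] := @mvt0 (fun s => f (s *: v + z)) (fun s => 'D_v f (s *: v + z)) h.
  move=> s; apply: (@is_derive_line _ _ f (fun s => s *: v + z)); last exact: C1_derivable.
  by move=> a b; rewrite scalerDl addrA.
by exists e; split => //; rewrite -E scale0r add0r.
Qed.

(** The mean value theorem is used along [v] for [y |-> f (h *: w + y) - f y], whose derivative is
    an increment of ['D_v f], and then along [w] for ['D_v f]. *)
Lemma C1_mvt2 f v w z (h : R) : is_Ck 1 f -> is_Ck 1 ('D_v f) ->
  exists a b : R, [/\ `|a| <= `|h|, `|b| <= `|h| &
    f (h *: v + (h *: w + z)) - f (h *: v + z) - f (h *: w + z) + f z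
    = h * (h * 'D_w ('D_v f) (b *: w + (a *: v + z)))].
Proof.
move=> f1 df1; pose g y := f (h *: w + y) - f y.
have tr y (k : V) : is_derive y v (fun y => f (k + y)) ('D_v f (k + y)).
  have E : (fun s : R => s^-1 *: (((fun y => f (k + y)) \o shift y) (s *: v) - f (k + y))) =
           (fun s : R => s^-1 *: ((f \o shift (k + y)) (s *: v) - f (k + y))).
    by apply/funext => s /=; rewrite addrCA.
  by split; rewrite /derivable /derive E//; exact: C1_derivable.
have g1 y : is_derive y v g ('D_v f (h *: w + y) - 'D_v f y).
  by apply: derB => //; exact: C1_is_derive.
pose F (s : R) := g (s *: v + z).
have dF (s : R) : is_derive s 1 F ('D_v g (s *: v + z)).
  apply: (@is_derive_line _ _ g (fun s => s *: v + z)); last by have [] := g1 (s *: v + z).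
  by move=> a b; rewrite scalerDl addrA.
have [a [ah E]] : exists a : R, `|a| <= `|h| /\ g (h *: v + z) - g z = h * 'D_v g (a *: v + z).
  have [a [ah E]] := mvt0 h dF; exists a; split => //.
  by rewrite -E /F scale0r add0r.
have [b [bh E2]] := C1_mvt w (a *: v + z) h df1.
exists a, b; split => //; rewrite -E2.
have [_ <-] := g1 (a *: v + z).
by rewrite -E /g (addrCA (h *: w)); ring.
Qed.

(** The second difference of [C1_mvt2] is symmetric in [v] and [w], so for every step [h] the two
    mixed derivatives take a common value at points within O(h) of [z]; by continuity they cannot
    differ at [z]. *)
Lemma schwarz f v w z : is_Ck 2 f -> 'D_v ('D_w f) z = 'D_w ('D_v f) z.
Proof.
move=> f2.
have f1 : is_Ck 1 f.
  case: f2 => cf df; apply/is_C1P; split => // [u y|u]; first by have [] := df u.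
  by have [_ [? _]] := df u.
have df1 u : is_Ck 1 ('D_u f) by have [_ /(_ u)[]] := f2.
apply/eqP/negP => /negP neq.
pose d := `|'D_v ('D_w f) z - 'D_w ('D_v f) z| / 2.
have d0 : 0 < d by rewrite divr_gt0// normr_gt0 subr_eq0.
have near0 (g : V -> R) u1 u2 : continuous g -> exists2 e : R, 0 < e &
    forall a b : R, `|a| <= e -> `|b| <= e -> `|g z - g (b *: u2 + (a *: u1 + z))| < d.
  move=> cg.
  have cG : continuous (fun p : R * R => g (p.2 *: u2 + (p.1 *: u1 + z))).
    move=> p; apply: continuous_comp; last exact: cg.
    apply: cvgD; first by apply: cvgZr_tmp; exact: cvg_snd.
    by apply: cvgD; [apply: cvgZr_tmp; exact: cvg_fst|exact: cvg_cst].
  have /cvgrPdist_lt/(_ d d0) := cG (0, 0); rewrite /= !scale0r !add0r.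
  move=> /nbhs_ballP[e /= e0 He]; exists (e / 2); first by rewrite divr_gt0.
  have e2 : e / 2 < e by rewrite ltr_pdivrMr// mulr_natr mulr2n ltrDl.
  by move=> a b ae be; apply: (He (a, b)); split => /=; rewrite /ball/= sub0r normrN;
    [exact: le_lt_trans ae e2|exact: le_lt_trans be e2].
have [e1 e10 H1] := near0 _ v w (@C1_continuous_derive _ _ _ w (df1 v)).
have [e2 e20 H2] := near0 _ w v (@C1_continuous_derive _ _ _ v (df1 w)).
pose h := Num.min e1 e2.
have h0 : 0 < h by rewrite lt_min e10.
have hn : `|h| = h by rewrite gtr0_norm.
have [a [b [ah bh E1]]] := @C1_mvt2 f v w z h f1 (df1 v).
have [a' [b' [ah' bh' E2]]] := @C1_mvt2 f w v z h f1 (df1 w).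
rewrite hn in ah bh ah' bh'.
have h1 : h <= e1 by rewrite ge_min lexx.
have h2 : h <= e2 by rewrite ge_min lexx orbT.
have {}H1 := H1 a b (le_trans ah h1) (le_trans bh h1).
have {}H2 := H2 a' b' (le_trans ah' h2) (le_trans bh' h2).
have E : 'D_w ('D_v f) (b *: w + (a *: v + z)) = 'D_v ('D_w f) (b' *: v + (a' *: w + z)).
  apply: (mulfI (lt0r_neq0 h0)); apply: (mulfI (lt0r_neq0 h0)).
  have sw (p q r u : R) : p - q - r + u = p - r - q + u by ring.
  have vz : h *: v + (h *: w + z) = h *: w + (h *: v + z) by exact: addrCA.
  by rewrite vz in E1; apply: (etrans (esym E1)); apply: (etrans _ E2); exact: sw.
rewrite E in H1.
have close (x y c : R) : `|x - c| < d -> `|y - c| < d -> `|x - y| < d + d.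
  move=> xc; rewrite distrC => cy; apply: le_lt_trans (ler_distD c x y) _.
  exact: ltrD.
have := close _ _ _ H2 H1.
by rewrite /d -splitr ltxx.
Qed.

End C1_calculus.

(** * The chain rule along curves and the angular gradient *)

Section chain_rule.
Context {R : realType}.
Implicit Types f : spacetime R -> R.

Lemma lin3 (t : R) (p1 p2 p3 k1 k2 k3 : R) :
  (t, (k1 + p1, k2 + p2, k3 + p3)) = k3 *: dir_x3 + (k2 *: dir_x2 + (k1 *: dir_x1 + (t, (p1, p2, p3)))).
Proof.
rewrite [RHS]surjective_pairing; congr pair; first by rewrite /= ![_ *: 0]mulr0 !add0r.
rewrite [RHS]surjective_pairing; congr pair; last first.
  by rewrite /= ![_ *: 0]mulr0 !add0r [_ *: _]mulr1.
by rewrite [RHS]surjective_pairing; congr pair;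
  rewrite /= ![_ *: 0]mulr0 !add0r [_ *: _]mulr1.
Qed.

(* Only directional derivatives are at hand: the coordinates are moved one at a
   time, with a mean value theorem for each. *)
Lemma is_derive_curve f (t a : R) (c1 c2 c3 : R -> R) (d1 d2 d3 : R) : is_Ck 1 f ->
  is_derive a 1 c1 d1 -> is_derive a 1 c2 d2 -> is_derive a 1 c3 d3 ->
  is_derive a 1 (fun s => f (t, (c1 s, c2 s, c3 s)))
    ('D_dir_x1 f (t, (c1 a, c2 a, c3 a)) * d1
     + 'D_dir_x2 f (t, (c1 a, c2 a, c3 a)) * d2
     + 'D_dir_x3 f (t, (c1 a, c2 a, c3 a)) * d3).
Proof.
move=> f1 h1 h2 h3.
set z : spacetime R := (t, (c1 a, c2 a, c3 a)).
pose k (c : R -> R) s := c (s + a) - c a.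
have [e1 E1] := choice (fun s => C1_mvt dir_x1 z (k c1 s) f1).
have [e2 E2] := choice (fun s => C1_mvt dir_x2 (k c1 s *: dir_x1 + z) (k c2 s) f1).
have [e3 E3] := choice (fun s => C1_mvt dir_x3 (k c2 s *: dir_x2 + (k c1 s *: dir_x1 + z)) (k c3 s) f1).
have quot c d : is_derive a 1 c d -> (fun s : R => s^-1 * k c s) @ 0^' --> d.
  move=> [dc <-]; rewrite /derive; have /cvg_ex[l cl] := dc.
  rewrite (cvg_lim _ cl)//; apply: cvg_trans cl; apply: near_eq_cvg; near=> s.
  by rewrite /= [s *: 1]mulr1.
have k0 c d : is_derive a 1 c d -> k c s @[s --> (0 : R)^'] --> (0 : R).
  move=> [dc _]; have /differentiable_continuous cc : differentiable c a by apply/derivable1_diffP.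
  have sa : s + a @[s --> (0:R)^'] --> 0 + a.
    apply: (@cvg_within_filter _ _ _ (nbhs (0 : R))).
    by apply: cvgD; [exact: cvg_id|exact: cvg_cst].
  rewrite add0r in sa.
  have ca : (fun _ : R => c a) @ 0^' --> c a by exact: cvg_cst.
  by have := cvgB (cvg_comp _ c sa cc) ca; rewrite subrr; exact.
have e0 c d (e : R -> R) : is_derive a 1 c d -> (forall s, `|e s| <= `|k c s|) ->
    e s @[s --> (0 : R)^'] --> (0 : R).
  move=> hc he; apply/cvgr0Pnorm_lt => eps eps0.
  have /cvgr0Pnorm_lt/(_ _ eps0) := k0 _ _ hc.
  by apply: filterS => s; apply: le_lt_trans.
have cz (u : R -> R) w : u s @[s --> (0 : R)^'] --> (0 : R) ->
   forall (y : R -> spacetime R), y s @[s --> (0 : R)^'] --> z ->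
   u s *: w + y s @[s --> (0 : R)^'] --> z.
  move=> u0 y yz; have : u s *: w + y s @[s --> (0 : R)^'] --> 0 *: w + z.
    by apply: cvgD => //; apply: cvgZr_tmp.
  by rewrite scale0r add0r.
have z0 : (fun _ : R => z) @ 0^' --> z by exact: cvg_cst.
have L1 := cz _ dir_x1 (k0 _ _ h1) _ z0.
have L2 := cz _ dir_x2 (k0 _ _ h2) _ L1.
have M1 := cz _ dir_x1 (e0 _ _ e1 h1 (fun s => (E1 s).1)) _ z0.
have M2 := cz _ dir_x2 (e0 _ _ e2 h2 (fun s => (E2 s).1)) _ L1.
have M3 := cz _ dir_x3 (e0 _ _ e3 h3 (fun s => (E3 s).1)) _ L2.
have D v y : y s @[s --> (0 : R)^'] --> z -> 'D_v f (y s) @[s --> (0 : R)^'] --> 'D_v f z.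
  by move=> yz; apply: (cvg_comp y ('D_v f) yz); exact: C1_continuous_derive.
have Q : (fun s : R => s^-1 *: (((fun s => f (t, (c1 s, c2 s, c3 s))) \o shift a) (s *: 1) - f z))
   @ 0^' --> 'D_dir_x1 f z * d1 + 'D_dir_x2 f z * d2 + 'D_dir_x3 f z * d3.
  have H : (fun s => 'D_dir_x1 f (e1 s *: dir_x1 + z) * (s^-1 * k c1 s)
      + 'D_dir_x2 f (e2 s *: dir_x2 + (k c1 s *: dir_x1 + z)) * (s^-1 * k c2 s)
      + 'D_dir_x3 f (e3 s *: dir_x3 + (k c2 s *: dir_x2 + (k c1 s *: dir_x1 + z))) * (s^-1 * k c3 s))
      @ (0 : R)^' --> 'D_dir_x1 f z * d1 + 'D_dir_x2 f z * d2 + 'D_dir_x3 f z * d3.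
    exact: cvgD (cvgD (cvgM (D dir_x1 _ M1) (quot _ _ h1)) (cvgM (D dir_x2 _ M2) (quot _ _ h2)))
      (cvgM (D dir_x3 _ M3) (quot _ _ h3)).
  have alg (i A B C u v w X : R) : A * (i * u) + B * (i * v) + C * (i * w)
    = i * (X - (X - w * C - v * B - u * A)) by ring.
  refine (cvg_trans _ H); apply: near_eq_cvg; near=> s.
  have fz : f z = f (k c3 s *: dir_x3 + (k c2 s *: dir_x2 + (k c1 s *: dir_x1 + z)))
     - (f (k c3 s *: dir_x3 + (k c2 s *: dir_x2 + (k c1 s *: dir_x1 + z))) - f (k c2 s *: dir_x2 + (k c1 s *: dir_x1 + z)))
     - (f (k c2 s *: dir_x2 + (k c1 s *: dir_x1 + z)) - f (k c1 s *: dir_x1 + z))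
     - (f (k c1 s *: dir_x1 + z) - f z) by ring.
  have := lin3 t (c1 a) (c2 a) (c3 a) (k c1 s) (k c2 s) (k c3 s).
  rewrite -/z {1 2 3}/k !subrK => E; rewrite fz -E.
  rewrite E (E1 s).2 (E2 s).2 (E3 s).2 -E /= [s *: 1]mulr1.
  exact: alg.
by split; [apply/cvg_ex; eexists; exact: Q|exact: cvg_lim Q].
Unshelve. all: by end_near. Qed.

Lemma sqr_enorm (x : R3 R) : enorm x ^+ 2 = x.1.1 ^+ 2 + x.1.2 ^+ 2 + x.2 ^+ 2.
Proof. by rewrite sqr_sqrtr// !addr_ge0// sqr_ge0. Qed.

Lemma enorm_ge0 (x : R3 R) : 0 <= enorm x.
Proof. exact: sqrtr_ge0. Qed.

Lemma coord_le_enorm (x : R3 R) : [/\ `|x.1.1| <= enorm x, `|x.1.2| <= enorm x & `|x.2| <= enorm x].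
Proof.
have h1 := sqr_ge0 x.1.1; have h2 := sqr_ge0 x.1.2; have h3 := sqr_ge0 x.2.
by split; rewrite -sqrtr_sqr ler_wsqrtr//; lra.
Qed.

(** By Lagrange's identity the right side is the square of the cross product of x and grad f. Off
    the x_3-axis there is equality, by differentiation along the meridian and the parallel through
    x; on the axis the longitude term is lost, whence an inequality. *)
Lemma grad_S2_sqr_le f (t : R) (x : R3 R) : is_Ck 1 f ->
  grad_S2 (fun y => f (t, y)) x ^+ 2
  <= enorm x ^+ 2 * ('D_dir_x1 f (t, x) ^+ 2 + 'D_dir_x2 f (t, x) ^+ 2
       + 'D_dir_x3 f (t, x) ^+ 2)
     - (x.1.1 * 'D_dir_x1 f (t, x) + x.1.2 * 'D_dir_x2 f (t, x)
       + x.2 * 'D_dir_x3 f (t, x)) ^+ 2.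
Proof.
move=> fC1; rewrite /grad_S2.
set f1 := 'D_dir_x1 f (t, x); set f2 := 'D_dir_x2 f (t, x).
set f3 := 'D_dir_x3 f (t, x).
set r := enorm x; set th := colatitude x; set ps := longitude x.
have xE : spherical r th ps = x by exact: spherical_anglesK.
have kc (c p : R) : is_derive p 1 (fun=> c) 0 by exact: is_derive_cst.
have dth : is_derive th 1 (fun a => f (t, spherical r a ps))
   (r * (cos th * (cos ps * f1 + sin ps * f2) - sin th * f3)).
  have ds : is_derive th 1 (sin : R -> R) (cos th) by exact: is_derive_sin.
  have dc : is_derive th 1 (cos : R -> R) (- sin th) by exact: is_derive_cos.
  have d1 := derM (derM (kc r th) ds) (kc (cos ps) th).
  have d2 := derM (derM (kc r th) ds) (kc (sin ps) th).
  have d3 := derM (kc r th) dc.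
  apply: is_derive_eq (is_derive_curve t fC1 d1 d2 d3) _.
  by rewrite -[(_, _, _)]/(spherical r th ps) xE -/f1 -/f2 -/f3; ring.
have dps : is_derive ps 1 (fun a => f (t, spherical r th a))
   (r * sin th * (- sin ps * f1 + cos ps * f2)).
  have ds : is_derive ps 1 (sin : R -> R) (cos ps) by exact: is_derive_sin.
  have dc : is_derive ps 1 (cos : R -> R) (- sin ps) by exact: is_derive_cos.
  have d1 := derM (kc (r * sin th) ps) dc.
  have d2 := derM (kc (r * sin th) ps) ds.
  have d3 := kc (r * cos th) ps.
  apply: is_derive_eq (is_derive_curve t fC1 d1 d2 d3) _.
  by rewrite -[(_, _, _)]/(spherical r th ps) xE -/f1 -/f2 -/f3; ring.
rewrite !derive1E (@derive_val _ _ _ _ _ _ _ dth) (@derive_val _ _ _ _ _ _ _ dps).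
clearbody f1 f2 f3; clear dth dps.
rewrite sqr_sqrtr; last first.
  apply: addr_ge0; first exact: sqr_ge0.
  by apply: mulr_ge0; [rewrite invr_ge0; exact: sqr_ge0|exact: sqr_ge0].
have -> : x.1.1 = r * sin th * cos ps by rewrite -[in LHS]xE.
have -> : x.1.2 = r * sin th * sin ps by rewrite -[in LHS]xE.
have -> : x.2 = r * cos th by rewrite -[in LHS]xE.
have := cos2Dsin2 th; have := cos2Dsin2 ps.
set ct := cos th; set st := sin th; set cp := cos ps; set sp := sin ps => Hp Ht.
(* [A] is the derivative along the horizontal radius and [B] the one along the parallel. A rotation
   of ([A], [f3]) by the colatitude yields the derivatives along the meridian and along the
   radius. *)
set A := cp * f1 + sp * f2; set B := - sp * f1 + cp * f2.
have EAB : f1 ^+ 2 + f2 ^+ 2 = A ^+ 2 + B ^+ 2.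
  by rewrite -[LHS]mul1r -Hp /A /B; ring.
have E3 : A ^+ 2 + f3 ^+ 2 = (ct * A - st * f3) ^+ 2 + (st * A + ct * f3) ^+ 2.
  by rewrite -[LHS]mul1r -Ht; ring.
have -> : f1 ^+ 2 + f2 ^+ 2 + f3 ^+ 2 = B ^+ 2 + (A ^+ 2 + f3 ^+ 2) by rewrite EAB; ring.
have -> : r * st * cp * f1 + r * st * sp * f2 + r * ct * f3 = r * (st * A + ct * f3).
  by rewrite /A; ring.
rewrite E3.
have -> : r ^+ 2 * (B ^+ 2 + ((ct * A - st * f3) ^+ 2 + (st * A + ct * f3) ^+ 2)) -
  (r * (st * A + ct * f3)) ^+ 2 = (r * (ct * A - st * f3)) ^+ 2 + (r * B) ^+ 2 by ring.
rewrite lerD2l.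
(* On the axis the longitude term of grad_S2 is 0, because 0^-1 = 0. *)
have [->|st0] := eqVneq st 0; first by rewrite expr0n/= invr0 mul0r sqr_ge0.
have -> : (st ^+ 2)^-1 * (r * st * B) ^+ 2 = (r * B) ^+ 2 by clearbody B; field.
exact: lexx.
Qed.

End chain_rule.

(** * The weights *)

Section weights.
Context {R : realType}.
Implicit Types (k w p x h : R).

(** A remainder of second order settles the square of [pos] with K = 1, kink included, without
    one-sided limits. *)
Lemma is_derive_quadratic (f : R -> R) (x d K : R) :
  (forall h, `|f (h + x) - f x - h * d| <= K * h ^+ 2) -> is_derive x 1 f d.
Proof.
move=> H.
have cv : (fun h : R => h^-1 *: ((f \o shift x) (h *: 1) - f x)) @ (0 : R)^' --> d.
  apply/cvgrPdist_le => e e0; near=> h.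
  have h0 : h != 0 by near: h; exact: nbhs_dnbhs_neq.
  have -> : d - h^-1 *: ((f \o shift x) (h *: 1) - f x) = - (h^-1 * (f (h + x) - f x - h * d)).
    by rewrite /= [h *: 1]mulr1 -[_ *: _]/(h^-1 * _); field.
  rewrite normrN normrM normfV ler_pdivrMl ?normr_gt0//.
  apply: le_trans (H h) _; rewrite -[h ^+ 2]ger0_norm ?sqr_ge0// expr2 normrM mulrCA.
  rewrite ler_pM2l ?normr_gt0//.
  apply: (@le_trans _ _ ((`|K| + 1) * `|h|)).
    by apply: ler_wpM2r => //; apply: le_trans (ler_norm K) _; rewrite lerDl.
  rewrite -ler_pdivlMl ?ltr_wpDl//.
  near: h; apply: dnbhs0_le; rewrite mulr_gt0// invr_gt0 ltr_wpDl//.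
by split; [apply/cvg_ex; exists d|exact: cvg_lim cv].
Unshelve. all: by end_near. Qed.

Definition pos w := Num.max 0 w.

Lemma posE w : pos w = if 0 <= w then w else 0.
Proof. by rewrite /pos; case: leP => // /ltW h; rewrite max_r// max_l. Qed.

Lemma is_derive_posq w : is_derive w 1 (fun w => pos w ^+ 2) (2 * pos w).
Proof.
apply: (@is_derive_quadratic _ _ _ 1) => h; rewrite ler_norml !posE.
case: ifPn => hw; case: ifPn => w0; try (move: hw w0; rewrite -?ltNge => hw w0); nra.
Qed.

Lemma continuous_pos : continuous pos.
Proof.
have -> : pos = (fun w => (w + `|w|) / 2).
  apply/funext => w; rewrite posE; case: ifPn => [w0|]; first by rewrite ger0_norm//; field.
  by rewrite -ltNge => w0; rewrite ltr0_norm// subrr mul0r.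
move=> w; apply: cvgM; last exact: cvg_cst.
by apply: cvgD; [exact: cvg_id|exact: (@norm_continuous _ R)].
Qed.

(* A positive C^1 function which is the identity above k: powers of ell k (r^2)
   and of ell 1 u, ell 1 v are then C^1 on the whole of space-time. *)
Definition ell k w := w + k^-1 * pos (k - w) ^+ 2.
Definition dell k w := 1 - k^-1 * (2 * pos (k - w)).

Lemma ellE k w : k <= w -> ell k w = w.
Proof. by rewrite -subr_le0 => h; rewrite /ell /pos max_l// expr0n mulr0 addr0. Qed.

Lemma dellE k w : k <= w -> dell k w = 1.
Proof. by rewrite -subr_le0 => h; rewrite /dell /pos max_l// !mulr0 subr0. Qed.

Lemma ell_gt0 k w : 0 < k -> 0 < ell k w.
Proof.
move=> k0; have [kw|wk] := leP k w; first by rewrite ellE//; lra.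
rewrite /ell /pos max_r; last by lra.
(* The bracket is k^2 - k w + w^2, a positive definite form. *)
have -> : w + k^-1 * (k - w) ^+ 2 = k^-1 * (k * w + (k - w) ^+ 2) by field; lra.
by apply: mulr_gt0; [rewrite invr_gt0|nra].
Qed.

Lemma is_derive_ell k w : is_derive w 1 (ell k) (dell k w).
Proof.
have h : is_derive w 1 (fun w => k - w) (0 - 1).
  exact: (derB (is_derive_cst k w (1 : R)) (is_derive_id w (1 : R))).
have hp : is_derive w 1 (fun w => pos (k - w) ^+ 2) (2 * pos (k - w) * (0 - 1)).
  exact: (@der_comp _ _ (fun w => pos w ^+ 2) (fun w => 2 * pos w) _ _ _ _ (is_derive_posq _) h).
have := derD (is_derive_id w 1) (derM (is_derive_cst (k^-1) w (1 : R)) hp).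
by move=> H; apply: is_derive_eq H _; rewrite /dell /cst/=; ring.
Qed.

Lemma continuous_dell k : continuous (dell k).
Proof.
move=> w; apply: cvgB; first exact: cvg_cst.
apply: cvgM; first exact: cvg_cst.
apply: cvgM; first exact: cvg_cst.
apply: (@continuous_comp _ _ _ (fun w => k - w) pos); last exact: continuous_pos.
by apply: cvgB; [exact: cvg_cst|exact: cvg_id].
Qed.

Definition pw k a w := ell k w `^ a.
Definition dpw k a w := a * ell k w `^ (a - 1) * dell k w.

Lemma is_derive_pw k a w : 0 < k -> is_derive w 1 (pw k a) (dpw k a w).
Proof.
move=> k0; have H := @is_derive1_powR R a _ (ell_gt0 w k0).
exact: (@der_comp _ _ (fun x => x `^ a) (fun x => a * x `^ (a - 1)) _ _ _ _ H (is_derive_ell k w)).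
Qed.

Lemma continuous_dpw k a : 0 < k -> continuous (dpw k a).
Proof.
move=> k0 w; apply: cvgM; last exact: continuous_dell.
apply: cvgM; first exact: cvg_cst.
have /differentiable_continuous : differentiable (pw k (a - 1)) w.
  by apply/derivable1_diffP; have [] := @is_derive_pw k (a - 1) w k0.
exact.
Qed.

Lemma pw_gt0 k a w : 0 < k -> 0 < pw k a w.
Proof. by move=> k0; apply: powR_gt0; exact: ell_gt0. Qed.

(* A C^1 quadratic spline, equal to 0 below 1 and to 1 above 2. *)
Definition sigma p := 2 * (pos (p - 1) ^+ 2 - 2 * pos (p - 3 / 2) ^+ 2 + pos (p - 2) ^+ 2).
Definition dsigma p := 4 * (pos (p - 1) - 2 * pos (p - 3 / 2) + pos (p - 2)).

Lemma is_derive_sigma p : is_derive p 1 sigma (dsigma p).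
Proof.
have h (c : R) : is_derive p 1 (fun w => pos (w - c) ^+ 2) (2 * pos (p - c) * (1 - 0)).
  apply: (@der_comp _ _ (fun w => pos w ^+ 2) (fun w => 2 * pos w) (fun w => w - c)); exact: is_derive_posq.
have := derM (is_derive_cst (2 : R) p (1 : R))
  (derD (derB (h 1) (derM (is_derive_cst (2 : R) p (1 : R)) (h (3 / 2)))) (h 2)).
by move=> H; apply: is_derive_eq H _; rewrite /dsigma /cst/=; ring.
Qed.

Lemma continuous_dsigma : continuous dsigma.
Proof.
have h (c : R) p : (pos (w - c)) @[w --> p] --> pos (p - c).
  apply: (@continuous_comp _ _ _ (fun w => w - c) pos); last exact: continuous_pos.
  by apply: cvgB; [exact: cvg_id|exact: cvg_cst].
move=> p; apply: cvgM; first exact: cvg_cst.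
apply: cvgD; last exact: h.
by apply: cvgB; [exact: h|apply: cvgM; [exact: cvg_cst|exact: h]].
Qed.

Lemma sigma0 p : p <= 1 -> sigma p = 0 /\ dsigma p = 0.
Proof.
by move=> p1; rewrite /sigma /dsigma /pos !max_l; [split; ring|lra..].
Qed.

Lemma sigma1 p : 2 <= p -> sigma p = 1 /\ dsigma p = 0.
Proof.
by move=> p1; rewrite /sigma /dsigma /pos !max_r; [split; field|lra..].
Qed.

Lemma sigma_bounds p : 0 <= sigma p <= 1 /\ 0 <= dsigma p <= 2.
Proof.
have [p1|p1] := leP p 1; first by have [-> ->] := sigma0 p1; lra.
have [p2|p2] := leP 2 p; first by have [-> ->] := sigma1 p2; lra.
rewrite /sigma /dsigma /pos (@max_r _ _ 0 (p - 1)) ?(@max_l _ _ 0 (p - 2)); [|lra..].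
have [p3|p3] := leP p (3 / 2); first by rewrite max_l; [split; nra|lra].
by rewrite max_r; [split; nra|lra].
Qed.

(* The trapezoidal rule for the concave derivative of x^s on [u, v]. *)
Lemma trapezoid (s u v : R) : 1 < s -> s < 2 -> 0 < u -> u <= v ->
  (v - u) / 2 * (s * v `^ (s - 1) + s * u `^ (s - 1)) <= v `^ s - u `^ s.
Proof.
move=> s1 s2 u0 uv.
(* The defect of the rule, up to the constant u^s, as a function of the right end. Its derivative is
   s / 2 times x^(s-1) - u^(s-1) - (s-1) x^(s-2) (x - u), non-negative because x^(s-1) is
   concave. *)
pose F x := x `^ s - (x - u) / 2 * (s * x `^ (s - 1) + s * u `^ (s - 1)).
pose dF x := s * x `^ (s - 1) - ((x - u) / 2 * (s * ((s - 1) * x `^ (s - 1 - 1)))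
  + (s * x `^ (s - 1) + s * u `^ (s - 1)) / 2).
have dF_ x : 0 < x -> is_derive x 1 F (dF x).
  move=> x0.
  have d1 := is_derive1_powR s x0; have d2 := is_derive1_powR (s - 1) x0.
  have l1 : is_derive x 1 (fun x => (x - u) / 2) (1 / 2).
    have := derM (derB (is_derive_id x (1 : R)) (is_derive_cst u x (1 : R))) (is_derive_cst (2^-1 : R) x (1 : R)).
    by move=> H; apply: is_derive_eq H _; rewrite /cst/=; ring.
  have l2 : is_derive x 1 (fun x => s * x `^ (s - 1) + s * u `^ (s - 1)) (s * ((s - 1) * x `^ (s - 1 - 1))).
    have := derD (derM (is_derive_cst s x (1 : R)) d2) (is_derive_cst (s * u `^ (s - 1)) x (1 : R)).
    by move=> H; apply: is_derive_eq H _; rewrite /cst/=; ring.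
  by apply: is_derive_eq (derB d1 (derM l1 l2)) _; rewrite /dF; ring.
have dF0 x : u <= x -> 0 <= dF x.
  move=> ux; have x0 : 0 < x by exact: lt_le_trans ux.
  have [||e] := @MVT_segment R (fun x => x `^ (s - 1)) (fun x => (s - 1) * x `^ (s - 1 - 1)) _ _ ux.
  - move=> y; rewrite in_itv/= => /andP[uy yx]; apply: is_derive1_powR; exact: lt_trans uy.
  - apply: derivable_within_continuous => y; rewrite in_itv/= => /andP[uy yx].
    by have [] := is_derive1_powR (s - 1) (lt_le_trans u0 uy).
  rewrite in_itv/= => /andP[ue ex] E.
  have mono : x `^ (s - 1 - 1) <= e `^ (s - 1 - 1).
    have -> : s - 1 - 1 = - (2 - s) by ring.
    rewrite !powRN lef_pV2 ?posrE ?powR_gt0//; last exact: lt_le_trans ue.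
    by apply: ge0_ler_powR => //; rewrite ?nnegrE; lra.
  have := ler_wpM2r (_ : 0 <= (s - 1) * (x - u)) mono.
  move=> /(_ ltac:(nra)) H.
  have -> : dF x = s / 2 * (x `^ (s - 1) - u `^ (s - 1) - (s - 1) * x `^ (s - 1 - 1) * (x - u)).
    by rewrite /dF; field.
  by rewrite E; apply: mulr_ge0; [lra|nra].
have [||e] := @MVT_segment R F dF _ _ uv.
- move=> y; rewrite in_itv/= => /andP[uy yx]; apply: dF_; exact: lt_trans uy.
- apply: derivable_within_continuous => y; rewrite in_itv/= => /andP[uy yx].
  by have [] := dF_ _ (lt_le_trans u0 uy).
rewrite in_itv/= => /andP[ue ev] E.
have : 0 <= F v - F u by rewrite E mulr_ge0 ?dF0 ?subr_ge0.
by rewrite /F subrr !mul0r subr0; lra.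
Qed.

End weights.

(** Builds the derivative from the syntax of the function. The leaves are closed by hypotheses, so
    the derivatives of the atoms have to be in the context; differences are tried before sums, being
    sums with an opposite. *)
Ltac der :=
  lazymatch goal with
  | |- @is_derive _ _ _ _ _ ?F _ =>
    lazymatch F with
    | fun z => @?f z + - @?g z => eapply (@derB _ _ f g); der
    | fun z => @?f z + @?g z => eapply (@derD _ _ f g); der
    | fun z => @?f z * @?g z => eapply (@derM _ _ f g); der
    | fun z => (@?f z) ^+ 2 => eapply (@derX _ _ f); der
    | fun z => - @?f z => eapply (@derN _ _ f); der
    | fun _ => ?c => exact: derC
    | _ => eassumption
    end
  end.

(** * The energy identity *)

Section fields.
Context {R : realType}.
Implicit Types (z v : spacetime R) (k : R).

(** The coordinates are linear functionals, applied to points and to directions alike: the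
    derivative of [X1] along [v] is [X1 v]. *)
Definition X1 z := z.2.1.1.
Definition X2 z := z.2.1.2.
Definition X3 z := z.2.2.
Definition time z := z.1.

Lemma derive_valE (V : normedModType R) (f : V -> R) (z v : V) d :
  is_derive z v f d -> 'D_v f z = d.
Proof. by case. Qed.

Lemma continuous_X1 : continuous X1.
Proof. by move=> z; apply: (cvg_comp _ _ (cvg_comp _ _ cvg_snd cvg_fst) cvg_fst). Qed.
Lemma continuous_X2 : continuous X2.
Proof. by move=> z; apply: (cvg_comp _ _ (cvg_comp _ _ cvg_snd cvg_fst) cvg_snd). Qed.
Lemma continuous_X3 : continuous X3.
Proof. by move=> z; apply: (cvg_comp _ _ cvg_snd cvg_snd). Qed.
Lemma continuous_time : continuous time.
Proof. by move=> z; exact: cvg_fst. Qed.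

Lemma C1_X1 : is_Ck 1 X1.
Proof. by apply: C1_linear; [exact: continuous_X1|]. Qed.
Lemma C1_X2 : is_Ck 1 X2.
Proof. by apply: C1_linear; [exact: continuous_X2|]. Qed.
Lemma C1_X3 : is_Ck 1 X3.
Proof. by apply: C1_linear; [exact: continuous_X3|]. Qed.
Lemma C1_time : is_Ck 1 time.
Proof. by apply: C1_linear; [exact: continuous_time|]. Qed.

Lemma der_X1 z v : is_derive z v X1 (X1 v). Proof. exact: der_linear. Qed.
Lemma der_X2 z v : is_derive z v X2 (X2 v). Proof. exact: der_linear. Qed.
Lemma der_X3 z v : is_derive z v X3 (X3 v). Proof. exact: der_linear. Qed.
Lemma der_time z v : is_derive z v time (time v). Proof. exact: der_linear. Qed.

Definition rsq z := X1 z ^+ 2 + X2 z ^+ 2 + X3 z ^+ 2.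
Definition dot z v := X1 z * X1 v + X2 z * X2 v + X3 z * X3 v.

Lemma C1_rsq : is_Ck 1 rsq.
Proof.
by apply: C1D; [apply: C1D|]; apply: C1X; [exact: C1_X1|exact: C1_X2|exact: C1_X3].
Qed.

Lemma der_rsq z v : is_derive z v rsq (2 * dot z v).
Proof.
have h1 := der_X1 z v; have h2 := der_X2 z v; have h3 := der_X3 z v.
eapply is_derive_eq; first by rewrite /rsq; der.
by rewrite /dot; ring.
Qed.

(* r and r^-2 where r^2 >= k. *)
Definition rho k z := pw k (1 / 2) (rsq z).
Definition irsq k z := pw k (- 1) (rsq z).

Lemma C1_rho k : 0 < k -> is_Ck 1 (rho k).
Proof.
move=> k0; apply: (@C1_comp _ _ (pw k (1 / 2)) (dpw k (1 / 2)) rsq).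
- by move=> w; exact: is_derive_pw.
- exact: continuous_dpw.
- exact: C1_rsq.
Qed.

Lemma C1_irsq k : 0 < k -> is_Ck 1 (irsq k).
Proof.
move=> k0; apply: (@C1_comp _ _ (pw k (- 1)) (dpw k (- 1)) rsq).
- by move=> w; exact: is_derive_pw.
- exact: continuous_dpw.
- exact: C1_rsq.
Qed.

Lemma rho_gt0 k z : 0 < k -> 0 < rho k z.
Proof. exact: pw_gt0. Qed.

(** Valid everywhere, inside the excised region too, as both factors are powers of the same positive
    function. The product [rho k z * irsq k z] plays the part of 1 / r from here on. *)
Lemma sqr_rho_irsq k z : 0 < k -> rho k z ^+ 2 * irsq k z = 1.
Proof.
move=> k0; have e0 := ell_gt0 (rsq z) k0; rewrite /rho /irsq /pw expr2.
rewrite -!powRD ?(gt_eqF e0) ?implybT//.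
have -> : 1 / 2 + 1 / 2 + -1 = 0 :> R by field.
exact: powRr0.
Qed.

Lemma rhoE k z : 0 < k -> k <= rsq z -> rho k z = Num.sqrt (rsq z).
Proof. by move=> k0 kz; rewrite /rho /pw ellE// mul1r powR12_sqrt//; lra. Qed.

Lemma rsq_irsq k z : 0 < k -> k <= rsq z -> rsq z * irsq k z = 1.
Proof.
move=> k0 kz; rewrite -(sqr_rho_irsq z k0) rhoE// sqr_sqrtr//; lra.
Qed.

Lemma der_rho k z v : 0 < k -> k <= rsq z ->
  is_derive z v (rho k) (dot z v * (rho k z * irsq k z)).
Proof.
move=> k0 kz.
have := @der_comp _ _ (pw k (1 / 2)) (dpw k (1 / 2)) rsq v z _ (is_derive_pw _ _ k0) (der_rsq z v).
move=> H; apply: is_derive_eq H _.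
have r0 : rsq z != 0 by rewrite gt_eqF//; lra.
rewrite /rho /irsq /pw /dpw !(ellE kz) dellE// -powRD ?r0 ?implybT//.
by rewrite (_ : 1 / 2 + -1 = 1 / 2 - 1)//; field.
Qed.

Lemma der_irsq k z v : 0 < k -> k <= rsq z ->
  is_derive z v (irsq k) (- (2 * dot z v) * irsq k z ^+ 2).
Proof.
move=> k0 kz.
have := @der_comp _ _ (pw k (-1)) (dpw k (-1)) rsq v z _ (is_derive_pw _ _ k0) (der_rsq z v).
move=> H; apply: is_derive_eq H _.
have r0 : rsq z != 0 by rewrite gt_eqF//; lra.
rewrite /irsq /pw /dpw !(ellE kz) dellE// expr2 -powRD ?r0 ?implybT//.
by ring.
Qed.

(** Vanishes where r^2 <= k, the only region where [rho] and [irsq] can differ from r and r^-2, and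
    equals 1 where r^2 >= 2k. *)
Definition chi k z := sigma (k^-1 * rsq z).

Lemma C1_chi k : is_Ck 1 (chi k).
Proof.
apply: (@C1_comp _ _ sigma dsigma (fun z => k^-1 * rsq z)).
- exact: is_derive_sigma.
- exact: continuous_dsigma.
- by apply: C1M; [exact: C1_cst|exact: C1_rsq].
Qed.

Lemma der_chi k z v : is_derive z v (chi k) (dsigma (k^-1 * rsq z) * (k^-1 * (2 * dot z v))).
Proof.
have h := der_rsq z v.
have h2 : is_derive z v (fun z => k^-1 * rsq z) (k^-1 * (2 * dot z v)).
  by eapply is_derive_eq; [der|ring].
exact: (@der_comp _ _ sigma dsigma _ _ _ _ (is_derive_sigma _) h2).
Qed.

Section energy_current.
Variables a c y G1 G2 G3 : spacetime R -> R.

Definition XG z := X1 z * G1 z + X2 z * G2 z + X3 z * G3 z.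
Definition GG z := G1 z ^+ 2 + G2 z ^+ 2 + G3 z ^+ 2.
(** The energy-momentum tensor of the wave equation contracted with a d_t + c x . grad, with [G] in
    place of the gradient of phi: [dens] is the time component and [flux] gives the space
    components. *)
Definition mult z := a z * y z + c z * XG z.
Definition dens z := 1 / 2 * (a z * (y z ^+ 2 + GG z)) + c z * (y z * XG z).
Definition flux (X G : spacetime R -> R) z :=
  1 / 2 * (c z * (X z * (GG z - y z ^+ 2))) - mult z * G z.

(* Here q = r^-2 and G = grad phi + q phi x, so that curl G = - q x /\ G and
   d_t G = grad y + q y x with y = phi_t; a and c are radial in x. *)
Lemma current_divergence z q at_ a' ct c' yt y1 y2 y3 g11 g12 g13 g21 g22 g23 g31 g32 g33 :
  rsq z * q = 1 ->
  is_derive z dir_t a at_ -> is_derive z dir_t c ct ->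
  is_derive z dir_x1 a (X1 z * a') -> is_derive z dir_x2 a (X2 z * a') ->
  is_derive z dir_x3 a (X3 z * a') ->
  is_derive z dir_x1 c (X1 z * c') -> is_derive z dir_x2 c (X2 z * c') ->
  is_derive z dir_x3 c (X3 z * c') ->
  is_derive z dir_t y yt -> is_derive z dir_x1 y y1 -> is_derive z dir_x2 y y2 ->
  is_derive z dir_x3 y y3 ->
  is_derive z dir_t G1 (y1 + X1 z * q * y z) ->
  is_derive z dir_t G2 (y2 + X2 z * q * y z) ->
  is_derive z dir_t G3 (y3 + X3 z * q * y z) ->
  is_derive z dir_x1 G1 g11 -> is_derive z dir_x2 G1 g12 -> is_derive z dir_x3 G1 g13 ->
  is_derive z dir_x1 G2 g21 -> is_derive z dir_x2 G2 g22 -> is_derive z dir_x3 G2 g23 ->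
  is_derive z dir_x1 G3 g31 -> is_derive z dir_x2 G3 g32 -> is_derive z dir_x3 G3 g33 ->
  g12 = g21 + q * (X1 z * G2 z - X2 z * G1 z) ->
  g13 = g31 + q * (X1 z * G3 z - X3 z * G1 z) ->
  g23 = g32 + q * (X2 z * G3 z - X3 z * G2 z) ->
  'D_dir_t dens z + ('D_dir_x1 (flux X1 G1) z + 'D_dir_x2 (flux X2 G2) z
    + 'D_dir_x3 (flux X3 G3) z)
  = mult z * (yt + q * XG z - (g11 + g22 + g33))
    + (1 / 2 * at_ * (y z ^+ 2 + GG z) + (ct - a') * (y z * XG z) - c' * XG z ^+ 2
       - 1 / 2 * c z * (y z ^+ 2 + GG z) + 1 / 2 * c' * rsq z * (GG z - y z ^+ 2)).
Proof.
move=> qE ta tc a1 a2 a3 c1 c2 c3 ty dy1 dy2 dy3 tG1 tG2 tG3.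
move=> d11 d12 d13 d21 d22 d23 d31 d32 d33 e12 e13 e23.
have t1 : is_derive z dir_t X1 0 by exact: der_X1.
have t2 : is_derive z dir_t X2 0 by exact: der_X2.
have t3 : is_derive z dir_t X3 0 by exact: der_X3.
have x11 : is_derive z dir_x1 X1 1 by exact: der_X1.
have x12 : is_derive z dir_x1 X2 0 by exact: der_X2.
have x13 : is_derive z dir_x1 X3 0 by exact: der_X3.
have x21 : is_derive z dir_x2 X1 0 by exact: der_X1.
have x22 : is_derive z dir_x2 X2 1 by exact: der_X2.
have x23 : is_derive z dir_x2 X3 0 by exact: der_X3.
have x31 : is_derive z dir_x3 X1 0 by exact: der_X1.
have x32 : is_derive z dir_x3 X2 0 by exact: der_X2.
have x33 : is_derive z dir_x3 X3 1 by exact: der_X3.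
erewrite (@derive_valE _ dens z dir_t); last by rewrite /dens /GG /XG; der.
erewrite (@derive_valE _ (flux X1 G1) z dir_x1); last by rewrite /flux /mult /GG /XG; der.
erewrite (@derive_valE _ (flux X2 G2) z dir_x2); last by rewrite /flux /mult /GG /XG; der.
erewrite (@derive_valE _ (flux X3 G3) z dir_x3); last by rewrite /flux /mult /GG /XG; der.
rewrite e12 e13 e23 /mult /GG /XG; move: qE; rewrite /rsq.
move: (X1 z) (X2 z) (X3 z) (G1 z) (G2 z) (G3 z) (a z) (c z) (y z) => z1 z2 z3 u1 u2 u3 az cz yz qE.
apply/eqP; rewrite -subr_eq0; apply/eqP.
(* The identity holds modulo r^2 q = 1 only, so the cofactor of this relation is supplied by hand;
   the same device recurs below. *)
transitivity (cz * (yz ^+ 2 - (u1 ^+ 2 + u2 ^+ 2 + u3 ^+ 2)) * ((z1 ^+ 2 + z2 ^+ 2 + z3 ^+ 2) * q - 1)).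
  by field.
by rewrite qE subrr mulr0.
Qed.
End energy_current.

End fields.

(** * The null weights and their current *)

Section weighted_energy.
Context {R : realType}.
Implicit Types (z w : spacetime R) (k s d : R) (phi : spacetime R -> R).

Lemma dot_t z : dot z dir_t = 0. Proof. by rewrite /dot !mulr0 !addr0. Qed.
Lemma dot_x1 z : dot z dir_x1 = X1 z.
Proof. by rewrite /dot mulr1 !mulr0 !addr0. Qed.
Lemma dot_x2 z : dot z dir_x2 = X2 z.
Proof. by rewrite /dot mulr1 !mulr0 addr0 add0r. Qed.
Lemma dot_x3 z : dot z dir_x3 = X3 z.
Proof. by rewrite /dot mulr1 !mulr0 !add0r. Qed.
Lemma time_t : time (dir_t : spacetime R) = 1. Proof. by []. Qed.
Lemma time_x1 : time (dir_x1 : spacetime R) = 0. Proof. by []. Qed.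
Lemma time_x2 : time (dir_x2 : spacetime R) = 0. Proof. by []. Qed.
Lemma time_x3 : time (dir_x3 : spacetime R) = 0. Proof. by []. Qed.

(* uu and vv are the null coordinates u and v; gam is the ghost weight, whose
   derivative supplies the positive bulk terms. *)
Definition uu k z := time z + 2 - rho k z.
Definition vv k z := time z + 2 + rho k z.
Definition gam d (w : R) : R := 1 + pw 1 (- (2 * d)) w.
Definition dgam d (w : R) : R := dpw 1 (- (2 * d)) w.
(** Weights of the outgoing part phi_t + S and of the incoming part phi_t - S of the multiplier.
    Written as a d_t + c x . grad, it has a = A + B and c = (A - B) / r. *)
Definition wA k s d z := gam d (uu k z) * pw 1 s (vv k z).
Definition wB k s d z := gam d (vv k z) * pw 1 s (uu k z).
Definition wa k s d z := wA k s d z + wB k s d z.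
Definition wc k s d z := (wA k s d z - wB k s d z) * (rho k z * irsq k z).
(** The component of grad (r phi) / r = grad phi + phi x / r^2 along [e], where [X] is the
    coordinate that belongs to [e]. *)
Definition Gr k phi (X : spacetime R -> R) e z :=
  'D_e phi z + X z * (irsq k z * phi z).

Lemma C1_uu k : 0 < k -> is_Ck 1 (uu k).
Proof.
move=> k0; apply: C1B; last exact: C1_rho.
by apply: C1D; [exact: C1_time|exact: C1_cst].
Qed.

Lemma C1_vv k : 0 < k -> is_Ck 1 (vv k).
Proof.
move=> k0; apply: C1D; last exact: C1_rho.
by apply: C1D; [exact: C1_time|exact: C1_cst].
Qed.

Lemma C1_pw (V : normedModType R) (a : R) (f : V -> R) : is_Ck 1 f -> is_Ck 1 (fun p => pw 1 a (f p)).
Proof.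
move=> f1; apply: (@C1_comp _ _ (pw 1 a) (dpw 1 a) f) => //.
- by move=> x; exact: is_derive_pw.
- exact: continuous_dpw.
Qed.

Lemma C1_gam (V : normedModType R) d (f : V -> R) : is_Ck 1 f -> is_Ck 1 (fun p => gam d (f p)).
Proof. by move=> f1; apply: C1D; [exact: C1_cst|exact: C1_pw]. Qed.

Lemma C1_wA k s d : 0 < k -> is_Ck 1 (wA k s d).
Proof.
by move=> k0; apply: C1M; [apply: C1_gam; exact: C1_uu|apply: C1_pw; exact: C1_vv].
Qed.

Lemma C1_wB k s d : 0 < k -> is_Ck 1 (wB k s d).
Proof.
by move=> k0; apply: C1M; [apply: C1_gam; exact: C1_vv|apply: C1_pw; exact: C1_uu].
Qed.

Lemma C1_wa k s d : 0 < k -> is_Ck 1 (wa k s d).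
Proof. by move=> k0; apply: C1D; [exact: C1_wA|exact: C1_wB]. Qed.

Lemma C1_wc k s d : 0 < k -> is_Ck 1 (wc k s d).
Proof.
move=> k0; apply: C1M; first by apply: C1B; [exact: C1_wA|exact: C1_wB].
by apply: C1M; [exact: C1_rho|exact: C1_irsq].
Qed.

Lemma C2_C1 phi : is_Ck 2 phi -> is_Ck 1 phi.
Proof.
move=> [cf df]; apply/is_C1P; split.
- exact: cf.
- by move=> u y; have [h _] := df u; exact: h.
- by move=> u; have [_ [h _]] := df u; exact: h.
Qed.

Lemma C2_derive phi e : is_Ck 2 phi -> is_Ck 1 ('D_e phi).
Proof. by move=> [_ df]; have [_ h] := df e; exact: h. Qed.

Lemma C1_Gr k phi X e : 0 < k -> is_Ck 2 phi -> is_Ck 1 X -> is_Ck 1 (Gr k phi X e).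
Proof.
move=> k0 f2 X1; apply: C1D; first exact: C2_derive.
by apply: C1M => //; apply: C1M; [exact: C1_irsq|exact: C2_C1].
Qed.

Section at_point.
Variables (k s d : R) (z : spacetime R).
Hypotheses (k0 : 0 < k) (kz : k <= rsq z).

Let n w := dot z w * (rho k z * irsq k z).

Lemma der_uu w : is_derive z w (uu k) (time w - n w).
Proof.
have h1 := der_time z w; have h2 := der_rho w k0 kz.
by eapply is_derive_eq; [rewrite /uu; der|rewrite /n; ring].
Qed.

Lemma der_vv w : is_derive z w (vv k) (time w + n w).
Proof.
have h1 := der_time z w; have h2 := der_rho w k0 kz.
by eapply is_derive_eq; [rewrite /vv; der|rewrite /n; ring].
Qed.

Lemma der_pw a w f df : is_derive z w f df ->
  is_derive z w (fun z => pw 1 a (f z)) (dpw 1 a (f z) * df).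
Proof. by move=> hf; apply: (@der_comp _ _ (pw 1 a) (dpw 1 a)) => //; exact: is_derive_pw. Qed.

Lemma der_gam a w f df : is_derive z w f df ->
  is_derive z w (fun z => gam a (f z)) (dgam a (f z) * df).
Proof.
move=> hf; have h := der_pw (- (2 * a)) hf.
by eapply is_derive_eq; [rewrite /gam; der|rewrite /dgam; ring].
Qed.

Let DA w := gam d (uu k z) * (dpw 1 s (vv k z) * (time w + n w))
  + pw 1 s (vv k z) * (dgam d (uu k z) * (time w - n w)).
Let DB w := gam d (vv k z) * (dpw 1 s (uu k z) * (time w - n w))
  + pw 1 s (uu k z) * (dgam d (vv k z) * (time w + n w)).

Lemma der_wA w : is_derive z w (wA k s d) (DA w).
Proof. exact: derM (der_gam d (der_uu w)) (der_pw s (der_vv w)). Qed.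

Lemma der_wB w : is_derive z w (wB k s d) (DB w).
Proof. exact: derM (der_gam d (der_vv w)) (der_pw s (der_uu w)). Qed.

Lemma der_wa w : is_derive z w (wa k s d) (DA w + DB w).
Proof. exact: derD (der_wA w) (der_wB w). Qed.

Lemma der_wc w : is_derive z w (wc k s d)
  ((wA k s d z - wB k s d z) * (rho k z * (- (2 * dot z w) * irsq k z ^+ 2) + irsq k z * n w)
   + rho k z * irsq k z * (DA w - DB w)).
Proof.
exact: derM (derB (der_wA w) (der_wB w)) (derM (der_rho w k0 kz) (der_irsq w k0 kz)).
Qed.

Lemma der_Gr phi X e w dX : is_Ck 2 phi -> is_derive z w X dX ->
  is_derive z w (Gr k phi X e)
    ('D_w ('D_e phi) z + (X z * (irsq k z * 'D_w phi z + phi z * (- (2 * dot z w) * irsq k z ^+ 2))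
      + irsq k z * phi z * dX)).
Proof.
move=> f2 hX; apply: derD; first exact/C1_is_derive/C2_derive.
apply: derM => //; apply: derM; first exact: der_irsq.
exact/C1_is_derive/C2_C1.
Qed.

End at_point.

Definition eG1 k phi := Gr k phi X1 dir_x1.
Definition eG2 k phi := Gr k phi X2 dir_x2.
Definition eG3 k phi := Gr k phi X3 dir_x3.
Definition edens k s d phi :=
  dens (wa k s d) (wc k s d) ('D_dir_t phi) (eG1 k phi) (eG2 k phi) (eG3 k phi).
Definition eflux k s d phi X :=
  flux (wa k s d) (wc k s d) ('D_dir_t phi) (eG1 k phi) (eG2 k phi) (eG3 k phi) X.
Definition emult k s d phi :=
  mult (wa k s d) (wc k s d) ('D_dir_t phi) (eG1 k phi) (eG2 k phi) (eG3 k phi).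
Definition eXG k phi := XG (eG1 k phi) (eG2 k phi) (eG3 k phi).
Definition eGG k phi := GG (eG1 k phi) (eG2 k phi) (eG3 k phi).
Definition eS k phi z := eXG k phi z * (rho k z * irsq k z).
Definition box_op phi z := 'D_dir_t ('D_dir_t phi) z - laplacian phi z.

Lemma curl_algebra (A B p q x1 x2 e1 e2 f1 f2 : R) : A = B -> e1 = x1 -> e2 = x2 ->
  A + (x1 * (q * f2 + p * (- (2 * e2) * q ^+ 2)) + q * p * 0) =
  B + (x2 * (q * f1 + p * (- (2 * e1) * q ^+ 2)) + q * p * 0)
  + q * (x1 * (f2 + x2 * (q * p)) - x2 * (f1 + x1 * (q * p))).
Proof. by move=> -> -> ->; ring. Qed.

(** In dimension three div (x / r^2) = r^-2, hence div G is the Laplacian of phi plus q x . G: the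
    correction of the gradient leaves the wave operator exact, with no term of order zero. *)
Lemma box_algebra (ytt p q x1 x2 x3 e1 e2 e3 f1 f2 f3 f11 f22 f33 : R) :
  (x1 ^+ 2 + x2 ^+ 2 + x3 ^+ 2) * q = 1 -> e1 = x1 -> e2 = x2 -> e3 = x3 ->
  ytt + q * (x1 * (f1 + x1 * (q * p)) + x2 * (f2 + x2 * (q * p)) + x3 * (f3 + x3 * (q * p)))
  - (f11 + (x1 * (q * f1 + p * (- (2 * e1) * q ^+ 2)) + q * p * 1)
     + (f22 + (x2 * (q * f2 + p * (- (2 * e2) * q ^+ 2)) + q * p * 1))
     + (f33 + (x3 * (q * f3 + p * (- (2 * e3) * q ^+ 2)) + q * p * 1)))
  = ytt - (f11 + f22 + f33).
Proof.
move=> qE -> -> ->; apply/eqP; rewrite -subr_eq0; apply/eqP.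
transitivity (3 * q * p * ((x1 ^+ 2 + x2 ^+ 2 + x3 ^+ 2) * q - 1)); first by ring.
by rewrite qE subrr mulr0.
Qed.

Lemma time_algebra (A B x q b f e : R) : A = B -> e = 0 ->
  A + (x * (q * b + f * (- (2 * e) * q ^+ 2)) + q * f * 0) = B + x * q * b.
Proof. by move=> -> ->; ring. Qed.

(** The quantity phi_t + S is transported along d_t - d_r, which annihilates v: in the coefficient
    of its square only gam(u) is differentiated, and symmetrically for phi_t - S. The derivatives of
    the powers s fall on the angular energy, where the factor r^-2 of the angular Laplacian adds -(A
    - B) / r. *)
Lemma energy_identity k s d phi z : 0 < k -> k <= rsq z -> is_Ck 2 phi ->
  let u := uu k z in let v := vv k z in
  let y := 'D_dir_t phi z in let S := eS k phi z in
  'D_dir_t (edens k s d phi) z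
  + ('D_dir_x1 (eflux k s d phi X1 (eG1 k phi)) z
     + 'D_dir_x2 (eflux k s d phi X2 (eG2 k phi)) z
     + 'D_dir_x3 (eflux k s d phi X3 (eG3 k phi)) z)
  = emult k s d phi z * box_op phi z
    + (dgam d u * pw 1 s v * (y + S) ^+ 2 + dgam d v * pw 1 s u * (y - S) ^+ 2
       + (gam d u * dpw 1 s v + gam d v * dpw 1 s u
          - (wA k s d z - wB k s d z) * (rho k z * irsq k z))
         * (eGG k phi z - S ^+ 2)).
Proof.
move=> k0 kz f2 u v y S.
have q1 := rsq_irsq k0 kz; have q2 := sqr_rho_irsq z k0.
have sch e e' := schwarz e e' z f2.
(* [br] and [ar] are the radial derivatives of A - B and A + B, and [bq] is (A - B) / r; [a'] and
   [c'] are the radial derivatives of [wa] and [wc] divided by r. *)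
pose br := gam d u * dpw 1 s v - pw 1 s v * dgam d u + gam d v * dpw 1 s u - pw 1 s u * dgam d v.
pose ar := gam d u * dpw 1 s v - pw 1 s v * dgam d u - gam d v * dpw 1 s u + pw 1 s u * dgam d v.
pose bq := (wA k s d z - wB k s d z) * (rho k z * irsq k z).
pose a' := ar * (rho k z * irsq k z).
pose c' := irsq k z * (br - bq).
have ax w : time w = 0 -> is_derive z w (wa k s d) (dot z w * a').
  by move=> tw; apply: is_derive_eq (der_wa s d k0 kz w) _; rewrite tw /a' /ar /u /v; ring.
have cx w : time w = 0 -> is_derive z w (wc k s d) (dot z w * c').
  move=> tw; apply: is_derive_eq (der_wc s d k0 kz w) _; rewrite tw /c' /br /bq -/u -/v.
  set br' := gam d u * _ - _ + _ - _.
  transitivity (dot z w * irsq k z * (br' * (rho k z ^+ 2 * irsq k z)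
    - (wA k s d z - wB k s d z) * (rho k z * irsq k z))); first by rewrite /br'; ring.
  by rewrite q2; ring.
have yD e := C1_is_derive e z (C2_derive dir_t f2).
have tX (X : spacetime R -> R) e : is_derive z dir_t X 0 ->
    is_derive z dir_t (Gr k phi X e) ('D_e ('D_dir_t phi) z + X z * irsq k z * y).
  move=> hX; apply: is_derive_eq (der_Gr k0 kz e f2 hX) _.
  exact: time_algebra (sch dir_t e) (dot_t z).
have GX X e w dX (hX : is_derive z w X dX) := der_Gr k0 kz e f2 hX.
have x11 : is_derive z dir_x1 X1 1 by exact: der_X1.
have x12 : is_derive z dir_x1 X2 0 by exact: der_X2.
have x13 : is_derive z dir_x1 X3 0 by exact: der_X3.
have x21 : is_derive z dir_x2 X1 0 by exact: der_X1.
have x22 : is_derive z dir_x2 X2 1 by exact: der_X2.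
have x23 : is_derive z dir_x2 X3 0 by exact: der_X3.
have x31 : is_derive z dir_x3 X1 0 by exact: der_X1.
have x32 : is_derive z dir_x3 X2 0 by exact: der_X2.
have x33 : is_derive z dir_x3 X3 1 by exact: der_X3.
have a1 := ax _ time_x1; have a2 := ax _ time_x2; have a3 := ax _ time_x3.
have c1 := cx _ time_x1; have c2 := cx _ time_x2; have c3 := cx _ time_x3.
rewrite dot_x1 in a1 c1; rewrite dot_x2 in a2 c2; rewrite dot_x3 in a3 c3.
rewrite /edens /eflux.
rewrite (@current_divergence _ _ _ _ _ _ _ z (irsq k z) _ _ _ _ _ _ _ _ _ _ _ _ _ _ _ _ _ q1
  (der_wa s d k0 kz dir_t) (der_wc s d k0 kz dir_t) a1 a2 a3 c1 c2 c3 (yD _) (yD _) (yD _) (yD _)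
  (tX _ dir_x1 (der_X1 z dir_t)) (tX _ dir_x2 (der_X2 z dir_t)) (tX _ dir_x3 (der_X3 z dir_t))
  (GX _ _ _ _ x11) (GX _ _ _ _ x21) (GX _ _ _ _ x31)
  (GX _ _ _ _ x12) (GX _ _ _ _ x22) (GX _ _ _ _ x32)
  (GX _ _ _ _ x13) (GX _ _ _ _ x23) (GX _ _ _ _ x33)); last 3 first.
- exact: curl_algebra (sch dir_x2 dir_x1) (dot_x1 z) (dot_x2 z).
- exact: curl_algebra (sch dir_x3 dir_x1) (dot_x1 z) (dot_x3 z).
- exact: curl_algebra (sch dir_x3 dir_x2) (dot_x2 z) (dot_x3 z).
rewrite -/(emult k s d phi) -/(eXG k phi) -/(eGG k phi) dot_t time_t mul0r.
congr (_ + _).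
  congr (_ * _); exact: box_algebra q1 (dot_x1 z) (dot_x2 z) (dot_x3 z).
rewrite -/y -/u -/v /S /eS; set GGz := eGG k phi z; set XGz := eXG k phi z.
clearbody y GGz XGz.
apply/eqP; rewrite -subr_eq0; apply/eqP.
transitivity ((br - bq) * (1 / 2) * (GGz - y ^+ 2) * (rsq z * irsq k z - 1)
  - (bq - br) * irsq k z * XGz ^+ 2 * (rho k z ^+ 2 * irsq k z - 1)).
  by rewrite /c' /a' /ar /br /bq /wc -/u -/v; field.
by rewrite q1 q2 !subrr !mulr0 subrr.
Qed.

End weighted_energy.

(** * Finite speed of propagation *)

Section finite_speed.
Context {R : realType}.
Implicit Types (z w : spacetime R) (phi F : spacetime R -> R).

(** Otherwise [g] would be at least half of its value at [x] on a small cube around [x], and the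
    integral would be positive. *)
Lemma cube_integral_gt0 (g : spacetime R -> R) (t N : R) (x : R3 R) :
  continuous g -> (forall y, 0 <= g (t, y)) ->
  `|x.1.1| < N -> `|x.1.2| < N -> `|x.2| < N ->
  (\int[leb3]_(y in box3 N) (g (t, y))%:E <= 0)%E -> g (t, x) = 0.
Proof.
move=> cg g0 x1 x2 x3 int0; apply/eqP; rewrite eq_le g0 andbT leNgt; apply/negP => gx.
pose e := g (t, x) / 2.
have e0 : 0 < e by rewrite divr_gt0.
have [del del0 Hdel] : exists2 del, 0 < del & forall y, ball x del y -> e <= g (t, y).
  have /cvgrPdist_lt/(_ e e0)/nbhs_ballP[del /= del0 H] := cg (t, x).
  exists del => // y xy; have := H (t, y) (conj (ballxx t del0) xy).
  rewrite ltr_norml => /andP[_]; rewrite ltrBlDr -ltrBlDl => h; apply: ltW.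
  by apply: le_lt_trans h; rewrite /e; lra.
pose eta := Num.min (del / 2) (Num.min (N - `|x.1.1|) (Num.min (N - `|x.1.2|) (N - `|x.2|))).
have eta0 : 0 < eta by rewrite !lt_min !subr_gt0 x1 x2 x3 divr_gt0.
have le1 : eta <= del / 2 by rewrite ge_min lexx.
have le2 : eta <= N - `|x.1.1| by rewrite !ge_min lexx !orbT.
have le3 : eta <= N - `|x.1.2| by rewrite !ge_min lexx !orbT.
have le4 : eta <= N - `|x.2| by rewrite !ge_min lexx !orbT.
pose I (c : R) : set (measurableTypeR R) := `[c - eta, c + eta]%classic.
pose B := (I x.1.1 `*` I x.1.2) `*` I x.2.
have mI c : measurable (I c) by exact: measurable_itv.
have mB : measurable B by apply: measurableX => //; exact: measurableX.
have muI c : lebesgue_measure (I c) = (2 * eta)%:E.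
  rewrite /I lebesgue_measure_itv/= lte_fin (_ : c - eta < c + eta); last by lra.
  by rewrite -EFinD; congr EFin; ring.
have muB : leb3 B = (2 * eta * (2 * eta) * (2 * eta))%:E.
  rewrite /leb3 product_measure1E//; last exact: measurableX.
  rewrite EFinM; congr (_ * _)%E; last exact: muI.
  rewrite /leb2 [LHS]product_measure1E// EFinM; congr (_ * _)%E; exact: muI.
have Ix c y : I c y -> `|y - c| <= eta.
  by rewrite /I/= in_itv/= ler_distl.
have BN : B `<=` box3 N.
  move=> y [[/= /Ix b1 /Ix b2] /Ix b3]; apply/box3P; split.
  - by have := ler_normD (y.1.1 - x.1.1) x.1.1; rewrite subrK; lra.
  - by have := ler_normD (y.1.2 - x.1.2) x.1.2; rewrite subrK; lra.
  - by have := ler_normD (y.2 - x.2) x.2; rewrite subrK; lra.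
have Bball y : B y -> ball x del y.
  have ed : eta < del by lra.
  move=> [[/= /Ix b1 /Ix b2] /Ix b3]; split; first split.
  - by rewrite /ball/= distrC; exact: le_lt_trans ed.
  - by rewrite /ball/= distrC; exact: le_lt_trans ed.
  - by rewrite /ball/= distrC; exact: le_lt_trans ed.
have mg : measurable_fun (box3 N) (fun y => (g (t, y))%:E).
  by apply/measurable_funTS/measurable_EFinP; exact: measurable_slice.
have : (\int[leb3]_(y in B) (cst e%:E y) <= 0)%E.
  apply: le_trans int0; apply: (@le_trans _ _ (\int[leb3]_(y in B) (g (t, y))%:E)%E).
    apply: ge0_le_integral => //.
    - by move=> y _; rewrite lee_fin ltW.
    - exact: (measurable_funS (measurable_box3 N) BN mg).
    - by move=> y By; rewrite lee_fin; exact/Hdel/Bball.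
  apply: ge0_subset_integral => //; first exact: measurable_box3.
  by move=> y _; rewrite lee_fin.
rewrite integral_cst// => le0.
have : ((e * (2 * eta * (2 * eta) * (2 * eta)))%:E <= 0)%E.
  rewrite EFinM; apply: le_trans le0; rewrite le_eqVlt; apply/orP; left; apply/eqP.
  by congr (_ * _)%E; apply/esym; exact: muB.
by rewrite lee_fin leNgt !mulr_gt0.
Qed.

Lemma derive_const_line (V : normedModType R) (f : V -> R) (v z : V) :
  (forall h : R, f (h *: v + z) = f z) -> 'D_v f z = 0.
Proof.
move=> fz; rewrite /derive; have -> : (fun h : R => h^-1 *: ((f \o shift z) (h *: v) - f z)) = cst 0.
  by apply/funext => h /=; rewrite fz subrr [_ *: _]mulr0.
exact: lim_cst.
Qed.

Definition gradsq phi z := 'D_dir_x1 phi z ^+ 2 + 'D_dir_x2 phi z ^+ 2 + 'D_dir_x3 phi z ^+ 2.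

Lemma initial_jet F phi (x : R3 R) : solves_wave F phi ->
  [/\ phi (0, x) = 0, 'D_dir_t phi (0, x) = 0, 'D_dir_x1 phi (0, x) = 0,
      'D_dir_x2 phi (0, x) = 0 & 'D_dir_x3 phi (0, x) = 0].
Proof.
move=> [_ _ phi0 phit0].
have H (v : spacetime R) : v.1 = 0 -> 'D_v phi (0, x) = 0.
  move=> v0; apply: derive_const_line => h; rewrite phi0.
  have -> : h *: v + (0, x) = (0, (h *: v + (0, x)).2).
    by rewrite [LHS]surjective_pairing; congr pair; rewrite /= v0 [_ *: _]mulr0 add0r.
  by rewrite phi0.
by split; [exact: phi0|exact: phit0|exact: H|exact: H|exact: H].
Qed.

(** Cauchy-Schwarz: |d . f| <= tau |f| wherever [p] is positive. In the use [p] is the truncated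
    quadratic below, [tau] is t1 - t and d is x - x0, so the flux through the level sets of the
    weight is dominated by the energy. *)
Lemma cone_algebra (tau y f1 f2 f3 d1 d2 d3 p : R) : 0 <= tau -> 0 <= p ->
  (0 < p -> d1 ^+ 2 + d2 ^+ 2 + d3 ^+ 2 <= tau ^+ 2) ->
  p * (2 * y * (d1 * f1 + d2 * f2 + d3 * f3)) <= p * (tau * (y ^+ 2 + (f1 ^+ 2 + f2 ^+ 2 + f3 ^+ 2))).
Proof.
move=> tau0 p0 hd.
have [->|pn] := eqVneq p 0; first by rewrite !mul0r.
have pp : 0 < p by rewrite lt_neqAle eq_sym pn.
rewrite ler_pM2l//; have {}hd := hd pp.
set e := d1 * f1 + d2 * f2 + d3 * f3; set f := f1 ^+ 2 + f2 ^+ 2 + f3 ^+ 2.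
have f0 : 0 <= f by rewrite !addr_ge0// sqr_ge0.
have cs : e ^+ 2 <= (d1 ^+ 2 + d2 ^+ 2 + d3 ^+ 2) * f.
  rewrite -subr_ge0; have -> : (d1 ^+ 2 + d2 ^+ 2 + d3 ^+ 2) * f - e ^+ 2 =
   (d1 * f2 - d2 * f1) ^+ 2 + (d1 * f3 - d3 * f1) ^+ 2 + (d2 * f3 - d3 * f2) ^+ 2.
    by rewrite /e /f; ring.
  by rewrite !addr_ge0// sqr_ge0.
have e2 : e ^+ 2 <= tau ^+ 2 * f.
  by apply: le_trans cs _; apply: ler_wpM2r.
clearbody e f.
have [t0|tn] := eqVneq tau 0.
  move: e2; rewrite t0 expr0n/= mul0r => e2.
  have -> : e = 0 by apply/eqP; rewrite -sqrf_eq0 eq_le e2 sqr_ge0.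
  by rewrite mulr0 mul0r.
have tp : 0 < tau by rewrite lt_neqAle eq_sym tn.
rewrite -(ler_pM2l tp).
have := sqr_ge0 (tau * y - e); nra.
Qed.

Lemma cone_dissipation (B Wt W1 W2 W3 y f1 f2 f3 p tau d1 d2 d3 : R) :
  B = 0 -> Wt = 2 * p * (- (2 * tau)) -> W1 = 2 * p * (- (2 * d1)) ->
  W2 = 2 * p * (- (2 * d2)) -> W3 = 2 * p * (- (2 * d3)) -> 0 <= tau -> 0 <= p ->
  (0 < p -> d1 ^+ 2 + d2 ^+ 2 + d3 ^+ 2 <= tau ^+ 2) ->
  B + 1 / 2 * Wt * (y ^+ 2 + (f1 ^+ 2 + f2 ^+ 2 + f3 ^+ 2)) - y * (f1 * W1 + f2 * W2 + f3 * W3) <= 0.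
Proof.
move=> -> -> -> -> -> tau0 p0 hd.
by have := cone_algebra y f1 f2 f3 tau0 p0 hd; lra.
Qed.

Lemma energy_flux_algebra (W Wt W1 W2 W3 y yt f1 f2 f3 f11 f22 f33 y1 y2 y3 a1 a2 a3 : R) :
  a1 = y1 -> a2 = y2 -> a3 = y3 ->
  W * (1 / 2 * (2 * y * yt + (2 * f1 * a1 + 2 * f2 * a2 + 2 * f3 * a3)) + (y ^+ 2 + (f1 ^+ 2 + f2 ^+ 2 + f3 ^+ 2)) * 0)
  + 1 / 2 * (y ^+ 2 + (f1 ^+ 2 + f2 ^+ 2 + f3 ^+ 2)) * Wt
  + (- (W * (y * f11 + f1 * y1) + y * f1 * W1) + - (W * (y * f22 + f2 * y2) + y * f2 * W2)
     + - (W * (y * f33 + f3 * y3) + y * f3 * W3))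
  = W * y * (yt - (f11 + f22 + f33))
    + 1 / 2 * Wt * (y ^+ 2 + (f1 ^+ 2 + f2 ^+ 2 + f3 ^+ 2)) - y * (f1 * W1 + f2 * W2 + f3 * W3).
Proof. by move=> -> -> ->; field. Qed.

Lemma rsqE (t : R) (x : R3 R) : rsq (t, x) = enorm x ^+ 2.
Proof. by rewrite sqr_enorm. Qed.

Lemma box_op_supp F phi (t : R) (x : R3 R) : solves_wave F phi ->
  supp F `<=` [set z | enorm z.2 <= z.1 + 1] -> 0 < t -> t + 1 < enorm x ->
  box_op phi (t, x) = 0.
Proof.
move=> [_ we _ _] sF t0 tx; rewrite /box_op we//.
apply/eqP/negPn/negP => F0.
have /sF/= : supp F (t, x) by apply: subset_closure.
by rewrite leNgt tx.
Qed.

Lemma enorm_triangle_sq (x x0 : R3 R) (a b : R) : 0 <= a -> 0 <= b ->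
  enorm x <= a ->
  (x.1.1 - x0.1.1) ^+ 2 + (x.1.2 - x0.1.2) ^+ 2 + (x.2 - x0.2) ^+ 2 <= b ^+ 2 ->
  enorm x0 <= a + b.
Proof.
move=> a0 b0 xa xb.
have xa2 : x.1.1 ^+ 2 + x.1.2 ^+ 2 + x.2 ^+ 2 <= a ^+ 2.
  by rewrite -sqr_enorm ler_sqr ?nnegrE ?enorm_ge0.
rewrite -(@ler_sqr R) ?nnegrE ?enorm_ge0 ?addr_ge0// sqr_enorm.
case: x x0 xa xb xa2 => [[p1 p2] p3] [[q1 q2] q3] /= _ xb xa2.
set m := p1 * (p1 - q1) + p2 * (p2 - q2) + p3 * (p3 - q3).
set A := p1 ^+ 2 + p2 ^+ 2 + p3 ^+ 2 in xa2 *.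
set B := (p1 - q1) ^+ 2 + (p2 - q2) ^+ 2 + (p3 - q3) ^+ 2 in xb *.
have cs : m ^+ 2 <= A * B.
  rewrite -subr_ge0; have -> : A * B - m ^+ 2 =
   (p1 * (p2 - q2) - p2 * (p1 - q1)) ^+ 2 + (p1 * (p3 - q3) - p3 * (p1 - q1)) ^+ 2
   + (p2 * (p3 - q3) - p3 * (p2 - q2)) ^+ 2.
    by rewrite /A /B /m; ring.
  by rewrite !addr_ge0// sqr_ge0.
have -> : q1 ^+ 2 + q2 ^+ 2 + q3 ^+ 2 = A + B - 2 * m by rewrite /A /B /m; ring.
have A0 : 0 <= A by rewrite !addr_ge0// sqr_ge0.
have B0 : 0 <= B by rewrite !addr_ge0// sqr_ge0.
have AB : A * B <= (a * b) ^+ 2 by rewrite exprMn ler_pM.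
have : - m <= a * b.
  have : `|m| <= a * b.
    rewrite -(@ler_sqr R) ?nnegrE ?mulr_ge0// real_normK ?num_real//.
    exact: le_trans AB.
  by rewrite ler_norml => /andP[]; lra.
by clearbody A B m; nra.
Qed.

(** The unweighted energy density, localised in the backward cone of (t1, x0), integrates to zero at
    t = 0 and cannot grow, as the cone misses the support of the source. The localising weight is
    positive at (tau, x0), which forces phi_t = 0 there; phi itself follows from its initial
    value. *)
Lemma finite_speed F phi (t0 : R) (x0 : R3 R) : solves_wave F phi ->
  supp F `<=` [set z | enorm z.2 <= z.1 + 1] ->
  0 <= t0 -> t0 + 1 < enorm x0 -> phi (t0, x0) = 0.
Proof.
move=> sw sF t00 tx0; have [f2 we phi0 phit0] := sw.
have [->|t0n] := eqVneq t0 0; first exact: phi0.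
have t0p : 0 < t0 by rewrite lt_neqAle eq_sym t0n.
(* The midpoint of t0 and |x0| - 1: later than t0, so that the weight is still positive at (t0, x0),
   and with t1 + 1 < |x0|, so that the cone avoids the support of F. *)
pose t1 := (t0 + enorm x0 - 1) / 2.
have t01 : t0 < t1 by rewrite /t1; lra.
have t1x : t1 + 1 < enorm x0 by rewrite /t1; lra.
(* The C^1 weight max(0, (t1 - t)^2 - |x - x0|^2)^2 vanishes outside the
   backward cone of (t1, x0), so integration is over a fixed box. *)
pose g z := (t1 - time z) ^+ 2
   - ((X1 z - x0.1.1) ^+ 2 + (X2 z - x0.1.2) ^+ 2 + (X3 z - x0.2) ^+ 2).
pose W z := pos (g z) ^+ 2.
pose y := 'D_dir_t phi.
have C1g : is_Ck 1 g.
  apply: C1B; first by apply: C1X; apply: C1B; [exact: C1_cst|exact: C1_time].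
  by apply: C1D; [apply: C1D|]; apply: C1X; apply: C1B;
    [exact: C1_X1|exact: C1_cst|exact: C1_X2|exact: C1_cst|exact: C1_X3|exact: C1_cst].
have C1W : is_Ck 1 W.
  apply: (@C1_comp _ _ (fun p : R => pos p ^+ 2) (fun p : R => 2 * pos p) g) => //.
    by move=> x; exact: is_derive_posq.
  move=> x; apply: cvgM; first exact: cvg_cst.
  exact: continuous_pos.
have derW z w : is_derive z w W (2 * pos (g z) * (- (2 * (t1 - time z) * time w)
    - (2 * (X1 z - x0.1.1) * X1 w + 2 * (X2 z - x0.1.2) * X2 w + 2 * (X3 z - x0.2) * X3 w))).
  have h1 := der_X1 z w; have h2 := der_X2 z w; have h3 := der_X3 z w.
  have h4 := der_time z w.
  apply: (@der_comp _ _ (fun p : R => pos p ^+ 2) (fun p : R => 2 * pos p) g); first exact: is_derive_posq.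
  by eapply is_derive_eq; [rewrite /g; der|ring].
have C1y e := C2_derive e f2.
pose e2 z := y z ^+ 2 + gradsq phi z.
have C1e2 : is_Ck 1 e2.
  apply: C1D; first by apply: C1X; exact: C1y.
  by apply: C1D; [apply: C1D|]; apply: C1X; exact: C1y.
pose P z := W z * (1 / 2 * e2 z).
pose J e z := - (W z * (y z * 'D_e phi z)).
have C1P : is_Ck 1 P := C1M C1W (C1M (C1_cst (1 / 2)) C1e2).
have C1J e : is_Ck 1 (J e) := C1N (C1M C1W (C1M (C1y dir_t) (C1y e))).
have dP z : 'D_dir_t P z = W z * (1 / 2 * (2 * y z * 'D_dir_t y z
    + (2 * 'D_dir_x1 phi z * 'D_dir_t ('D_dir_x1 phi) z
       + 2 * 'D_dir_x2 phi z * 'D_dir_t ('D_dir_x2 phi) z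
       + 2 * 'D_dir_x3 phi z * 'D_dir_t ('D_dir_x3 phi) z)) + e2 z * 0)
    + 1 / 2 * e2 z * 'D_dir_t W z.
  have d0 := C1_is_derive dir_t z (C1y dir_t).
  have d1 := C1_is_derive dir_t z (C1y dir_x1).
  have d2 := C1_is_derive dir_t z (C1y dir_x2).
  have d3 := C1_is_derive dir_t z (C1y dir_x3).
  exact: derive_valE (derM (C1_is_derive dir_t z C1W) (derM (derC (1 / 2) dir_t z)
    (derD (derX d0) (derD (derD (derX d1) (derX d2)) (derX d3))))).
have dJ e z : 'D_e (J e) z = - (W z * (y z * 'D_e ('D_e phi) z + 'D_e phi z * 'D_e y z)
    + y z * 'D_e phi z * 'D_e W z).
  exact: derive_valE (derN (derM (C1_is_derive e z C1W)
    (derM (C1_is_derive e z (C1y dir_t)) (C1_is_derive e z (C1y e))))).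
have dW z e : 'D_e W z = _ := derive_valE (derW z e).
(* On a face some coordinate of x is at distance at least t1 + 1 from that of x0, hence x is outside
   the cone. *)
pose N := enorm x0 + t1 + 1.
have [c1 c2 c3] := coord_le_enorm x0.
have t1p : 0 < t1 by exact: lt_trans t01.
have x0p : 0 <= enorm x0 by exact: enorm_ge0.
have N0 : 0 < N by rewrite /N; lra.
have face t x : 0 <= t <= t0 -> N \in [:: `|x.1.1|; `|x.1.2|; `|x.2|] -> W (t, x) = 0.
  move=> /andP[tp tt] xN; rewrite /W.
  have key (p q : R) : `|q| <= enorm x0 -> N = `|p| -> (t1 - t) ^+ 2 <= (p - q) ^+ 2.
    move=> hq hp; rewrite -[leRHS]real_normK ?num_real// ler_sqr ?nnegrE//; last by lra.
    by have := lerB_dist p q; rewrite -hp /N; lra.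
  have -> : pos (g (t, x)) = 0.
    apply/max_l; rewrite /g /time /X1 /X2 /X3/=.
    have s1 := sqr_ge0 (x.1.1 - x0.1.1); have s2 := sqr_ge0 (x.1.2 - x0.1.2).
    have s3 := sqr_ge0 (x.2 - x0.2).
    move: xN; rewrite !inE => /or3P[] /eqP xN.
    - by have := key _ _ c1 xN; lra.
    - by have := key _ _ c2 xN; lra.
    - by have := key _ _ c3 xN; lra.
  by rewrite expr0n.
have yzero tau : 0 < tau <= t0 -> y (tau, x0) = 0.
  move=> /andP[tau0 taut].
  have : P (tau, x0) = 0.
    apply: (@cube_integral_gt0 P tau N).
    - exact: C1_continuous C1P.
    - move=> x; rewrite /P /e2 /gradsq; apply: mulr_ge0; first exact: sqr_ge0.
      by apply: mulr_ge0; [lra|rewrite !addr_ge0// sqr_ge0].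
    - by rewrite /N; lra.
    - by rewrite /N; lra.
    - by rewrite /N; lra.
    apply: le_trans (box_divergence_le tau0 N0 C1P (C1J dir_x1) (C1J dir_x2) (C1J dir_x3)
      (h := fun=> 0) _ _ _ _) _.
    - exact: cst_continuous.
    - move=> t x /andP[tp tt] xN; rewrite /J face//; last by rewrite tp (le_trans tt).
      by split; rewrite mul0r oppr0.
    - move=> x; have [_ h0 h1 h2 h3] := initial_jet x sw.
      have e20 : e2 (0, x) = 0 by rewrite /e2 /gradsq /y h0 h1 h2 h3; ring.
      by rewrite /P e20 !mulr0.
    - move=> t x /andP[tp tt] xN.
      have tt1 : t <= t1 by apply: le_trans tt _; apply: le_trans taut _; exact: ltW.
      refine (eq_ind_r (fun r => r <= 0) _ (etrans (congr2 +%R (dP (t, x))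
        (congr2 +%R (congr2 +%R (dJ dir_x1 (t, x)) (dJ dir_x2 (t, x))) (dJ dir_x3 (t, x))))
        (energy_flux_algebra _ _ _ _ _ _ _ _ _ _ _ _ _ (schwarz dir_t dir_x1 (t, x) f2)
        (schwarz dir_t dir_x2 (t, x) f2) (schwarz dir_t dir_x3 (t, x) f2)))).
      apply: (@cone_dissipation _ _ _ _ _ _ _ _ _ (pos (g (t, x))) (t1 - time (t, x))
        (X1 (t, x) - x0.1.1) (X2 (t, x) - x0.1.2) (X3 (t, x) - x0.2)).
      + have [gt0|gt0] := leP (g (t, x)) 0; first by rewrite /W /pos max_l// expr0n/= !mul0r.
        have := box_op_supp sw sF tp; move=> /(_ x) bs; rewrite -[_ - _]/(box_op phi (t, x)) bs ?mulr0//.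
        (* A point of the cone with |x| <= t + 1 would give |x0| <= (t + 1) + (t1 - t) = t1 + 1. *)
        rewrite ltNge; apply/negP => xt.
        have tp1 : 0 <= t + 1 by lra.
        have tp2 : 0 <= t1 - t by rewrite subr_ge0.
        move: gt0; rewrite /g subr_gt0 => /ltW gt0.
        by have := enorm_triangle_sq tp1 tp2 xt gt0; lra.
      + by rewrite dW time_t; congr (_ * _); rewrite /X1 /X2 /X3 /=; ring.
      + by rewrite dW time_x1; congr (_ * _); rewrite /X1 /X2 /X3 /=; ring.
      + by rewrite dW time_x2; congr (_ * _); rewrite /X1 /X2 /X3 /=; ring.
      + by rewrite dW time_x3; congr (_ * _); rewrite /X1 /X2 /X3 /=; ring.
      + by rewrite subr_ge0.
      + by rewrite /pos le_max lexx.
      + by rewrite /pos lt_max ltxx/= /g subr_gt0 => /ltW.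
    by rewrite integral0.
  rewrite /P /e2 => /eqP; rewrite mulf_eq0 => /orP[].
    rewrite /W sqrf_eq0 /pos max_r.
      rewrite /g /time /X1 /X2 /X3/= !subrr expr0n/= !addr0 subr0 sqrf_eq0 subr_eq0.
      by move=> /eqP t1E; move: taut; rewrite -t1E leNgt t01.
    by rewrite /g /X1 /X2 /X3/= !subrr expr0n/= !addr0 subr0 sqr_ge0.
  rewrite mulf_eq0 => /orP[|]; first by rewrite mul1r invr_eq0 pnatr_eq0.
  rewrite /gradsq paddr_eq0 ?sqr_ge0 ?addr_ge0 ?sqr_ge0//.
  by rewrite sqrf_eq0 => /andP[/eqP].
have cphi := C2_C1 f2.
have dline (t : R) : is_derive t 1 (phi \o (fun t => (t, x0))) ('D_dir_t phi (t, x0)).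
  apply: (@is_derive_line _ _ phi (fun t => (t, x0))); last exact: C1_derivable.
  move=> h k; congr pair; rewrite /=; first by rewrite [_ *: _]mulr1.
  case: (x0) => [[p1 p2] p3]; congr pair; last by rewrite /= [_ *: _]mulr0 add0r.
  by congr pair; rewrite /= [_ *: _]mulr0 add0r.
have [|e] := @MVT_segment _ (phi \o (fun t => (t, x0))) (fun t => 'D_dir_t phi (t, x0)) 0 t0 t00.
  by apply: derivable_within_continuous => t _; have [] := dline t.
rewrite in_itv/= => /andP[e0 et]; rewrite phi0 subr0 => ->.
have [->|en] := eqVneq e 0; first by rewrite phit0 mul0r.
by rewrite -/(y (e, x0)) yzero ?mul0r// lt_neqAle eq_sym en e0.
Qed.

(** For t > 0 the exterior of the cone is open and phi vanishes on it, so its derivatives vanish as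
    well; t = 0 is the case of the initial data. *)
Lemma outside_jet F phi (t : R) (x : R3 R) : solves_wave F phi ->
  supp F `<=` [set z | enorm z.2 <= z.1 + 1] -> 0 <= t -> t + 1 < enorm x ->
  [/\ phi (t, x) = 0, 'D_dir_t phi (t, x) = 0, 'D_dir_x1 phi (t, x) = 0,
      'D_dir_x2 phi (t, x) = 0 & 'D_dir_x3 phi (t, x) = 0].
Proof.
move=> sw sF t0 tx.
have [->|tn] := eqVneq t 0; first exact: initial_jet sw.
have tp : 0 < t by rewrite lt_neqAle eq_sym tn.
pose H z := rsq z - (time z + 1) ^+ 2.
have cH : continuous H.
  apply: C1_continuous; apply: C1B; first exact: C1_rsq.
  by apply: C1X; apply: C1D; [exact: C1_time|exact: C1_cst].
have H0 : 0 < H (t, x).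
  by rewrite /H rsqE /time/= subr_gt0 ltr_sqr ?nnegrE ?enorm_ge0//; lra.
have near0 : {near (t, x), phi =1 cst 0}.
  have n1 : \forall z \near (t, x), 0 < H z.
    exact: (cvgr_gt _ (cH (t, x))).
  have n2 : \forall z \near (t, x), 0 < time z.
    exact: (cvgr_gt _ (@continuous_time R (t, x))).
  have key z : 0 < H z -> 0 < time z -> phi z = 0.
    case: z => t' x'; rewrite /H /time rsqE/= subr_gt0 => + tz.
    rewrite ltr_sqr ?nnegrE ?enorm_ge0//; last by lra.
    by move=> h; apply: (finite_speed sw sF) => //; exact: ltW.
  by near=> z; apply: key; near: z.
have D v : 'D_v phi (t, x) = 0 by rewrite (near_eq_derive _ near0) derive_cst.
by split; [exact: nbhs_singleton near0|exact: D..].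
Unshelve. all: by end_near. Qed.

End finite_speed.

(** * Pointwise estimates *)

Section pointwise.
Context {R : realType}.

Lemma pwE (a w : R) : 1 <= w -> pw 1 a w = w `^ a.
Proof. by move=> w1; rewrite /pw ellE. Qed.

Lemma dpwE (a w : R) : 1 <= w -> dpw 1 a w = a * w `^ (a - 1).
Proof. by move=> w1; rewrite /dpw ellE// dellE// mulr1. Qed.

(** The maximum of the left side over [X] is g^2 F^2 / (8 d U), and g^2 <= 4 gives the constant. *)
Lemma amgm (d g U Ui X F : R) : 0 < d -> 0 < U -> U * Ui = 1 -> 0 <= g <= 2 ->
  g * X * F - 2 * d * U * X ^+ 2 <= 1 / (2 * d) * Ui * F ^+ 2.
Proof.
move=> d0 U0 UU /andP[g0 g2].
have -> : Ui = U^-1 by rewrite -[RHS]mulr1 -UU mulrA mulVf ?mul1r// gt_eqF.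
rewrite -subr_ge0.
have -> : 1 / (2 * d) * U^-1 * F ^+ 2 - (g * X * F - 2 * d * U * X ^+ 2) =
  ((4 * d * U * X - g * F) ^+ 2 + (4 - g ^+ 2) * F ^+ 2) / (8 * d * U).
  by field; rewrite !gt_eqF.
apply: divr_ge0; last by rewrite !mulr_ge0// ltW.
apply: addr_ge0; first exact: sqr_ge0.
by apply: mulr_ge0; [nra|exact: sqr_ge0].
Qed.

Lemma gam_bounds (d w : R) : 0 < d -> 1 <= w -> 1 <= gam d w <= 2.
Proof.
move=> d0 w1; rewrite /gam pwE// lerDl powR_ge0/= -[leRHS]/(1 + 1) lerD2l.
by rewrite -[leRHS](powRr0 w) ler_powR//; lra.
Qed.

Lemma gam_mono (d u v : R) : 0 < d -> 1 <= u -> u <= v -> gam d v <= gam d u.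
Proof.
move=> d0 u1 uv; rewrite /gam !pwE//; last exact: le_trans uv.
have u0 : 0 < u by lra.
have v0 : 0 < v by lra.
rewrite lerD2l !powRN lef_pV2 ?posrE ?powR_gt0//.
by apply: ge0_ler_powR => //; rewrite ?nnegrE; lra.
Qed.

Lemma angular_sign (s d u v rho iq : R) : 1 < s -> s < 2 -> 0 < d -> 1 <= u ->
  v = u + 2 * rho -> 0 < rho -> rho * iq = 1 ->
  gam d u * dpw 1 s v + gam d v * dpw 1 s u
  - (gam d u * pw 1 s v - gam d v * pw 1 s u) * iq <= 0.
Proof.
move=> s1 s2 d0 u1 vE r0 rq.
have uv : u <= v by lra.
have v1 : 1 <= v by lra.
have g1 := gam_bounds d0 u1; have g2 := gam_bounds d0 v1.
have gm := gam_mono d0 u1 uv.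
have u0 : 0 < u by lra.
have := trapezoid s1 s2 u0 uv; rewrite !dpwE// !pwE//.
have p1 : 0 <= s * u `^ (s - 1) by rewrite mulr_ge0 ?powR_ge0//; lra.
have p2 : 0 <= u `^ s by exact: powR_ge0.
have -> : iq = rho^-1 by rewrite -[RHS]mulr1 -rq mulrA mulVf ?mul1r// gt_eqF.
move: (u `^ s) (v `^ s) (s * u `^ (s - 1)) (s * v `^ (s - 1)) p1 p2 => pu pv su sv p1 p2.
have -> : (v - u) / 2 = rho by rewrite vE; field.
move=> T; rewrite subr_le0 ler_pdivlMr//.
move: (gam d u) (gam d v) g1 g2 gm => gu gv /andP[a1 a2] /andP[b1 b2] gm.
(* The sum of [H] and [H2] is minus [rho] times the left side of the claim: [H2] is the trapezoidal
   defect, [H] the gain from the decrease of [gam]. *)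
have H : 0 <= (gu - gv) * (pu + rho * su) by apply: mulr_ge0; [lra|apply: addr_ge0 => //; apply: mulr_ge0 => //; exact: ltW].
have H2 : 0 <= gu * (pv - pu - rho * (sv + su)) by apply: mulr_ge0; lra.
nra.
Qed.

(** AM-GM on the incoming term produces u^s v^(1+2d) F^2, while the source norm offers v^s u^(1+2d).
    After the common factor is removed, u^e <= v^e remains with e = s - (1 + 2d) >= 0. *)
Lemma weight_exchange (s d u v : R) : 0 < d -> 1 + 2 * d <= s -> 1 <= u -> u <= v ->
  u `^ s * v `^ (1 + 2 * d) <= v `^ s * u `^ (1 + 2 * d).
Proof.
move=> d0 ds u1 uv.
have u0 : u != 0 by rewrite gt_eqF//; lra.
have v0 : v != 0 by rewrite gt_eqF//; lra.
have -> : s = 1 + 2 * d + (s - (1 + 2 * d)) by ring.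
set e := s - (1 + 2 * d); set a := 1 + 2 * d.
rewrite (@powRD _ u a e) ?u0 ?implybT// (@powRD _ v a e) ?v0 ?implybT//.
have -> : u `^ a * u `^ e * v `^ a = u `^ a * v `^ a * u `^ e by ring.
have -> : v `^ a * v `^ e * u `^ a = u `^ a * v `^ a * v `^ e by ring.
apply: ler_wpM2l; first by rewrite mulr_ge0 ?powR_ge0.
by apply: ge0_ler_powR => //; rewrite ?nnegrE /e; lra.
Qed.

Lemma bulk_bound (s d u v rho iq y S Z2 F A B : R) :
  1 < s -> s < 2 -> 0 < d -> 1 + 2 * d <= s -> 1 <= u ->
  v = u + 2 * rho -> 0 < rho -> rho * iq = 1 -> 0 <= Z2 ->
  A = gam d u * pw 1 s v -> B = gam d v * pw 1 s u ->
  (A * (y + S) + B * (y - S)) * F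
  + (dgam d u * pw 1 s v * (y + S) ^+ 2 + dgam d v * pw 1 s u * (y - S) ^+ 2
     + (gam d u * dpw 1 s v + gam d v * dpw 1 s u - (A - B) * iq) * Z2)
  <= d^-1 * (pw 1 s v * pw 1 (1 + 2 * d) u) * F ^+ 2.
Proof.
move=> s1 s2 d0 ds u1 vE r0 rq Z0 -> ->.
have uv : u <= v by lra.
have v1 : 1 <= v by lra.
have hz := angular_sign s1 s2 d0 u1 vE r0 rq.
have {hz} := mulr_le0_ge0 hz Z0.
set bz := (_ * Z2) => hz.
have we := weight_exchange d0 ds u1 uv.
have [u0 v0] : 0 < u /\ 0 < v by split; lra.
have UU w : 0 < w -> w `^ (- (2 * d) - 1) * w `^ (1 + 2 * d) = 1.
  move=> w0; rewrite -powRD; last by rewrite (gt_eqF w0) implybT.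
  by rewrite (_ : - (2 * d) - 1 + (1 + 2 * d) = 0) ?powRr0//; ring.
have g2 w : 1 <= w -> 0 <= gam d w <= 2.
  by move=> w1; have /andP[a ->] := gam_bounds d0 w1; rewrite (le_trans _ a).
have Hu := amgm (y + S) F d0 (powR_gt0 (- (2 * d) - 1) u0) (UU u u0) (g2 u u1).
have Hv := amgm (y - S) F d0 (powR_gt0 (- (2 * d) - 1) v0) (UU v v0) (g2 v v1).
move: hz Hu Hv; rewrite /dgam !dpwE// !pwE//.
move=> hz /(ler_wpM2l (powR_ge0 v s)) Hu /(ler_wpM2l (powR_ge0 u s)) Hv.
have H3 := ler_wpM2r (sqr_ge0 F) we.
have d2 : 0 <= 1 / (2 * d) by rewrite divr_ge0// mulr_ge0// ltW.
have {}H3 := ler_wpM2l d2 H3.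
clearbody bz.
move: (gam d u) (gam d v) Hu Hv => gu gv.
move: (u `^ s) (v `^ s) (u `^ (1 + 2 * d)) (v `^ (1 + 2 * d)) H3 => pu pv qu qv H3.
move: (u `^ (- (2 * d) - 1)) (v `^ (- (2 * d) - 1)) => U V Hu Hv.
(* One half of the constant for the outgoing term, one half for the incoming one. *)
have -> : d^-1 * (pv * qu) * F ^+ 2 = 1 / (2 * d) * (pv * qu * F ^+ 2) + 1 / (2 * d) * (pv * qu * F ^+ 2).
  by field; rewrite gt_eqF.
set K := 1 / (2 * d) in Hu Hv H3 *; clearbody K.
lra.
Qed.

(** In null form the density is half of A ((y + S)^2 + Z) + B ((y - S)^2 + Z), with Z = GGz - S^2.
    Both A and B are at least u^s, because gam >= 1 and v >= u, and for A = B = u^s the left side is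
    recovered. *)
Lemma density_lower (s d u v iq a c y XGz GGz S : R) : 0 < d -> 1 < s -> 1 <= u -> u <= v ->
  a = gam d u * pw 1 s v + gam d v * pw 1 s u ->
  c = (gam d u * pw 1 s v - gam d v * pw 1 s u) * iq ->
  S = XGz * iq -> S ^+ 2 <= GGz ->
  u `^ s * (y ^+ 2 + S ^+ 2 + (GGz - S ^+ 2)) <= 1 / 2 * (a * (y ^+ 2 + GGz)) + c * (y * XGz).
Proof.
move=> d0 s1 u1 uv -> -> SE SG.
have v1 : 1 <= v by lra.
have /andP[a1 a2] := gam_bounds d0 u1; have /andP[b1 b2] := gam_bounds d0 v1.
rewrite !pwE//.
have uvs : u `^ s <= v `^ s by apply: ge0_ler_powR => //; rewrite ?nnegrE; lra.
have us := powR_ge0 u s.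
have -> : (gam d u * v `^ s - gam d v * u `^ s) * iq * (y * XGz) =
  (gam d u * v `^ s - gam d v * u `^ s) * (y * S) by rewrite SE; ring.
have A1 : u `^ s <= gam d u * v `^ s.
  by apply: le_trans uvs _; rewrite -[leLHS]mul1r; apply: ler_wpM2r => //; exact: powR_ge0.
have B1 : u `^ s <= gam d v * u `^ s.
  by rewrite -[leLHS]mul1r; apply: ler_wpM2r.
move: A1 B1 us; move: (gam d v * u `^ s) => B; move: (gam d u * v `^ s) => A.
move: (u `^ s) => p A1 B1 p0.
rewrite -subr_ge0.
have -> : 1 / 2 * ((A + B) * (y ^+ 2 + GGz)) + (A - B) * (y * S) - p * (y ^+ 2 + S ^+ 2 + (GGz - S ^+ 2))
  = 1 / 2 * (A - p) * (y + S) ^+ 2 + 1 / 2 * (B - p) * (y - S) ^+ 2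
    + 1 / 2 * ((A - p) + (B - p)) * (GGz - S ^+ 2) by field.
have s1' := sqr_ge0 (y + S); have s2' := sqr_ge0 (y - S).
have h1 : 0 <= 1 / 2 * (A - p) by lra.
have h2 : 0 <= 1 / 2 * (B - p) by lra.
have h3 : 0 <= 1 / 2 * ((A - p) + (B - p)) by lra.
have h4 : 0 <= GGz - S ^+ 2 by rewrite subr_ge0.
by apply: addr_ge0; [apply: addr_ge0|]; apply: mulr_ge0.
Qed.

(** The correction q p x is radial: it turns x . grad phi into x . grad phi + phi and leaves the
    angular part of the gradient alone. The last claim is Cauchy-Schwarz. *)
Lemma radial_algebra (x1 x2 x3 f1 f2 f3 p q rho : R) :
  (x1 ^+ 2 + x2 ^+ 2 + x3 ^+ 2) * q = 1 -> rho ^+ 2 * q = 1 ->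
  let D := x1 * f1 + x2 * f2 + x3 * f3 in
  let g1 := f1 + x1 * (q * p) in let g2 := f2 + x2 * (q * p) in
  let g3 := f3 + x3 * (q * p) in
  let S := (x1 * g1 + x2 * g2 + x3 * g3) * (rho * q) in
  [/\ S ^+ 2 = q * (D + p) ^+ 2,
      g1 ^+ 2 + g2 ^+ 2 + g3 ^+ 2 - S ^+ 2 = f1 ^+ 2 + f2 ^+ 2 + f3 ^+ 2 - q * D ^+ 2
    & q * D ^+ 2 <= f1 ^+ 2 + f2 ^+ 2 + f3 ^+ 2].
Proof.
move=> qE rE D g1 g2 g3 S.
have XGE : x1 * g1 + x2 * g2 + x3 * g3 = D + p.
  transitivity (D + (x1 ^+ 2 + x2 ^+ 2 + x3 ^+ 2) * q * p); first by rewrite /g1 /g2 /g3 /D; ring.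
  by rewrite qE mul1r.
have SE : S ^+ 2 = q * (D + p) ^+ 2.
  rewrite /S XGE; transitivity (q * (D + p) ^+ 2 * (rho ^+ 2 * q)); first by ring.
  by rewrite rE mulr1.
split => //.
  rewrite SE /g1 /g2 /g3.
  transitivity (f1 ^+ 2 + f2 ^+ 2 + f3 ^+ 2 + 2 * q * p * D + (x1 ^+ 2 + x2 ^+ 2 + x3 ^+ 2) * q * q * p ^+ 2
    - q * (D + p) ^+ 2); first by rewrite /D; ring.
  by rewrite qE; ring.
have q0 : 0 <= q.
  by rewrite -[q]mul1r -rE -mulrA -expr2 mulr_ge0 ?sqr_ge0.
rewrite -subr_ge0.
have -> : f1 ^+ 2 + f2 ^+ 2 + f3 ^+ 2 - q * D ^+ 2 =
  (x1 ^+ 2 + x2 ^+ 2 + x3 ^+ 2) * q * (f1 ^+ 2 + f2 ^+ 2 + f3 ^+ 2) - q * D ^+ 2.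
  by rewrite qE mul1r.
have -> : (x1 ^+ 2 + x2 ^+ 2 + x3 ^+ 2) * q * (f1 ^+ 2 + f2 ^+ 2 + f3 ^+ 2) - q * D ^+ 2 =
  q * ((x1 * f2 - x2 * f1) ^+ 2 + (x1 * f3 - x3 * f1) ^+ 2 + (x2 * f3 - x3 * f2) ^+ 2).
  by rewrite /D; ring.
by rewrite mulr_ge0// !addr_ge0// sqr_ge0.
Qed.

End pointwise.

(** * Energy and Hardy estimates away from the origin *)

Section truncated_energy.
Context {R : realType}.
Variables (s d : R) (F phi : spacetime R -> R).
Hypotheses (s1 : 1 < s) (s2 : s < 2) (d0 : 0 < d) (ds : 1 + 2 * d <= s).
Hypotheses (sw : solves_wave F phi)
  (sF : supp F `<=` [set z | enorm z.2 <= z.1 + 1]).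
Implicit Types (k t T N : R) (x : R3 R) (z w : spacetime R).

Let f2 : is_Ck 2 phi. Proof. by case: sw. Qed.

Let jet0 z := [/\ phi z = 0, 'D_dir_t phi z = 0, 'D_dir_x1 phi z = 0,
  'D_dir_x2 phi z = 0 & 'D_dir_x3 phi z = 0].

Lemma jet0_energy k z : jet0 z ->
  [/\ edens k s d phi z = 0, forall X G, eflux k s d phi X G z = 0 * X z - 0 * G z,
   emult k s d phi z = 0, eGG k phi z = 0 & eXG k phi z = 0].
Proof.
move=> [p0 y0 h1 h2 h3].
have g1 : eG1 k phi z = 0 by rewrite /eG1 /Gr p0 h1 !mulr0 addr0.
have g2 : eG2 k phi z = 0 by rewrite /eG2 /Gr p0 h2 !mulr0 addr0.
have g3 : eG3 k phi z = 0 by rewrite /eG3 /Gr p0 h3 !mulr0 addr0.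
have xg : eXG k phi z = 0 by rewrite /eXG /XG g1 g2 g3 !mulr0 !addr0.
have gg : eGG k phi z = 0 by rewrite /eGG /GG g1 g2 g3 expr0n/= !addr0.
have m0 : emult k s d phi z = 0.
  by rewrite /emult /mult y0 -/(eXG k phi z) xg !mulr0 addr0.
split => //.
  by rewrite /edens /dens y0 -/(eXG k phi z) -/(eGG k phi z) xg gg expr0n/= !addr0 !mulr0 addr0.
move=> X G; rewrite /eflux /flux y0 -/(eGG k phi z) gg -/(emult k s d phi z) m0 expr0n/=.
by rewrite subr0 !mulr0 !mul0r.
Qed.

Definition pdens k z := chi k z * edens k s d phi z.
Definition pflux k X G z := chi k z * eflux k s d phi X G z.
(** The cutoff is radial and independent of time, so its derivative meets only the radial component
    of the flux. *)
Definition cutoff_err k z := dsigma (k^-1 * rsq z) * (k^-1 * 2)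
  * (X1 z * eflux k s d phi X1 (eG1 k phi) z + X2 z * eflux k s d phi X2 (eG2 k phi) z
     + X3 z * eflux k s d phi X3 (eG3 k phi) z).
(** Stated with [box_op phi], which is continuous on all of space-time, whereas the equation
    determines F for t > 0 only. *)
Definition bulk k z :=
  chi k z * (d^-1 * (pw 1 s (vv k z) * pw 1 (1 + 2 * d) (uu k z)) * box_op phi z ^+ 2).

Lemma C1_eG k : 0 < k ->
  [/\ is_Ck 1 (eG1 k phi), is_Ck 1 (eG2 k phi) & is_Ck 1 (eG3 k phi)].
Proof.
by move=> k0; split; apply: C1_Gr => //; [exact: C1_X1|exact: C1_X2|exact: C1_X3].
Qed.

Lemma C1_eXG k : 0 < k -> is_Ck 1 (eXG k phi).
Proof.
move=> k0; have [g1 g2 g3] := C1_eG k0.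
exact: C1D (C1D (C1M C1_X1 g1) (C1M C1_X2 g2)) (C1M C1_X3 g3).
Qed.

Lemma C1_eGG k : 0 < k -> is_Ck 1 (eGG k phi).
Proof.
move=> k0; have [g1 g2 g3] := C1_eG k0.
exact: C1D (C1D (C1X g1) (C1X g2)) (C1X g3).
Qed.

Lemma C1_emult k : 0 < k -> is_Ck 1 (emult k s d phi).
Proof.
move=> k0.
exact: C1D (C1M (C1_wa s d k0) (C2_derive dir_t f2)) (C1M (C1_wc s d k0) (C1_eXG k0)).
Qed.

Lemma C1_edens k : 0 < k -> is_Ck 1 (edens k s d phi).
Proof.
move=> k0; have y1 := C2_derive dir_t f2.
exact: C1D (C1M (C1_cst _) (C1M (C1_wa s d k0) (C1D (C1X y1) (C1_eGG k0))))
  (C1M (C1_wc s d k0) (C1M y1 (C1_eXG k0))).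
Qed.

Lemma C1_eflux k X G : 0 < k -> is_Ck 1 X -> is_Ck 1 G -> is_Ck 1 (eflux k s d phi X G).
Proof.
move=> k0 hX hG; have y1 := C2_derive dir_t f2.
exact: C1B (C1M (C1_cst _) (C1M (C1_wc s d k0) (C1M hX (C1B (C1_eGG k0) (C1X y1)))))
  (C1M (C1_emult k0) hG).
Qed.

Lemma C1_pdens k : 0 < k -> is_Ck 1 (pdens k).
Proof. by move=> k0; exact: C1M (C1_chi k) (C1_edens k0). Qed.

Lemma C1_pflux k X G : 0 < k -> is_Ck 1 X -> is_Ck 1 G -> is_Ck 1 (pflux k X G).
Proof. by move=> k0 hX hG; exact: C1M (C1_chi k) (C1_eflux k0 hX hG). Qed.

Lemma chi_small k z : 0 < k -> rsq z < k ->
  chi k z = 0 /\ dsigma (k^-1 * rsq z) = 0.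
Proof.
move=> k0 zk; rewrite /chi; apply: sigma0.
by rewrite mulrC ler_pdivrMr// mul1r ltW.
Qed.

Lemma chi_big k z : 0 < k -> 2 * k <= rsq z ->
  chi k z = 1 /\ dsigma (k^-1 * rsq z) = 0.
Proof.
move=> k0 zk; rewrite /chi; apply: sigma1.
by rewrite mulrC ler_pdivlMr.
Qed.

Lemma chi_bounds k z : 0 <= chi k z <= 1.
Proof. by have [] := sigma_bounds (k^-1 * rsq z). Qed.

Lemma leibniz_algebra (c D0 D1 D2 D3 g0 g1 g2 g3 e E x1 x2 x3 w0 w1 w2 w3 : R) :
  D0 + (D1 + D2 + D3) = E -> w0 = 0 -> w1 = x1 -> w2 = x2 -> w3 = x3 ->
  c * D0 + g0 * (e * (2 * w0)) + (c * D1 + g1 * (e * (2 * w1)) + (c * D2 + g2 * (e * (2 * w2)))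
    + (c * D3 + g3 * (e * (2 * w3))))
  = c * E + e * 2 * (x1 * g1 + x2 * g2 + x3 * g3).
Proof. by move=> <- -> -> -> ->; ring. Qed.

Lemma derive_chiM k (g : spacetime R -> R) w z : is_Ck 1 g ->
  'D_w (fun z => chi k z * g z) z =
  chi k z * 'D_w g z + g z * (dsigma (k^-1 * rsq z) * k^-1 * (2 * dot z w)).
Proof.
move=> g1; rewrite -(mulrA (dsigma _)).
exact: derive_valE (derM (der_chi k z w) (C1_is_derive w z g1)).
Qed.

Lemma truncated_divergence k z : 0 < k ->
  'D_dir_t (pdens k) z + ('D_dir_x1 (pflux k X1 (eG1 k phi)) z
   + 'D_dir_x2 (pflux k X2 (eG2 k phi)) z + 'D_dir_x3 (pflux k X3 (eG3 k phi)) z)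
  = chi k z * ('D_dir_t (edens k s d phi) z
      + ('D_dir_x1 (eflux k s d phi X1 (eG1 k phi)) z
         + 'D_dir_x2 (eflux k s d phi X2 (eG2 k phi)) z
         + 'D_dir_x3 (eflux k s d phi X3 (eG3 k phi)) z))
    + cutoff_err k z.
Proof.
move=> k0; have [g1 g2 g3] := C1_eG k0.
have dD := derive_chiM k dir_t z (C1_edens k0).
have d1 := derive_chiM k dir_x1 z (C1_eflux k0 C1_X1 g1).
have d2 := derive_chiM k dir_x2 z (C1_eflux k0 C1_X2 g2).
have d3 := derive_chiM k dir_x3 z (C1_eflux k0 C1_X3 g3).
rewrite /cutoff_err (mulrA (dsigma _)).
exact: (etrans (congr2 +%R dD (congr2 +%R (congr2 +%R d1 d2) d3))
  (leibniz_algebra _ _ _ _ _ _ erefl (dot_t z) (dot_x1 z) (dot_x2 z) (dot_x3 z))).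
Qed.

Lemma uu_ge1 k t x : 0 < k -> k <= rsq (t, x) -> enorm x <= t + 1 -> 1 <= uu k (t, x).
Proof.
move=> k0 kz xt; rewrite /uu rhoE// rsqE sqrtr_sqr ger0_norm ?enorm_ge0//.
by rewrite /time/=; lra.
Qed.

Lemma vvE k z : vv k z = uu k z + 2 * rho k z.
Proof. by rewrite /vv /uu; ring. Qed.

Lemma rho_iq k z : 0 < k -> rho k z * (rho k z * irsq k z) = 1.
Proof. by move=> k0; rewrite mulrA -expr2 sqr_rho_irsq. Qed.

Lemma Z2_ge0 k z : 0 < k -> k <= rsq z -> 0 <= eGG k phi z - eS k phi z ^+ 2.
Proof.
move=> k0 kz.
have [_ E H] := @radial_algebra _ (X1 z) (X2 z) (X3 z) ('D_dir_x1 phi z) ('D_dir_x2 phi z)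
  ('D_dir_x3 phi z) (phi z) (irsq k z) (rho k z) (rsq_irsq k0 kz) (sqr_rho_irsq z k0).
by rewrite [leRHS]E subr_ge0.
Qed.

Lemma zero_bulk_algebra (m b A y S B C GGz : R) : m = 0 -> y = 0 -> S = 0 -> GGz = 0 ->
  m * b + (A * (y + S) ^+ 2 + B * (y - S) ^+ 2 + C * (GGz - S ^+ 2)) = 0.
Proof. by move=> -> -> -> ->; ring. Qed.

Lemma mult_algebra (A B q r y XGz b : R) :
  ((A + B) * y + (A - B) * (r * q) * XGz) * b =
  (A * (y + XGz * (r * q)) + B * (y - XGz * (r * q))) * b.
Proof. by ring. Qed.

(** Apart from [cutoff_err], common to both sides, there are three regions: for r^2 < k the cutoff
    vanishes; in the cone u >= 1 and [bulk_bound] applies; outside the cone phi and its first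
    derivatives vanish, while [bulk] is non-negative. *)
Lemma truncated_bound k t x : 0 < k -> 0 < t ->
  'D_dir_t (pdens k) (t, x) + ('D_dir_x1 (pflux k X1 (eG1 k phi)) (t, x)
   + 'D_dir_x2 (pflux k X2 (eG2 k phi)) (t, x) + 'D_dir_x3 (pflux k X3 (eG3 k phi)) (t, x))
  <= bulk k (t, x) + cutoff_err k (t, x).
Proof.
move=> k0 t0; refine (eq_ind_r (fun r => r <= _) _ (truncated_divergence (t, x) k0)).
rewrite lerD2r /bulk; set z := (t, x).
have [zk|kz] := ltP (rsq z) k.
  by have [-> _] := chi_small k0 zk; rewrite !mul0r.
have /andP[c0 _] := chi_bounds k z; apply: ler_wpM2l => //.
refine (eq_ind_r (fun r => r <= _) _ (energy_identity s d k0 kz f2)).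
have [xt|xt] := leP (enorm x) (t + 1).
  have u1 : 1 <= uu k z by exact: uu_ge1.
  have := bulk_bound ('D_dir_t phi z) (eS k phi z) (box_op phi z) s1 s2 d0 ds u1 (vvE k z)
    (rho_gt0 z k0) (rho_iq z k0) (Z2_ge0 k0 kz) erefl erefl.
  apply: le_trans; rewrite le_eqVlt; apply/orP; left; apply/eqP.
  congr (_ + _); exact: mult_algebra.
have j0 := outside_jet sw sF (ltW t0) xt.
have [_ _ m0 gg xg] := jet0_energy k j0; have [_ y0 _ _ _] := j0.
have S0 : eS k phi z = 0 by rewrite /eS xg mul0r.
refine (eq_ind_r (fun r => r <= _) _ (zero_bulk_algebra _ _ _ _ m0 y0 S0 gg)).
by rewrite mulr_ge0 ?sqr_ge0// mulr_ge0 ?invr_ge0 ?(ltW d0)// mulr_ge0// ltW// pw_gt0.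
Qed.

Lemma continuous_box_op : continuous (box_op phi).
Proof.
have c2 e e' : continuous ('D_e ('D_e' phi)).
  by apply: C1_continuous_derive; exact: C2_derive.
by move=> z; apply: cvgB; [exact: c2|apply: cvgD; [apply: cvgD|]; exact: c2].
Qed.

Lemma continuous_bulk k : 0 < k -> continuous (bulk k).
Proof.
move=> k0.
have cw := C1_continuous (C1M (C1_cst d^-1) (C1M (C1_pw s (C1_vv k0)) (C1_pw (1 + 2 * d) (C1_uu k0)))).
move=> z; apply: cvgM; first exact: (C1_continuous (C1_chi k)).
apply: cvgM; first exact: cw.
by apply: cvgM; exact: continuous_box_op.
Qed.

Lemma continuous_dsigma_rsq k : continuous (fun z => dsigma (k^-1 * rsq z) * (k^-1 * 2)).
Proof.
move=> z; apply: cvgM; last exact: cvg_cst.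
apply: (@continuous_comp _ _ _ (fun z => k^-1 * rsq z) dsigma); last exact: continuous_dsigma.
exact: (C1_continuous (C1M (C1_cst _) C1_rsq)).
Qed.

Lemma continuous_cutoff_err k : 0 < k -> continuous (cutoff_err k).
Proof.
move=> k0; have [g1 g2 g3] := C1_eG k0.
have cf := C1_continuous (C1D (C1D (C1M C1_X1 (C1_eflux k0 C1_X1 g1))
  (C1M C1_X2 (C1_eflux k0 C1_X2 g2))) (C1M C1_X3 (C1_eflux k0 C1_X3 g3))).
by move=> z; apply: cvgM; [exact: continuous_dsigma_rsq|exact: cf].
Qed.

Lemma face_outside N t T x : T + 1 < N -> 0 <= t <= T ->
  N \in [:: `|x.1.1|; `|x.1.2|; `|x.2|] -> jet0 (t, x).
Proof.
move=> TN /andP[t0 tT] xN; apply: outside_jet sw sF t0 _.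
have [c1 c2 c3] := coord_le_enorm x.
by move: xN; rewrite !inE => /or3P[] /eqP xN; lra.
Qed.

Lemma truncated_energy_le k T N : 0 < k -> 0 < T -> T + 1 < N ->
  (\int[leb3]_(x in box3 N) (pdens k (T, x))%:E
   <= \int[leb4]_(z in slab T N) (bulk k z + cutoff_err k z)%:E)%E.
Proof.
move=> k0 T0 TN; have [g1 g2 g3] := C1_eG k0.
have N0 : 0 < N by lra.
apply: (box_divergence_le T0 N0 (C1_pdens k0) (C1_pflux k0 C1_X1 g1) (C1_pflux k0 C1_X2 g2)
  (C1_pflux k0 C1_X3 g3)).
- by move=> z; apply: cvgD; [exact: continuous_bulk|exact: continuous_cutoff_err].
- move=> t x tT xN; have [_ fl _ _ _] := jet0_energy k (face_outside TN tT xN).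
  by rewrite /pflux !fl !mul0r subr0 mulr0.
- move=> x; have [e0 _ _ _ _] := jet0_energy k (initial_jet x sw).
  by rewrite /pdens e0 mulr0.
- by move=> t x /andP[t0 _] _; exact: truncated_bound.
Qed.

Definition radial z := X1 z * 'D_dir_x1 phi z + X2 z * 'D_dir_x2 phi z + X3 z * 'D_dir_x3 phi z.
Definition radial_dens k z := chi k z * (pw 1 s (uu k z) * (irsq k z * radial z ^+ 2)).
Definition hardy_err k z := dsigma (k^-1 * rsq z) * (k^-1 * 2) * (pw 1 s (uu k z) * phi z ^+ 2).
Definition hflux k (X : spacetime R -> R) z := pw 1 s (uu k z) * (X z * (irsq k z * phi z ^+ 2)).

Lemma C1_hflux k X : 0 < k -> is_Ck 1 X -> is_Ck 1 (hflux k X).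
Proof.
move=> k0 hX.
exact: C1M (C1_pw s (C1_uu k0)) (C1M hX (C1M (C1_irsq k0) (C1X (C2_C1 f2)))).
Qed.

Lemma derive_hflux k X w z dX : 0 < k -> k <= rsq z -> is_Ck 1 X -> is_derive z w X dX ->
  'D_w (hflux k X) z =
  pw 1 s (uu k z) * (X z * (irsq k z * (2 * phi z * 'D_w phi z)
     + phi z ^+ 2 * (- (2 * dot z w) * irsq k z ^+ 2)) + irsq k z * phi z ^+ 2 * dX)
  + X z * (irsq k z * phi z ^+ 2)
    * (dpw 1 s (uu k z) * (time w - dot z w * (rho k z * irsq k z))).
Proof.
move=> k0 kz X1 hX; have dphi := C1_is_derive w z (C2_C1 f2).
exact: derive_valE (derM (der_pw s (der_uu k0 kz w)) (derM hX (derM (der_irsq w k0 kz) (derX dphi)))).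
Qed.

Lemma hardy_algebra (a a' q r p x1 x2 x3 e1 e2 e3 h1 h2 h3 t1 t2 t3 : R) :
  (x1 ^+ 2 + x2 ^+ 2 + x3 ^+ 2) * q = 1 -> e1 = x1 -> e2 = x2 -> e3 = x3 ->
  t1 = 0 -> t2 = 0 -> t3 = 0 ->
  a * (x1 * (q * (2 * p * h1) + p ^+ 2 * (- (2 * e1) * q ^+ 2)) + q * p ^+ 2 * 1)
  + x1 * (q * p ^+ 2) * (a' * (t1 - e1 * (r * q)))
  + (a * (x2 * (q * (2 * p * h2) + p ^+ 2 * (- (2 * e2) * q ^+ 2)) + q * p ^+ 2 * 1)
     + x2 * (q * p ^+ 2) * (a' * (t2 - e2 * (r * q))))
  + (a * (x3 * (q * (2 * p * h3) + p ^+ 2 * (- (2 * e3) * q ^+ 2)) + q * p ^+ 2 * 1)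
     + x3 * (q * p ^+ 2) * (a' * (t3 - e3 * (r * q))))
  = a * (q * ((x1 * h1 + x2 * h2 + x3 * h3 + p) ^+ 2 - (x1 * h1 + x2 * h2 + x3 * h3) ^+ 2))
    - a' * (r * q) * p ^+ 2.
Proof.
move=> qE -> -> -> -> -> ->; apply/eqP; rewrite -subr_eq0; apply/eqP.
transitivity (- (2 * a * q * p ^+ 2 + a' * (r * q) * p ^+ 2) * ((x1 ^+ 2 + x2 ^+ 2 + x3 ^+ 2) * q - 1)).
  by ring.
by rewrite qE subrr mulr0.
Qed.

Lemma leibniz_algebra3 (c D1 D2 D3 g g1 g2 g3 e E x1 x2 x3 w1 w2 w3 : R) :
  D1 + D2 + D3 = E -> w1 = x1 -> w2 = x2 -> w3 = x3 -> x1 * g1 + x2 * g2 + x3 * g3 = g ->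
  c * D1 + g1 * (e * (2 * w1)) + (c * D2 + g2 * (e * (2 * w2))) + (c * D3 + g3 * (e * (2 * w3)))
  = c * E + e * 2 * g.
Proof. by move=> <- -> -> -> <-; ring. Qed.

(** Again div (x / r^2) = r^-2: the derivative of phi^2 and this divergence add up to 2 phi x . grad
    phi + phi^2, which is the difference of the two squares. The last term of the bracket comes from
    the dependence of u on r. *)
Lemma hardy_divergence k z : 0 < k ->
  'D_dir_x1 (fun z => chi k z * hflux k X1 z) z + 'D_dir_x2 (fun z => chi k z * hflux k X2 z) z
  + 'D_dir_x3 (fun z => chi k z * hflux k X3 z) z
  = chi k z * (pw 1 s (uu k z) * (irsq k z * ((radial z + phi z) ^+ 2 - radial z ^+ 2))
      - dpw 1 s (uu k z) * (rho k z * irsq k z) * phi z ^+ 2) + hardy_err k z.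
Proof.
move=> k0.
have d1 := derive_chiM k dir_x1 z (C1_hflux k0 C1_X1).
have d2 := derive_chiM k dir_x2 z (C1_hflux k0 C1_X2).
have d3 := derive_chiM k dir_x3 z (C1_hflux k0 C1_X3).
refine (eq_ind_r (fun r => r = _) _ (congr2 +%R (congr2 +%R d1 d2) d3)).
have [zk|kz] := ltP (rsq z) k.
  have [c0 e0] := chi_small k0 zk.
  by rewrite /hardy_err c0 e0 !mul0r !mulr0 !addr0.
have q1 := rsq_irsq k0 kz.
rewrite /hardy_err (mulrA (dsigma _)).
apply: (leibniz_algebra3 _ _ _ (dot_x1 z) (dot_x2 z) (dot_x3 z)).
  have E1 := derive_hflux k0 kz C1_X1 (der_X1 z dir_x1).
  have E2 := derive_hflux k0 kz C1_X2 (der_X2 z dir_x2).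
  have E3 := derive_hflux k0 kz C1_X3 (der_X3 z dir_x3).
  exact: (etrans (congr2 +%R (congr2 +%R E1 E2) E3)
    (hardy_algebra _ _ _ _ _ _ _ q1 (dot_x1 z) (dot_x2 z) (dot_x3 z) time_x1 time_x2 time_x3)).
transitivity (rsq z * irsq k z * (pw 1 s (uu k z) * phi z ^+ 2)); last by rewrite q1 mul1r.
by rewrite /hflux /rsq; ring.
Qed.

Lemma edens_lower k t x : 0 < k -> 0 <= t -> k <= rsq (t, x) -> enorm x <= t + 1 ->
  uu k (t, x) `^ s * ('D_dir_t phi (t, x) ^+ 2 + eS k phi (t, x) ^+ 2
    + (eGG k phi (t, x) - eS k phi (t, x) ^+ 2)) <= edens k s d phi (t, x).
Proof.
move=> k0 t0 kz xt; have u1 := uu_ge1 k0 kz xt.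
apply: (density_lower _ d0 s1 u1 (v := vv k (t, x)) (iq := rho k (t, x) * irsq k (t, x))) => //.
- by rewrite vvE lerDl mulr_ge0// ltW// rho_gt0.
- by rewrite -subr_ge0; exact: Z2_ge0.
Qed.

Lemma radial_energy k z : 0 < k -> k <= rsq z ->
  [/\ eS k phi z ^+ 2 = irsq k z * (radial z + phi z) ^+ 2,
      eGG k phi z - eS k phi z ^+ 2 = gradsq phi z - irsq k z * radial z ^+ 2
    & irsq k z * radial z ^+ 2 <= gradsq phi z].
Proof.
move=> k0 kz.
exact: (@radial_algebra _ (X1 z) (X2 z) (X3 z) ('D_dir_x1 phi z) ('D_dir_x2 phi z)
  ('D_dir_x3 phi z) (phi z) (irsq k z) (rho k z) (rsq_irsq k0 kz) (sqr_rho_irsq z k0)).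
Qed.

(** In the cone the divergence turns u^s phi_r^2 into u^s S^2 minus a non-negative multiple of
    phi^2, and the energy density dominates u^s S^2. *)
Lemma hardy_bound k t x : 0 < k -> 0 <= t ->
  radial_dens k (t, x)
  + ('D_dir_x1 (fun z => chi k z * hflux k X1 z) (t, x)
     + 'D_dir_x2 (fun z => chi k z * hflux k X2 z) (t, x)
     + 'D_dir_x3 (fun z => chi k z * hflux k X3 z) (t, x))
  <= pdens k (t, x) + hardy_err k (t, x).
Proof.
move=> k0 t0; set z := (t, x).
refine (eq_ind_r (fun r => radial_dens k z + r <= _) _ (hardy_divergence z k0)).
rewrite addrA lerD2r /radial_dens /pdens -mulrDr.
have [zk|kz] := ltP (rsq z) k; first by have [-> _] := chi_small k0 zk; rewrite !mul0r.
have /andP[c0 _] := chi_bounds k z; apply: ler_wpM2l => //.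
have [xt|xt] := leP (enorm x) (t + 1); last first.
  have j0 := outside_jet sw sF t0 xt; have [e0 _ _ _ _] := jet0_energy k j0.
  have [p0 _ h1 h2 h3] := j0.
  have r0 : radial z = 0 by rewrite /radial h1 h2 h3 !mulr0 !addr0.
  by rewrite e0 r0 p0 addr0 subrr expr0n/= !mulr0 subr0 addr0.
have u1 := uu_ge1 k0 kz xt.
have := edens_lower k0 t0 kz xt; have [SE _ _] := radial_energy k0 kz; rewrite -/z in u1 *.
apply: le_trans.
have Z0 := Z2_ge0 k0 kz.
have p0 : 0 <= uu k z `^ s by exact: powR_ge0.
apply: (@le_trans _ _ (uu k z `^ s * eS k phi z ^+ 2)).
  rewrite SE pwE// dpwE//.
  have h : 0 <= s * uu k z `^ (s - 1) * (rho k z * irsq k z) * phi z ^+ 2.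
    apply: mulr_ge0; last exact: sqr_ge0.
    apply: mulr_ge0; first by apply: mulr_ge0; [exact: (ltW (lt_trans ltr01 s1))|exact: powR_ge0].
    by apply: mulr_ge0; apply: ltW; [exact: rho_gt0|exact: pw_gt0].
  move: h; set h := (_ * _ * phi z ^+ 2); move=> h0; clearbody h.
  rewrite -subr_ge0; apply: le_trans h0 _; rewrite le_eqVlt; apply/orP; left; apply/eqP.
  by ring.
apply: ler_wpM2l => //.
rewrite -addrA addrC -addrA lerDl; apply: addr_ge0; last exact: sqr_ge0.
exact: Z0.
Qed.

Lemma hardy_energy_le k T N : 0 < k -> 0 <= T -> T + 1 < N ->
  (\int[leb3]_(x in box3 N) (radial_dens k (T, x))%:E
   <= \int[leb3]_(x in box3 N) (pdens k (T, x) + hardy_err k (T, x))%:E)%E.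
Proof.
move=> k0 T0 TN; have N0 : 0 < N by lra.
have C1h X : is_Ck 1 X -> is_Ck 1 (fun z => chi k z * hflux k X z).
  by move=> hX; exact: C1M (C1_chi k) (C1_hflux k0 hX).
apply: (box_divergence_le3 (g := fun z => pdens k z + hardy_err k z)
  T0 N0 (C1h _ C1_X1) (C1h _ C1_X2) (C1h _ C1_X3)).
- have D1 e := C2_derive e f2.
  exact: (C1_continuous (C1M (C1_chi k) (C1M (C1_pw s (C1_uu k0)) (C1M (C1_irsq k0)
    (C1X (C1D (C1D (C1M C1_X1 (D1 _)) (C1M C1_X2 (D1 _))) (C1M C1_X3 (D1 _)))))))).
- have ch := C1_continuous (C1M (C1_pw s (C1_uu k0)) (C1X (C2_C1 f2))).
  move=> z; apply: cvgD; first exact: (C1_continuous (C1_pdens k0)).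
  by apply: cvgM; [exact: continuous_dsigma_rsq|exact: ch].
- move=> t x tT xN; have [p0 _ _ _ _] := face_outside TN tT xN.
  by rewrite /hflux p0 expr0n/= !mulr0.
- by move=> x _; exact: hardy_bound.
Qed.

End truncated_energy.

(** * The cutoff errors *)

Section cutoff_errors.
Context {R : realType}.

Lemma continuous_bounded_itv (g : R -> R) (a b : R) : continuous g ->
  exists2 M, 0 < M & forall x, a <= x <= b -> `|g x| <= M.
Proof.
move=> cg.
have /compact_bounded[M [_ Mg]] : compact (g @` `[a, b]).
  by apply: continuous_compact; [exact: continuous_subspaceT|exact: segment_compact].
exists (`|M| + 1); first by rewrite ltr_wpDl.
move=> x xab; apply: Mg; first by rewrite ltr_pwDr// ler_norm.
by exists x => //=; rewrite in_itv.
Qed.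

Lemma C1_lipschitz (g dg : R -> R) (a b : R) :
  (forall x : R, is_derive x 1 g (dg x)) -> continuous dg ->
  exists2 L, 0 < L & forall x y, a <= x -> x <= y -> y <= b -> `|g y - g x| <= L * (y - x).
Proof.
move=> hg cdg; have [L L0 HL] := continuous_bounded_itv a b cdg.
exists L => // x y ax xy yb.
have [|e] := @MVT_segment _ g dg _ _ xy.
  by apply: derivable_within_continuous => p _; have [] := hg p.
rewrite in_itv/= => /andP[xe ey] ->; rewrite normrM (ger0_norm (x := y - x)) ?subr_ge0//.
apply: ler_wpM2r; first by rewrite subr_ge0.
by apply: HL; rewrite (le_trans ax xe) (le_trans ey yb).
Qed.

Lemma product_difference_bound (gu gv pu pv Mg Mp Lg Lp h : R) :
  `|gu| <= Mg -> `|pu| <= Mp -> `|gv - gu| <= Lg * h -> `|pv - pu| <= Lp * h ->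
  0 <= Mg -> 0 <= Mp ->
  `|gu * pv - gv * pu| <= (Mg * Lp + Mp * Lg) * h.
Proof.
move=> h1 h2 h3 h4 m1 m2.
have -> : gu * pv - gv * pu = gu * (pv - pu) - pu * (gv - gu) by ring.
apply: le_trans (ler_normB _ _) _; rewrite !normrM mulrDl -!mulrA.
by apply: lerD; apply: ler_pM.
Qed.

(** G is of size phi / r at the origin, but the radial flux can be written through P = x . G = x .
    grad phi + phi, the angular energy Z, c and b rho, each of which stays bounded there. *)
Lemma flux_algebra (x1 x2 x3 g1 g2 g3 y a b q rho P Z c m GGz : R) :
  (x1 ^+ 2 + x2 ^+ 2 + x3 ^+ 2) * q = 1 ->
  x1 * g1 + x2 * g2 + x3 * g3 = P -> GGz = q * P ^+ 2 + Z -> c = b * (rho * q) ->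
  m = a * y + c * P ->
  x1 * (1 / 2 * (c * (x1 * (GGz - y ^+ 2))) - m * g1)
  + x2 * (1 / 2 * (c * (x2 * (GGz - y ^+ 2))) - m * g2)
  + x3 * (1 / 2 * (c * (x3 * (GGz - y ^+ 2))) - m * g3)
  = - (1 / 2 * c * P ^+ 2) + 1 / 2 * (b * rho) * (Z - y ^+ 2) - a * y * P.
Proof.
move=> qE PE -> cE ->; subst c.
transitivity (1 / 2 * b * rho * ((x1 ^+ 2 + x2 ^+ 2 + x3 ^+ 2) * q) * (q * P ^+ 2 + Z - y ^+ 2)
  - (a * y + b * (rho * q) * P) * (x1 * g1 + x2 * g2 + x3 * g3)); first by field.
by rewrite qE PE; field.
Qed.

Lemma flux_bound (c br a y P Z L Ma My MP MZ : R) :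
  `|c| <= L -> `|br| <= L -> `|a| <= Ma -> `|y| <= My -> `|P| <= MP -> 0 <= Z <= MZ ->
  `|- (1 / 2 * c * P ^+ 2) + 1 / 2 * br * (Z - y ^+ 2) - a * y * P|
  <= L * MP ^+ 2 + L * (MZ + My ^+ 2) + Ma * My * MP.
Proof.
move=> hc hb ha hy hP /andP[Z0 hZ].
have L0 : 0 <= L by exact: le_trans hc.
have sq (p M : R) : `|p| <= M -> p ^+ 2 <= M ^+ 2.
  move=> pM; rewrite -(real_normK (num_real p)) ler_sqr ?nnegrE//; exact: le_trans pM.
have hP2 := sq _ _ hP; have hy2 := sq _ _ hy.
have b1 : `|1 / 2 * c * P ^+ 2| <= L * MP ^+ 2.
  rewrite normrM (ger0_norm (sqr_ge0 P)); apply: ler_pM => //; first exact: sqr_ge0.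
  rewrite normrM ger0_norm; last by lra.
  by apply: le_trans hc; rewrite -[leRHS]mul1r; apply: ler_wpM2r => //; lra.
have b2 : `|1 / 2 * br * (Z - y ^+ 2)| <= L * (MZ + My ^+ 2).
  rewrite normrM; apply: ler_pM => //.
    rewrite normrM ger0_norm; last by lra.
    by apply: le_trans hb; rewrite -[leRHS]mul1r; apply: ler_wpM2r => //; lra.
  apply: le_trans (ler_normB _ _) _; rewrite (ger0_norm Z0) (ger0_norm (sqr_ge0 y)).
  exact: lerD.
have b3 : `|a * y * P| <= Ma * My * MP.
  rewrite !normrM; apply: ler_pM => //; apply: ler_pM => //.
apply: le_trans (ler_normB _ _) _; apply: lerD => //.
by apply: le_trans (ler_normD _ _) _; rewrite normrN; apply: lerD.
Qed.

Variables (s d : R) (phi : spacetime R -> R).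
Hypothesis f2 : is_Ck 2 phi.
Implicit Types (k t T N : R) (x : R3 R) (z w : spacetime R).

Lemma rsq_le1_box x t : rsq (t, x) <= 1 -> box3 1 x.
Proof.
rewrite rsqE => h; have [c1 c2 c3] := coord_le_enorm x.
have e1 : enorm x <= 1.
  by rewrite -(@ler_sqr R) ?nnegrE ?enorm_ge0// expr1n.
by apply/box3P; split; [exact: le_trans c1 e1|exact: le_trans c2 e1|exact: le_trans c3 e1].
Qed.

Lemma rho_le1 k z : 0 < k -> k <= rsq z -> rsq z <= 1 -> rho k z <= 1.
Proof. by move=> k0 kz z1; rewrite rhoE// -[leRHS]sqrtr1 ler_wsqrtr. Qed.

Lemma continuous_radial : continuous (radial phi).
Proof.
have D1 e := C2_derive e f2.
exact: C1_continuous (C1D (C1D (C1M C1_X1 (D1 _)) (C1M C1_X2 (D1 _))) (C1M C1_X3 (D1 _))).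
Qed.

Lemma continuous_gradsq : continuous (gradsq phi).
Proof.
have D1 e := C2_derive e f2.
exact: C1_continuous (C1D (C1D (C1X (D1 _)) (C1X (D1 _))) (C1X (D1 _))).
Qed.

Lemma dsigma_abs k z (E C : R) : 0 < k -> `|E| <= C ->
  `|dsigma (k^-1 * rsq z) * (k^-1 * 2) * E| <= 4 * C / k.
Proof.
move=> k0 EC; have [_ /andP[b0 b2]] := sigma_bounds (k^-1 * rsq z).
have k2 : 0 <= k^-1 * 2 by rewrite mulr_ge0// invr_ge0 ltW.
rewrite normrM (ger0_norm (mulr_ge0 b0 k2)).
have -> : 4 * C / k = 2 * (k^-1 * 2) * C by field; rewrite gt_eqF.
apply: ler_pM => //; first exact: mulr_ge0.
exact: ler_wpM2r.
Qed.

(* A = B at r = 0 and both are Lipschitz, so c = (A - B) / r is bounded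
   uniformly in k. *)
Lemma weight_bounds T : exists2 L, 0 < L & forall k t x, 0 < k -> k <= rsq (t, x) ->
  rsq (t, x) <= 1 -> 0 <= t <= T ->
  [/\ `|wc k s d (t, x)| <= L, `|(wA k s d (t, x) - wB k s d (t, x)) * rho k (t, x)| <= L,
      `|wa k s d (t, x)| <= L & `|pw 1 s (uu k (t, x))| <= L].
Proof.
have cp : continuous (pw 1 s).
  by move=> w; apply/differentiable_continuous/derivable1_diffP; have [] := is_derive_pw s w ltr01.
have hgam (w : R) : is_derive w 1 (gam d) (dgam d w).
  have h := @is_derive_pw R 1 (- (2 * d)) w ltr01.
  by eapply is_derive_eq; [exact: derD (is_derive_cst (1 : R) w (1 : R)) h|rewrite add0r].
have cg : continuous (gam d).
  by move=> w; apply/differentiable_continuous/derivable1_diffP; have [] := hgam w.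
(* For r <= 1 and 0 <= t <= T both u = t + 2 - r and v = t + 2 + r lie in [1, T + 3]. *)
have [Mp Mp0 HMp] := continuous_bounded_itv 1 (T + 3) cp.
have [Mg Mg0 HMg] := continuous_bounded_itv 1 (T + 3) cg.
have [Lp Lp0 HLp] := @C1_lipschitz (pw 1 s) (dpw 1 s) 1 (T + 3)
  (fun x : R => is_derive_pw s x ltr01) (continuous_dpw ltr01).
have [Lg Lg0 HLg] := @C1_lipschitz (gam d) (dgam d) 1 (T + 3) hgam (continuous_dpw ltr01).
pose L1 := (Mg * Lp + Mp * Lg) * 2.
have L10 : 0 < L1 by rewrite mulr_gt0// addr_gt0// mulr_gt0.
exists (L1 + (Mg * Mp + Mg * Mp) + Mp).
  by rewrite addr_gt0// addr_gt0// addr_gt0// mulr_gt0.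
move=> k t x k0 kz z1 /andP[t0 tT]; set z := (t, x).
have r1 := rho_le1 k0 kz z1; have r0 := rho_gt0 z k0; rewrite -/z in r1.
have hu : 1 <= uu k z by rewrite /uu /time/=; lra.
have huv : uu k z <= vv k z by rewrite vvE; lra.
have hv : vv k z <= T + 3 by rewrite /vv /time/=; lra.
have u_in : 1 <= uu k z <= T + 3 by rewrite hu (le_trans huv hv).
have v_in : 1 <= vv k z <= T + 3 by rewrite hv (le_trans hu huv).
have Mpu := HMp _ u_in; have Mpv := HMp _ v_in.
have Mgu := HMg _ u_in; have Mgv := HMg _ v_in.
have vu : vv k z - uu k z = 2 * rho k z by rewrite vvE; ring.
have lp := HLp _ _ hu huv hv; have lg := HLg _ _ hu huv hv; rewrite vu in lp lg.
have := product_difference_bound Mgu Mpu lg lp (ltW Mg0) (ltW Mp0).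
rewrite mulrA -/L1 -/(wA k s d z) -/(wB k s d z) => hb.
have MM : 0 < Mg * Mp by rewrite mulr_gt0.
have q2 := rho_iq z k0.
have hc : `|wc k s d z| <= L1.
  rewrite /wc normrM; have -> : L1 = L1 * rho k z * (rho k z * irsq k z) by rewrite -mulrA q2 mulr1.
  have h : 0 <= rho k z * irsq k z by rewrite mulr_ge0 ?ltW// pw_gt0.
  by rewrite (ger0_norm h); apply: ler_wpM2r.
split; first by lra.
- have hr : `|rho k z| <= 1 by rewrite ger0_norm// ltW.
  have : `|(wA k s d z - wB k s d z) * rho k z| <= L1 * rho k z * 1.
    by rewrite normrM; apply: ler_pM.
  have : L1 * rho k z <= L1 * 1 by apply: ler_wpM2l => //; exact: ltW.
  lra.
- have hA : `|wA k s d z| <= Mg * Mp by rewrite normrM; apply: ler_pM.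
  have hB : `|wB k s d z| <= Mg * Mp by rewrite normrM; apply: ler_pM.
  have := ler_normD (wA k s d z) (wB k s d z); rewrite -/(wa k s d z); lra.
- by lra.
Qed.

Lemma dsigma_support k z : 0 < k -> dsigma (k^-1 * rsq z) != 0 -> k <= rsq z <= 2 * k.
Proof.
move=> k0 h; apply/andP; split; rewrite leNgt; apply/negP => zk; move/negP: h; apply; apply/eqP.
  by have [] := chi_small k0 zk.
by have [] := chi_big k0 (ltW zk).
Qed.

(** For 2k <= 1 the transition region k <= r^2 <= 2k lies in the unit ball, where the factors of
    [flux_algebra] are bounded uniformly in [k]; only the 1 / k from the derivative of the cutoff is
    left. *)
Lemma cutoff_err_bound T : exists2 C, 0 < C & forall k t x, 0 < k -> 2 * k <= 1 ->
  0 <= t <= T -> `|cutoff_err s d phi k (t, x)| <= C / k.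
Proof.
have [L L0 HL] := weight_bounds T.
have D1 e := C2_derive e f2.
have [My My0 HMy] := continuous_bounded_box 0 T 1 (C1_continuous (D1 dir_t)).
have [MZ MZ0 HMZ] := continuous_bounded_box 0 T 1 continuous_gradsq.
have cP : continuous (fun z => radial phi z + phi z).
  by move=> z; apply: cvgD; [exact: continuous_radial|exact: C1_continuous (C2_C1 f2) z].
have [MP MP0 HMP] := continuous_bounded_box 0 T 1 cP.
pose C := L * MP ^+ 2 + L * (MZ + My ^+ 2) + L * My * MP.
have C0 : 0 < C.
  by rewrite addr_gt0 ?mulr_gt0// addr_gt0 ?mulr_gt0 ?exprn_gt0// addr_gt0// exprn_gt0.
exists (4 * C); first by rewrite mulr_gt0.
move=> k t x k0 k1 tT; set z := (t, x).
have [d00|dn0] := eqVneq (dsigma (k^-1 * rsq z)) 0.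
  by rewrite /cutoff_err -/z d00 !mul0r normr0 divr_ge0 ?mulr_ge0 ?ltW.
have /andP[kz zk] := dsigma_support k0 dn0.
have z1 : rsq z <= 1 by exact: le_trans k1.
have xb := rsq_le1_box z1.
have [hc hb ha _] := HL k t x k0 kz z1 tT.
have [SE ZE ZL] := radial_energy phi k0 kz.
have Z0 := Z2_ge0 phi k0 kz.
have qE := rsq_irsq k0 kz.
have q0 : 0 <= irsq k z by exact/ltW/pw_gt0.
apply: dsigma_abs => //.
have PE : X1 z * eG1 k phi z + X2 z * eG2 k phi z + X3 z * eG3 k phi z = radial phi z + phi z.
  transitivity (radial phi z + rsq z * irsq k z * phi z); last by rewrite qE mul1r.
  by rewrite /eG1 /eG2 /eG3 /Gr /radial /rsq; move: ('D_dir_x1 phi z) ('D_dir_x2 phi z) ('D_dir_x3 phi z) => h1 h2 h3; ring.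
have GE : eGG k phi z = irsq k z * (radial phi z + phi z) ^+ 2 + (eGG k phi z - eS k phi z ^+ 2).
  by rewrite SE addrC subrK.
have mE : emult k s d phi z = wa k s d z * 'D_dir_t phi z + wc k s d z * (radial phi z + phi z).
  by rewrite -PE.
have E := flux_algebra qE PE GE erefl mE.
refine (eq_ind_r (fun r => `|r| <= C) _ E).
apply: flux_bound => //.
- by apply: HMy.
- by apply: HMP.
- rewrite Z0/= ZE; have := HMZ t x tT xb; rewrite ler_norml => /andP[_ h].
  by apply: le_trans h; rewrite lerBlDr lerDl mulr_ge0// sqr_ge0.
Qed.

Lemma hardy_err_bound T : 0 <= T -> exists2 C, 0 < C & forall k x, 0 < k -> 2 * k <= 1 ->
  `|hardy_err s phi k (T, x)| <= C / k.
Proof.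
move=> T0; have [L L0 HL] := weight_bounds T.
have [M M0 HM] := continuous_bounded_box 0 T 1 (C1_continuous (C1X (C2_C1 f2))).
exists (4 * (L * M)); first by rewrite mulr_gt0// mulr_gt0.
move=> k x k0 k1; set z := (T, x).
have TT : 0 <= T <= T by rewrite T0 lexx.
have [d00|dn0] := eqVneq (dsigma (k^-1 * rsq z)) 0.
  by rewrite /hardy_err d00 !mul0r normr0 divr_ge0 ?mulr_ge0 ?ltW.
have /andP[kz zk] := dsigma_support k0 dn0.
have z1 : rsq z <= 1 by exact: le_trans k1.
have xb := rsq_le1_box z1.
have [_ _ _ hp] := HL k T x k0 kz z1 TT.
by apply: dsigma_abs => //; rewrite normrM; apply: ler_pM => //; exact: HM.
Qed.

End cutoff_errors.

(** * Passage to the limit *)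

Import HBNNSimple.

Section nonneg_integrals.
Context d (T : measurableType d) (R : realType) (mu : {measure set T -> \bar R}).
Local Open Scope ereal_scope.

(* The function grad_S2 phi is not known to be measurable: its integral is
   handled as a supremum over simple functions. *)
Lemma integral_le_nnsfun (f : T -> \bar R) (K : \bar R) : (forall x, 0 <= f x) ->
  (forall h : {nnsfun T >-> R}, (forall x, (h x)%:E <= f x) ->
    \int[mu]_x (h x)%:E <= K) ->
  \int[mu]_x f x <= K.
Proof.
move=> f0 H; rewrite ge0_integralTE//; apply: ge_ereal_sup => _ [h hf <-].
have := H h hf; rewrite integral_nnsfun// patch_setT; exact.
Qed.

(** Immediate from the integral as a supremum over simple functions. It is applied with the source
    on the right, and F is not assumed measurable. *)
Lemma ge0_le_integral_any (D : set T) (f g : T -> \bar R) : (forall x, D x -> 0 <= f x) ->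
  (forall x, D x -> f x <= g x) -> \int[mu]_(x in D) f x <= \int[mu]_(x in D) g x.
Proof.
move=> f0 fg; rewrite (integral_mkcond D f) (integral_mkcond D g).
have f0' x : 0 <= (f \_ D) x by apply: erestrict_ge0.
have fg' x : (f \_ D) x <= (g \_ D) x by apply: lee_restrict.
rewrite !ge0_integralTE//; last by move=> x; exact: le_trans (fg' x).
apply: ereal_sup_le => _ [h hf <-]; exists h => // x; exact: le_trans (fg' x).
Qed.

Lemma integral_small_support (D E : set T) (g : T -> R) (c : R) : measurable D ->
  measurable E -> (0 <= c)%R -> (forall x, D x -> 0 <= g x <= c * \1_E x)%R ->
  \int[mu]_(x in D) (g x)%:E <= c%:E * mu E.
Proof.
move=> mD mE c0 gc.
apply: (@le_trans _ _ (\int[mu]_(x in D) (c * \1_E x)%:E)).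
  by apply: ge0_le_integral_any => x Dx; rewrite lee_fin; have /andP[] := gc x Dx.
under eq_integral do rewrite EFinM.
rewrite ge0_integralZl_EFin//; last by apply/measurable_EFinP; exact: measurable_indic.
rewrite integral_indic//; apply: lee_wpmul2l; first by rewrite lee_fin.
by apply: le_measure => //; rewrite inE//; exact: measurableI.
Qed.
End nonneg_integrals.

Section limit.
Context {R : realType}.

(* A substitute for Fatou's lemma when f is not measurable: a simple function
   below f is bounded, so its integral over the excised box tends to 0. *)
Lemma integral_limit_bound (f : R3 R -> \bar R) (N C : R) (K : \bar R) (M : R -> R3 R -> R) :
  0 <= C -> (forall x, 0 <= f x)%E -> (forall x, ~ box3 N x -> f x = 0%E) ->
  (forall e, 0 < e <= 1 -> measurable_fun [set: measurableTypeR R * measurableTypeR R * measurableTypeR R] (M e)) ->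
  (forall e x, 0 < e <= 1 -> 0 <= M e x) ->
  (forall e x, 0 < e <= 1 -> box3 N x -> ~ box3 e x -> (f x <= (M e x)%:E)%E) ->
  (forall e : R, (0 < e <= 1)%R -> \int[leb3]_(x in box3 N) (M e x)%:E <= K + (C * e)%:E)%E ->
  (\int[leb3]_x f x <= K)%E.
Proof.
move=> C0 f0 fN mM M0 fM intM; apply: integral_le_nnsfun => // h hf.
have [L L0 hL] : exists2 L, 0 < L & forall x, h x <= L.
  have [L [_ HL]] := simple_bounded h.
  exists (`|L| + 1); first by rewrite ltr_wpDl.
  move=> x; apply: le_trans (ler_norm _) _; apply: HL => //.
  by rewrite ltr_pwDr// ler_norm.
apply/lee_addgt0Pr => eps eps0.
(* As e <= 1, the two errors C e and L (2e)^3 add up to at most e S. *)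
pose S := C + L * 8.
have S0 : 0 < S by rewrite ltr_wpDl// mulr_gt0.
pose e := Num.min 1 (eps / S).
have e0 : 0 < e by rewrite lt_min ltr01 divr_gt0.
have e1 : e <= 1 by rewrite ge_min lexx.
have eS : e * S <= eps by rewrite -ler_pdivlMr// ge_min lexx orbT.
have e01 : 0 < e <= 1 by rewrite e0.
have mN := measurable_box3 N; have me := measurable_box3 e.
apply: (@le_trans _ _ (\int[leb3]_(x in box3 N) ((M e x)%:E + (L * \1_(box3 e) x)%:E))%E).
  rewrite [leRHS]integral_mkcond; apply: ge0_le_integral_any => x _; first by rewrite lee_fin.
  rewrite patchE; case: ifPn => xN; last first.
    by apply: le_trans (hf x) _; rewrite fN// => h0; move: xN; rewrite mem_set.
  move/set_mem : xN => xN; have [xe|xe] := pselect (box3 e x).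
    rewrite indicE mem_set// mulr1 -EFinD lee_fin; apply: le_trans (hL x) _.
    by rewrite lerDr; exact: M0.
  rewrite indicE memNset// mulr0 adde0; apply: le_trans (hf x) _; exact: fM.
rewrite ge0_integralD//; last 4 first.
- by move=> x _; rewrite lee_fin; exact: M0.
- by apply/measurable_EFinP; apply: measurable_funTS; exact: mM.
- by move=> x _; rewrite lee_fin mulr_ge0// ltW.
- by apply/measurable_EFinP; apply: measurable_funM => //; exact: measurable_indic.
apply: (@le_trans _ _ (K + (C * e)%:E + L%:E * leb3 (box3 e))%E).
  apply: leeD; first exact: intM.
  apply: integral_small_support => //; first exact: ltW.
  by move=> x _; rewrite mulr_ge0//= ltW.
have lE : (L%:E * leb3 (box3 e) = (L * (8 * e ^+ 3))%:E)%E.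
  by rewrite EFinM; congr (_ * _)%E; exact: leb3_box3 (ltW e0).
rewrite (_ : (K + (C * e)%:E + L%:E * leb3 (box3 e) = K + (C * e)%:E + (L * (8 * e ^+ 3))%:E)%E);
  last by congr (_ + _)%E; exact: lE.
rewrite -addeA -EFinD; apply: leeD2l; rewrite lee_fin; apply: le_trans eS.
have : e ^+ 3 <= e by rewrite -[leRHS]expr1 ler_wiXn2l// ltW.
move=> e3; rewrite /S mulrDr [e * C]mulrC lerD2l mulrA [e * _]mulrC.
by apply: ler_wpM2l => //; rewrite mulr_ge0// ltW.
Qed.

Lemma L2_norm_sqr d (T : measurableType d) (mu : {measure set T -> \bar R}) (f : T -> R) :
  ('N[mu]_2%:E[EFin \o f] = (\int[mu]_x (f x ^+ 2)%:E) `^ 2^-1)%E.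
Proof.
rewrite unlock; congr (_ `^ _)%E; apply: eq_integral => x _ /=.
transitivity ((`|f x|)%:E `^ 2)%E => //.
by rewrite poweR_EFin powR_mulrn// real_normK ?num_real.
Qed.

Lemma L2_norm_le d1 d2 (T1 : measurableType d1) (T2 : measurableType d2)
    (mu : {measure set T1 -> \bar R}) (nu : {measure set T2 -> \bar R})
    (f : T1 -> R) (g : T2 -> R) (c : R) : 0 <= c ->
  (\int[mu]_x (f x ^+ 2)%:E <= (c ^+ 2)%:E * \int[nu]_x (g x ^+ 2)%:E)%E ->
  ('N[mu]_2%:E[EFin \o f] <= c%:E * 'N[nu]_2%:E[EFin \o g])%E.
Proof.
move=> c0 H; rewrite !L2_norm_sqr.
have If : (0 <= \int[mu]_x (f x ^+ 2)%:E)%E by apply: integral_ge0 => x _; rewrite lee_fin sqr_ge0.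
have Ig : (0 <= \int[nu]_x (g x ^+ 2)%:E)%E by apply: integral_ge0 => x _; rewrite lee_fin sqr_ge0.
have -> : (c%:E = (c ^+ 2)%:E `^ 2^-1)%E.
  by rewrite poweR_EFin powR12_sqrt ?sqr_ge0// sqrtr_sqr ger0_norm.
rewrite -poweRM ?lee_fin ?sqr_ge0//; apply: gt0_ler_poweR => //.
- by rewrite in_itv/= If leey.
- by rewrite in_itv/= leey andbT mule_ge0// lee_fin sqr_ge0.
Qed.

End limit.

(** * From the truncated energy to the three weighted norms *)

Section assembly.
Context {R : realType}.
Variables (s d delta : R) (F phi : spacetime R -> R).
Hypotheses (s1 : 1 < s) (s2 : s < 2) (d0 : 0 < d) (ds : 1 + 2 * d <= s) (dd : d <= delta).
Hypotheses (sw : solves_wave F phi)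
  (sF : supp F `<=` [set z | enorm z.2 <= z.1 + 1]).
Implicit Types (k t T N : R) (x : R3 R) (z w : spacetime R).

Let f2 : is_Ck 2 phi. Proof. by case: sw. Qed.

Let source : spacetime R -> R :=
  (fun z => wplus z.1 z.2 (s / 2) * wminus z.1 z.2 (1 / 2 + delta) * F z) \_ [set z | 0 < z.1].

Let I4 : \bar R := (\int[leb4]_z (source z ^+ 2)%:E)%E.

Let I4_ge0 : (0 <= I4)%E.
Proof. by apply: integral_ge0 => z _; rewrite lee_fin sqr_ge0. Qed.

Lemma uuE k t x : 0 < k -> k <= rsq (t, x) -> uu k (t, x) = t + 2 - enorm x.
Proof. by move=> k0 kz; rewrite /uu rhoE// rsqE sqrtr_sqr ger0_norm ?enorm_ge0. Qed.

Lemma powR_half_sqr (a p : R) : (a `^ (p / 2)) ^+ 2 = a `^ p.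
Proof.
by rewrite -powR_mulrn ?powR_ge0// -powRrM; congr (_ `^ _); field.
Qed.

Lemma bulk_le_source k t x : 0 < k -> 0 < t -> d * bulk s d phi k (t, x) <= source (t, x) ^+ 2.
Proof.
move=> k0 t0; have s0 := sqr_ge0 (source (t, x)).
have [zk|kz] := ltP (rsq (t, x)) k.
  by have [c0 _] := chi_small k0 zk; rewrite /bulk c0 mul0r mulr0.
have [xt|xt] := leP (enorm x) (t + 1); last first.
  by rewrite /bulk (box_op_supp sw sF t0 xt) expr0n/= !mulr0.
have u1 := uu_ge1 k0 kz xt.
have uE := uuE k0 kz.
have vE : vv k (t, x) = t + 2 + enorm x.
  by rewrite vvE uE rhoE// rsqE sqrtr_sqr ger0_norm ?enorm_ge0//; ring.
have r0 := enorm_ge0 x.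
have v1 : 1 <= t + 2 + enorm x by lra.
have -> : source (t, x) = wplus t x (s / 2) * wminus t x (1 / 2 + delta) * F (t, x).
  by rewrite /source patchE mem_set.
have FE : box_op phi (t, x) = F (t, x) by case: sw => _ we _ _; exact: we.
have h : (wminus t x (1 / 2 + delta)) ^+ 2 = (t + 2 - enorm x) `^ (1 + 2 * delta).
  have -> : 1 / 2 + delta = (1 + 2 * delta) / 2 by field.
  exact: powR_half_sqr.
rewrite !exprMn h /wplus powR_half_sqr /bulk FE vE uE !pwE//; last by rewrite -uE.
have /andP[c0 c1] := chi_bounds k (t, x).
have dn : d != 0 by rewrite gt_eqF.
set c := chi k (t, x) in c0 c1 *.
set a := (t + 2 + enorm x) `^ s; set b := (t + 2 - enorm x) `^ (1 + 2 * d).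
have -> : d * (c * (d^-1 * (a * b) * F (t, x) ^+ 2)) = c * (a * b * F (t, x) ^+ 2) by field.
have a0 : 0 <= a by exact: powR_ge0.
have b0 : 0 <= b by exact: powR_ge0.
(* Since u >= 1, the exponent may be raised from 1 + 2d to 1 + 2 delta. *)
have bb : b <= (t + 2 - enorm x) `^ (1 + 2 * delta).
  by apply: ler_powR; [rewrite -uE|rewrite lerD2l ler_pM2l].
have F0 := sqr_ge0 (F (t, x)).
apply: (@le_trans _ _ (1 * (a * b * F (t, x) ^+ 2))).
  by apply: ler_wpM2r => //; rewrite mulr_ge0// mulr_ge0.
rewrite mul1r; apply: ler_wpM2r => //; exact: ler_wpM2l.
Qed.

Lemma not_box3 e x t : 0 < e -> ~ box3 e x -> e ^+ 2 < rsq (t, x).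
Proof.
move=> e0 xe; rewrite rsqE ltNge; apply/negP => h; apply: xe.
have xe : enorm x <= e by rewrite -(@ler_sqr R) ?nnegrE ?enorm_ge0// ltW.
have [c1 c2 c3] := coord_le_enorm x.
by apply/box3P; split; [exact: le_trans c1 xe|exact: le_trans c2 xe|exact: le_trans c3 xe].
Qed.

Lemma edens_ge0 k t x : 0 < k -> 0 <= t -> k <= rsq (t, x) -> 0 <= edens k s d phi (t, x).
Proof.
move=> k0 t0 kz; have [xt|xt] := leP (enorm x) (t + 1); last first.
  by have [-> _ _ _ _] := jet0_energy s d k (outside_jet sw sF t0 xt).
apply: le_trans (edens_lower phi s1 d0 k0 t0 kz xt); apply: mulr_ge0; first exact: powR_ge0.
apply: addr_ge0; first by apply: addr_ge0; exact: sqr_ge0.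
exact: (Z2_ge0 phi k0 kz).
Qed.

Lemma pdens_ge0 k t x : 0 < k -> 0 <= t -> 0 <= pdens s d phi k (t, x).
Proof.
move=> k0 t0; have /andP[c0 _] := chi_bounds k (t, x).
have [zk|kz] := ltP (rsq (t, x)) k.
  by have [c _] := chi_small k0 zk; rewrite /pdens c mul0r.
by rewrite mulr_ge0// edens_ge0.
Qed.

Lemma radial_dens_ge0 k z : 0 < k -> 0 <= radial_dens s phi k z.
Proof.
move=> k0; have /andP[c0 _] := chi_bounds k z.
apply: mulr_ge0 => //; apply: mulr_ge0; first exact/ltW/pw_gt0.
by apply: mulr_ge0; [exact/ltW/pw_gt0|exact: sqr_ge0].
Qed.

Lemma bulk_ge0 k z : 0 <= bulk s d phi k z.
Proof.
have /andP[c0 _] := chi_bounds k z.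
apply: mulr_ge0 => //; apply: mulr_ge0; last exact: sqr_ge0.
apply: mulr_ge0; first by rewrite invr_ge0 ltW.
by apply: mulr_ge0; exact/ltW/pw_gt0.
Qed.

Lemma continuous_radial_dens k : 0 < k -> continuous (radial_dens s phi k).
Proof.
move=> k0; have D1 e := C2_derive e f2.
exact: (C1_continuous (C1M (C1_chi k) (C1M (C1_pw s (C1_uu k0)) (C1M (C1_irsq k0)
    (C1X (C1D (C1D (C1M C1_X1 (D1 _)) (C1M C1_X2 (D1 _))) (C1M C1_X3 (D1 _)))))))).
Qed.

Lemma continuous_abs (g : spacetime R -> R) : continuous g -> continuous (fun z => `|g z|).
Proof. by move=> cg z; apply: cvg_norm; exact: cg. Qed.

Lemma continuous_hardy_err k : 0 < k -> continuous (hardy_err s phi k).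
Proof.
move=> k0; have ch := C1_continuous (C1M (C1_pw s (C1_uu k0)) (C1X (C2_C1 f2))).
by move=> z; apply: cvgM; [exact: continuous_dsigma_rsq|exact: ch].
Qed.

Lemma integral_bulk_le k T N : 0 < k -> 0 < T -> 0 < N ->
  (\int[leb4]_(z in slab T N) (bulk s d phi k z)%:E <= (d^-1)%:E * I4)%E.
Proof.
move=> k0 T0 N0; have cb := continuous_bulk (s := s) (d := d) sw k0.
have mS := measurable_slab T N.
have b0 := bulk_ge0 k.
under eq_integral => z _.
  rewrite (_ : bulk s d phi k z = d^-1 * (d * bulk s d phi k z)); last first.
    by rewrite mulrA mulVf ?mul1r// gt_eqF.
  rewrite EFinM; over.
rewrite ge0_integralZl_EFin//; last 3 first.
- by move=> z _; rewrite lee_fin mulr_ge0// ltW.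
- apply/measurable_EFinP; apply: measurable_funTS; apply: measurable_funM => //.
  exact: continuous_measurable_spacetime.
- by rewrite invr_ge0 ltW.
apply: lee_wpmul2l; first by rewrite lee_fin invr_ge0 ltW.
rewrite [leLHS]integral_mkcond; apply: ge0_le_integral_any => z _.
  by apply: erestrict_ge0 => z' _; rewrite lee_fin mulr_ge0// ltW.
rewrite patchE; case: ifPn => zS; last by rewrite lee_fin sqr_ge0.
case: z zS => t x /set_mem[/=]; rewrite in_itv/= => /andP[t0 _] _.
by rewrite lee_fin; exact: bulk_le_source.
Qed.

(** With k = e^2 / 2 the cutoff is constant where r >= e, so the error lives in the cube of
    half-side [e]: at most C / k times T (2e)^3, that is 16 C T e. *)
Lemma integral_cutoff_err_le T N : 0 < T -> 0 < N -> exists2 C, 0 <= C & forall e, 0 < e <= 1 ->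
  (\int[leb4]_(z in slab T N) (`|cutoff_err s d phi (e ^+ 2 / 2) z|)%:E <= (C * e)%:E)%E.
Proof.
move=> T0 N0; have [C C0 HC] := cutoff_err_bound s d f2 T.
exists (16 * C * T); first by rewrite mulr_ge0 ?ltW// mulr_gt0.
move=> e /andP[e0 e1].
have k0 : 0 < e ^+ 2 / 2 by rewrite divr_gt0// exprn_gt0.
have k1 : 2 * (e ^+ 2 / 2) <= 1.
  by rewrite mulrC divfK ?pnatr_eq0// expr_le1// ltW.
set k := e ^+ 2 / 2 in k0 k1 *.
have kE : 2 * k = e ^+ 2 by rewrite /k mulrC divfK ?pnatr_eq0.
apply: (@le_trans _ _ ((C / k)%:E * leb4 (slab T e))%E).
  apply: integral_small_support; [exact: measurable_slab|exact: measurable_slab| |].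
    by rewrite divr_ge0// ltW.
  move=> [t x] [/=]; rewrite in_itv/= => /andP[t0 tT] _; rewrite normr_ge0/=.
  have [xe|xe] := pselect (box3 e x).
    rewrite indicE mem_set ?mulr1; last by split => //=; rewrite in_itv/= t0.
    by apply: HC => //; rewrite ltW.
  rewrite indicE memNset ?mulr0; last by move=> [].
  have h2 : 2 * k <= rsq (t, x) by rewrite kE ltW// not_box3.
  by have [_ h] := chi_big k0 h2; rewrite /cutoff_err h ?mul0r ?normr0.
rewrite [leLHS](_ : _ = ((C / k) * (T * (8 * e ^+ 3)))%:E); last first.
  by rewrite [RHS]EFinM; congr (_ * _)%E; exact: leb4_slab (ltW T0) (ltW e0).
by rewrite lee_fin /k le_eqVlt; apply/orP; left; apply/eqP; field; rewrite gt_eqF.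
Qed.

Lemma integral_hardy_err_le T N : 0 <= T -> exists2 C, 0 <= C & forall e, 0 < e <= 1 ->
  (\int[leb3]_(x in box3 N) (`|hardy_err s phi (e ^+ 2 / 2) (T, x)|)%:E <= (C * e)%:E)%E.
Proof.
move=> T0; have [C C0 HC] := hardy_err_bound s d f2 T0.
exists (16 * C); first by rewrite mulr_ge0 ?ltW.
move=> e /andP[e0 e1].
have k0 : 0 < e ^+ 2 / 2 by rewrite divr_gt0// exprn_gt0.
have k1 : 2 * (e ^+ 2 / 2) <= 1.
  by rewrite mulrC divfK ?pnatr_eq0// expr_le1// ltW.
set k := e ^+ 2 / 2 in k0 k1 *.
have kE : 2 * k = e ^+ 2 by rewrite /k mulrC divfK ?pnatr_eq0.
apply: (@le_trans _ _ ((C / k)%:E * leb3 (box3 e))%E).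
  apply: integral_small_support; [exact: measurable_box3|exact: measurable_box3| |].
    by rewrite divr_ge0// ltW.
  move=> x _; rewrite normr_ge0/=.
  have [xe|xe] := pselect (box3 e x).
    by rewrite indicE mem_set ?mulr1//; apply: HC.
  rewrite indicE memNset ?mulr0//.
  have h2 : 2 * k <= rsq (T, x) by rewrite kE ltW// not_box3.
  by have [_ h] := chi_big k0 h2; rewrite /hardy_err h ?mul0r ?normr0.
rewrite [leLHS](_ : _ = ((C / k) * (8 * e ^+ 3))%:E); last first.
  by rewrite [RHS]EFinM; congr (_ * _)%E; exact: leb3_box3 (ltW e0).
by rewrite lee_fin /k le_eqVlt; apply/orP; left; apply/eqP; field; rewrite gt_eqF.
Qed.

(** [B] stands for I4 / d, which may be infinite. *)
Lemma ereal_four (B : \bar R) (p q : R) : (0 <= B)%E ->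
  ((B + p%:E) + (B + p%:E) + ((B + p%:E + q%:E) + (B + p%:E + q%:E))
   = (B + B + B + B) + (4 * p + 2 * q)%:E)%E.
Proof. by case: B => [r _| _|]//; rewrite -!EFinD; congr EFin; ring. Qed.

Lemma ereal_quadruple (c : R) (B : \bar R) : 0 < c -> (0 <= B)%E ->
  (c%:E * B + c%:E * B + c%:E * B + c%:E * B = (4 * c)%:E * B)%E.
Proof.
move=> c0; case: B => [r _|_|]//; first by rewrite -!EFinM -!EFinD; congr EFin; ring.
by rewrite !gt0_muley ?lte_fin ?mulr_gt0.
Qed.

Lemma ereal_triple (c : R) (B : \bar R) : 0 < c -> (0 <= B)%E ->
  (c%:E * B + c%:E * B + c%:E * B = (3 * c)%:E * B)%E.
Proof.
move=> c0; case: B => [r _|_|]//; first by rewrite -!EFinM -!EFinD; congr EFin; ring.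
by rewrite !gt0_muley ?lte_fin ?mulr_gt0.
Qed.

(** A common majorant of the three squared integrands off the cube of half-side [e]; the factor 2 is
    that of [target_algebra]. *)
Let M T e x := 2 * (pdens s d phi (e ^+ 2 / 2) (T, x) + radial_dens s phi (e ^+ 2 / 2) (T, x)).

Lemma half_sqr_gt0 (e : R) : 0 < e <= 1 -> 0 < e ^+ 2 / 2.
Proof. by move=> /andP[e0 _]; rewrite divr_gt0// exprn_gt0. Qed.

(** The integral of [pdens] is at most I4 / d by the energy inequality, and so is that of
    [radial_dens] by the Hardy inequality, both up to O(e). Twice their sum makes 4 / d. *)
Lemma integral_truncated_le T N : 0 < T -> T + 1 < N -> exists2 C, 0 <= C & forall e, 0 < e <= 1 ->
  (\int[leb3]_(x in box3 N) (M T e x)%:E <= (4 / d)%:E * I4 + (C * e)%:E)%E.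
Proof.
move=> T0 TN; have N0 : 0 < N by lra.
have [C1 C10 H1] := integral_cutoff_err_le T0 N0.
have [C2 C20 H2] := integral_hardy_err_le N (ltW T0).
exists (4 * C1 + 2 * C2); first by rewrite addr_ge0// mulr_ge0.
move=> e e01; have k0 := half_sqr_gt0 e01.
set k := e ^+ 2 / 2 in k0 *; rewrite /M -/k.
have mB := measurable_box3 N.
have B0 : (0 <= (d^-1)%:E * I4)%E by rewrite mule_ge0// lee_fin invr_ge0 ltW.
have mp : measurable_fun (box3 N) (fun x => (pdens s d phi k (T, x))%:E).
  apply/measurable_EFinP/measurable_funTS.
  exact: (measurable_slice T (C1_continuous (C1_pdens s d sw k0))).
have mr : measurable_fun (box3 N) (fun x => (radial_dens s phi k (T, x))%:E).
  apply/measurable_EFinP/measurable_funTS.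
  exact: (measurable_slice T (continuous_radial_dens k0)).
have mh : measurable_fun (box3 N) (fun x => (`|hardy_err s phi k (T, x)|)%:E).
  apply/measurable_EFinP/measurable_funTS.
  exact: (measurable_slice T (continuous_abs (continuous_hardy_err k0))).
have p0 x : box3 N x -> (0 <= (pdens s d phi k (T, x))%:E)%E.
  by move=> _; rewrite lee_fin; apply: pdens_ge0 => //; exact: ltW.
have r0 x : box3 N x -> (0 <= (radial_dens s phi k (T, x))%:E)%E.
  by move=> _; rewrite lee_fin; exact: radial_dens_ge0.
have J1 : (\int[leb3]_(x in box3 N) (pdens s d phi k (T, x))%:E <= (d^-1)%:E * I4 + (C1 * e)%:E)%E.
  apply: le_trans (truncated_energy_le s1 s2 d0 ds sw sF k0 T0 TN) _.
  have mS := measurable_slab T N.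
  have cb := continuous_bulk (s := s) (d := d) sw k0; have cc := continuous_cutoff_err (s := s) (d := d) sw k0.
  apply: (@le_trans _ _ (\int[leb4]_(z in slab T N) ((bulk s d phi k z)%:E + (`|cutoff_err s d phi k z|)%:E))%E).
    apply: le_integral => //.
    - apply: (integrable_slab (ltW T0) (ltW N0)).
      by move=> z; apply: cvgD; [exact: cb|exact: cc].
    - apply: (integrable_slab (ltW T0) (ltW N0) (f := fun z => bulk s d phi k z + `|cutoff_err s d phi k z|)).
      by move=> z; apply: cvgD; [exact: cb|exact: continuous_abs cc z].
    - by move=> z _; rewrite -EFinD lee_fin lerD2l ler_norm.
  rewrite ge0_integralD//; last 3 first.
  - by move=> z _; rewrite lee_fin; exact: bulk_ge0.
  - by apply/measurable_EFinP/measurable_funTS; exact: continuous_measurable_spacetime.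
  - apply/measurable_EFinP/measurable_funTS; apply: continuous_measurable_spacetime.
    exact: continuous_abs.
  by apply: leeD; [exact: integral_bulk_le|exact: H1].
have J2 : (\int[leb3]_(x in box3 N) (radial_dens s phi k (T, x))%:E
    <= (d^-1)%:E * I4 + (C1 * e)%:E + (C2 * e)%:E)%E.
  apply: le_trans (hardy_energy_le s1 d0 sw sF k0 (ltW T0) TN) _.
  apply: (@le_trans _ _ (\int[leb3]_(x in box3 N) ((pdens s d phi k (T, x))%:E + (`|hardy_err s phi k (T, x)|)%:E))%E).
    have cp := C1_continuous (C1_pdens s d sw k0); have ch := continuous_hardy_err k0.
    apply: le_integral => //.
    - apply: (@integrable_box3 _ (fun z => pdens s d phi k z + hardy_err s phi k z) T N (ltW N0)).
      by move=> z; apply: cvgD; [exact: cp|exact: ch].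
    - apply: (@integrable_box3 _ (fun z => pdens s d phi k z + `|hardy_err s phi k z|) T N (ltW N0)).
      by move=> z; apply: cvgD; [exact: cp|exact: continuous_abs ch z].
    - by move=> x _; rewrite -EFinD lee_fin lerD2l ler_norm.
  by rewrite ge0_integralD//; apply: leeD => //; exact: H2.
under eq_integral => x _.
  rewrite (_ : 2 * _ = pdens s d phi k (T, x) + pdens s d phi k (T, x)
    + (radial_dens s phi k (T, x) + radial_dens s phi k (T, x))); last by ring.
  rewrite !EFinD; over.
rewrite ge0_integralD//; last 4 first.
- by move=> x xN; rewrite adde_ge0// p0.
- exact: emeasurable_funD.
- by move=> x xN; rewrite adde_ge0// r0.
- exact: emeasurable_funD.
rewrite !ge0_integralD//.
apply: (le_trans (leeD (leeD J1 J1) (leeD J2 J2))).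
rewrite ereal_four// ereal_quadruple ?invr_gt0//.
by rewrite le_eqVlt; apply/orP; left; apply/eqP; congr (_ + _%:E)%E; ring.
Qed.

(** Isolates what the three integrands share. The bound is asked for every admissible [k], so that
    off the cube of half-side [e] it can be used with k = e^2 / 2, where the cutoff is 1 and [M] is
    a majorant; then [e] tends to 0. *)
Lemma slice_norm_le T (g : R3 R -> R) : 0 <= T ->
  (T = 0 -> forall x, g x = 0) -> (forall x, T + 1 < enorm x -> g x = 0) ->
  (forall k x, 0 < k -> k <= rsq (T, x) -> enorm x <= T + 1 ->
    g x ^+ 2 <= 2 * (edens k s d phi (T, x)
      + uu k (T, x) `^ s * (irsq k (T, x) * radial phi (T, x) ^+ 2))) ->
  (L2_R3 g <= (Num.sqrt (4 / d))%:E * source_norm s delta F)%E.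
Proof.
move=> T0 g0 gout gM; apply: L2_norm_le; first exact: sqrtr_ge0.
have d4 : 0 <= 4 / d by rewrite divr_ge0// ltW.
rewrite sqr_sqrtr// -/source -/I4.
have [TE|Tn] := eqVneq T 0.
  rewrite integral0_eq; last by move=> x _; rewrite g0// expr0n.
  by rewrite mule_ge0// lee_fin.
have Tp : 0 < T by rewrite lt_neqAle eq_sym Tn.
have TN : T + 1 < T + 2 by lra.
have [C C0 HC] := integral_truncated_le Tp TN.
apply: (@integral_limit_bound _ _ (T + 2) C _ (M T)) => //.
- by move=> x; rewrite lee_fin sqr_ge0.
- move=> x xN; rewrite gout ?expr0n//.
  have N2 : 0 < T + 2 by lra.
  have := not_box3 0 N2 xN; rewrite rsqE ltr_sqr ?nnegrE ?enorm_ge0 ?ltW//; lra.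
- move=> e e01; have k0 := half_sqr_gt0 e01.
  have cp := C1_continuous (C1_pdens s d sw k0); have cr := continuous_radial_dens k0.
  apply: (@measurable_slice _ (fun z => 2 * (pdens s d phi (e ^+ 2 / 2) z + radial_dens s phi (e ^+ 2 / 2) z)) T).
  by move=> z; apply: cvgM; [exact: cvg_cst|apply: cvgD; [exact: cp|exact: cr]].
- move=> e x e01; have k0 := half_sqr_gt0 e01.
  by rewrite mulr_ge0// addr_ge0// ?pdens_ge0 ?radial_dens_ge0.
- move=> e x e01 xN xe; have k0 := half_sqr_gt0 e01; have /andP[e0 _] := e01.
  rewrite lee_fin; have [xt|xt] := leP (enorm x) (T + 1); last first.
    by rewrite gout// expr0n/= mulr_ge0// addr_ge0// ?pdens_ge0 ?radial_dens_ge0.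
  have h := not_box3 T e0 xe.
  have kE : 2 * (e ^+ 2 / 2) = e ^+ 2 by rewrite mulrC divfK ?pnatr_eq0.
  have k2 : 2 * (e ^+ 2 / 2) <= rsq (T, x) by rewrite kE ltW.
  have kz : e ^+ 2 / 2 <= rsq (T, x) by lra.
  have [c1 _] := chi_big k0 k2.
  apply: le_trans (gM _ _ k0 kz xt) _.
  rewrite /M /pdens /radial_dens c1 !mul1r pwE//; exact: uu_ge1.
Qed.

Lemma irsqE k t x : 0 < k -> k <= rsq (t, x) -> irsq k (t, x) = (enorm x ^+ 2)^-1.
Proof.
move=> k0 kz; have := rsq_irsq k0 kz; rewrite rsqE => E.
have x0 : enorm x ^+ 2 != 0 by rewrite -(rsqE t) gt_eqF//; exact: lt_le_trans kz.
by apply: (mulfI x0); rewrite E mulfV.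
Qed.

Lemma target_algebra (p y2 S2 Z2 q D P G E m : R) : 0 <= p -> 0 <= y2 -> 0 <= S2 -> 0 <= Z2 ->
  0 <= q -> S2 = q * (D + P) ^+ 2 -> Z2 = G - q * D ^+ 2 -> p * (y2 + S2 + Z2) <= E ->
  m <= Z2 ->
  [/\ p * (y2 + G) <= 2 * (E + p * (q * D ^+ 2)),
      p * (q * P ^+ 2) <= 2 * (E + p * (q * D ^+ 2))
    & p * m <= 2 * (E + p * (q * D ^+ 2))].
Proof.
move=> p0 y0 S0 Z0 q0 SE ZE HE mZ.
have D0 : 0 <= q * D ^+ 2 by rewrite mulr_ge0 ?sqr_ge0.
have GE : G = Z2 + q * D ^+ 2 by rewrite ZE subrK.
have PE : q * P ^+ 2 <= 2 * S2 + 2 * (q * D ^+ 2).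
  rewrite SE -subr_ge0.
  have -> : 2 * (q * (D + P) ^+ 2) + 2 * (q * D ^+ 2) - q * P ^+ 2 = q * (2 * D + P) ^+ 2 by ring.
  by rewrite mulr_ge0 ?sqr_ge0.
have E2 : 2 * (p * (y2 + S2 + Z2) + p * (q * D ^+ 2)) <= 2 * (E + p * (q * D ^+ 2)).
  by rewrite ler_pM2l// lerD2r.
have fac : 2 * (p * (y2 + S2 + Z2) + p * (q * D ^+ 2)) = p * (2 * (y2 + S2 + Z2 + q * D ^+ 2)) by ring.
rewrite fac in E2.
split; apply: le_trans E2; apply: ler_wpM2l => //; lra.
Qed.

Lemma energy_norm_le T : 0 <= T ->
  (energy_norm s phi T <= (3 * Num.sqrt (4 / d))%:E * source_norm s delta F)%E.
Proof.
move=> T0.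
have c0 : 0 < Num.sqrt (4 / d) by rewrite sqrtr_gt0 divr_gt0.
have sn0 : (0 <= source_norm s delta F)%E by exact: Lnorm_ge0.
rewrite -ereal_triple// /energy_norm.
have sqr_w x : wminus T x (s / 2) ^+ 2 = (T + 2 - enorm x) `^ s by exact: powR_half_sqr.
have fC1 := C2_C1 f2.
have jet_grad x : [/\ phi (T, x) = 0, 'D_dir_t phi (T, x) = 0, 'D_dir_x1 phi (T, x) = 0,
      'D_dir_x2 phi (T, x) = 0 & 'D_dir_x3 phi (T, x) = 0] ->
    [/\ grad_tx phi (T, x) = 0, phi (T, x) / enorm x = 0 & grad_S2 (fun y => phi (T, y)) x / enorm x = 0].
  move=> [p0 y0 h1 h2 h3]; split.
  - by rewrite /grad_tx y0 h1 h2 h3 expr0n/= !addr0 sqrtr0.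
  - by rewrite p0 mul0r.
  have := grad_S2_sqr_le T x fC1; rewrite h1 h2 h3 expr0n/= !mulr0 !addr0 mulr0 expr0n/= subr0.
  move=> h; have /eqP : grad_S2 (fun y => phi (T, y)) x ^+ 2 == 0 by rewrite eq_le h sqr_ge0.
  by move/eqP; rewrite sqrf_eq0 => /eqP ->; rewrite mul0r.
have jets x : T = 0 \/ T + 1 < enorm x ->
    [/\ grad_tx phi (T, x) = 0, phi (T, x) / enorm x = 0 & grad_S2 (fun y => phi (T, y)) x / enorm x = 0].
  move=> H; apply: jet_grad; case: H => [->|xt]; first exact: initial_jet sw.
  exact: outside_jet sw sF T0 xt.
have main k x : 0 < k -> k <= rsq (T, x) -> enorm x <= T + 1 ->
    let B := 2 * (edens k s d phi (T, x)
      + uu k (T, x) `^ s * (irsq k (T, x) * radial phi (T, x) ^+ 2)) in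
  [/\ (T + 2 - enorm x) `^ s * grad_tx phi (T, x) ^+ 2 <= B,
      (T + 2 - enorm x) `^ s * (phi (T, x) / enorm x) ^+ 2 <= B
    & (T + 2 - enorm x) `^ s * (grad_S2 (fun y => phi (T, y)) x / enorm x) ^+ 2 <= B].
  move=> k0 kz xt B.
  have q0 : 0 <= irsq k (T, x) by exact/ltW/pw_gt0.
  have [SE ZE _] := radial_energy phi k0 kz.
  have Z0 := Z2_ge0 phi k0 kz.
  have HE := edens_lower phi s1 d0 k0 T0 kz xt.
  have qE := irsqE k0 kz.
  have gz : (grad_S2 (fun y => phi (T, y)) x / enorm x) ^+ 2
     <= eGG k phi (T, x) - eS k phi (T, x) ^+ 2.
    rewrite ZE qE expr_div_n ler_pdivrMr; last first.
      by rewrite -(rsqE T); exact: lt_le_trans kz.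
    apply: le_trans (grad_S2_sqr_le T x fC1) _; rewrite le_eqVlt; apply/orP; left; apply/eqP.
    have x0 : enorm x ^+ 2 != 0 by rewrite -(rsqE T) gt_eqF//; exact: lt_le_trans kz.
    have clear_denominator (a G D : R) : a != 0 -> a * G - D = (G - a^-1 * D) * a.
      by move=> a0; field.
    exact: clear_denominator.
  have [t1 t2 t3] := target_algebra (powR_ge0 _ s) (sqr_ge0 ('D_dir_t phi (T, x)))
    (sqr_ge0 (eS k phi (T, x))) Z0 q0 SE ZE HE gz.
  rewrite -/B in t1 t2 t3; rewrite (uuE k0 kz) in t1 t2 t3.
  split.
  - apply: le_trans t1; rewrite le_eqVlt; apply/orP; left; apply/eqP; congr (_ * _).
    rewrite /grad_tx sqr_sqrtr; first by rewrite /gradsq !addrA.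
    by rewrite !addr_ge0// sqr_ge0.
  - by rewrite expr_div_n -qE (mulrC (phi _ ^+ 2)).
  - exact: t3.
apply: leeD; first apply: leeD; apply: (slice_norm_le T0).
- by move=> TE x; have [-> _ _] := jets x (or_introl TE); rewrite mulr0.
- by move=> x xt; have [-> _ _] := jets x (or_intror xt); rewrite mulr0.
- by move=> k x k0 kz xt; have [h _ _] := main k x k0 kz xt; rewrite exprMn sqr_w.
- by move=> TE x; have [_ -> _] := jets x (or_introl TE); rewrite mulr0.
- by move=> x xt; have [_ -> _] := jets x (or_intror xt); rewrite mulr0.
- by move=> k x k0 kz xt; have [_ h _] := main k x k0 kz xt; rewrite exprMn sqr_w.
- by move=> TE x; have [_ _ ->] := jets x (or_introl TE); rewrite mulr0.
- by move=> x xt; have [_ _ ->] := jets x (or_intror xt); rewrite mulr0.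
- by move=> k x k0 kz xt; have [_ _ h] := main k x k0 kz xt; rewrite exprMn sqr_w.
Qed.

End assembly.

Unset Implicit Arguments.

Theorem theorem2p1 (R : realType) (s delta : R) :
  1 < s -> s < 2 -> 0 < delta ->
  exists C : R, 0 < C /\
    forall F phi : spacetime R -> R,
      solves_wave F phi ->
      supp F `<=` [set z | enorm z.2 <= z.1 + 1] ->
      (ereal_sup [set energy_norm s phi t | t in [set t : R | (0 <= t)%R]]
        <= C%:E * source_norm s delta F)%E.
Proof.
move=> s1 s2 delta0.
pose d := Num.min delta ((s - 1) / 2).
have d0 : 0 < d by rewrite lt_min delta0/=; lra.
have dd : d <= delta by rewrite ge_min lexx.
have ds : 1 + 2 * d <= s.
  have d2 : d <= (s - 1) / 2 by rewrite ge_min lexx orbT.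
  by lra.
(* Each of the three norms costs sqrt (4 / d). The exponent [s] enters through [d] alone: for s >= 1
   + 2 delta the constant is 6 / sqrt delta. *)
exists (3 * Num.sqrt (4 / d)); split.
  by rewrite mulr_gt0// sqrtr_gt0 divr_gt0.
move=> F phi sw sF; apply: ge_ereal_sup => _ [t t0 <-].
exact: (energy_norm_le s1 s2 d0 ds dd sw sF t0).
Qed.
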